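(* For any integer $\gamma \geq 0$, $\mathsf{Dias}_\gamma$ is a Koszul operad. Moreover, the set of hook syntax trees of $\mathbf{Free}(\{\dashv_a, \vdash_a : a \in [\gamma]\})$ forms a Poincaré-Birkhoff-Witt basis of $\mathsf{Dias}_\gamma$.
   Context: The ground field has characteristic zero; operad means nonsymmetric operad; $[\gamma] = \{1, \dots, \gamma\}$. Definition of $\mathsf{Dias}_\gamma$: let $\mathcal{M}_\gamma$ be the monoid $\{0\} \cup [\gamma]$ with product $\max$. The operad $\mathsf{T}\mathcal{M}_\gamma$ has as component of arity $n \geq 1$ the linear span of the words of length $n$ on $\mathcal{M}_\gamma$, with $u \circ_i v := u_1 \dots u_{i-1}\, \max(u_i, v_1) \dots \max(u_i, v_m)\, u_{i+1} \dots u_n$ and unit the word $0$. $\mathsf{Dias}_\gamma$ is the suboperad generated by the words $0a$ and $a0$, $a \in [\gamma]$; it is also a set-operad. It is binary and quadratic: it is isomorphic to the quotient of the free operad $\mathbf{Free}(\{\dashv_a, \vdash_a : a \in [\gamma]\})$ (spanned by planar binary trees, called syntax trees, with internal nodes labeled by the generators) by the ideal generated by the elements (for all $a, a' \in [\gamma]$, with $\uparrow$ denoting $\max$) $\dashv_a \circ_1 \vdash_{a'} - \vdash_{a'} \circ_2 \dashv_a$; $\dashv_a \circ_1 \dashv_{a \uparrow a'} - \dashv_a \circ_2 \vdash_{a'}$; $\vdash_a \circ_1 \dashv_{a'} - \vdash_a \circ_2 \vdash_{a \uparrow a'}$; $\dashv_{a \uparrow a'} \circ_1 \dashv_a - \dashv_a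 \circ_2 \dashv_{a'}$; $\vdash_a \circ_1 \vdash_{a'} - \vdash_{a \uparrow a'} \circ_2 \vdash_a$, the generators $\dashv_a$ and $\vdash_a$ corresponding to the words $0a$ and $a0$. Hook syntax trees: these are the syntax trees indexed by pairs $(u, v)$ of (possibly empty) words on $[\gamma]$, defined as follows with $k = |u|$ and $\ell = |v|$. The tree consists of a left comb whose internal nodes are labeled, from bottom to top, by $\dashv_{v_1}, \dots, \dashv_{v_\ell}$ (all right children in this comb are leaves), where on the leftmost leaf of this comb is grafted a right comb whose internal nodes are labeled, from top to bottom, by $\vdash_{u_1}, \dots, \vdash_{u_k}$ (all left children in it are leaves, as is the last right child). As an expression in inputs $x_1, x_2, \dots$ it reads $(\cdots((x_1 \vdash_{u_1} (x_2 \vdash_{u_2} (\cdots (x_k \vdash_{u_k} x_{k+1}) \cdots))) \dashv_{v_1} x_{k+2}) \cdots) \dashv_{v_\ell} x_{k+\ell+1}$. A quadratic operad is Koszul if its Koszul complex is acyclic (Ginzburg–Kapranov). Poincaré-Birkhoff-Witt bases are those of Hoffbeck, used in the following form for set-operads: if $S$ is a graded set and $\to$ is a quadratic rewrite rule on syntax trees on $S$ (rewriting trees with two internal nodes into trees with two internal nodes of the same arity, applied inside larger trees by replacing partial subtrees) which is convergent (terminating and confluent), and if $\mathcal{O}$ is isomorphic to the quotient of the free set-operad on $S$ by the operad congruence induced by $\to$, then the set of normal forms of $\to$ is a Poincaré-Birkhoff-Witt basis of $\mathcal{O}$. *)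

(* Defs.v *)
From HB Require Import structures.
From mathcomp Require Import all_boot all_order all_algebra.
From mathcomp Require Import zify.
From mathcomp Require Export finmap.
From mathcomp.multinomials Require Export monalg.
From Stdlib Require Import Relations.

Set Implicit Arguments.
Unset Strict Implicit.
Unset Printing Implicit Defensive.

Import Order.TTheory GRing.Theory.

(* Nonsymmetric set-operads without element of arity 0.  The underlying
   graded set is {x | op_mem x}, graded by op_arity; op_comp x i y is the
   partial composition x o_i y, with positions i starting at 1, and is
   meaningless unless 1 <= i <= op_arity x. *)
Record operad := Operad {
  op_sort :> choiceType;
  op_mem : op_sort -> Prop;
  op_arity : op_sort -> nat;
  op_unit : op_sort;
  op_comp : op_sort -> nat -> op_sort -> op_sort;
  op_arity_gt0 : forall x, op_mem x -> 0 < op_arity x;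
  op_unit_mem : op_mem op_unit;
  op_arity_unit : op_arity op_unit = 1;
  op_comp_mem : forall x i y, op_mem x -> op_mem y -> 0 < i <= op_arity x ->
    op_mem (op_comp x i y);
  op_arity_comp : forall x i y, op_mem x -> op_mem y -> 0 < i <= op_arity x ->
    op_arity (op_comp x i y) = (op_arity x + op_arity y).-1;
  op_unit_comp : forall x, op_mem x -> op_comp op_unit 1 x = x;
  op_comp_unit : forall x i, op_mem x -> 0 < i <= op_arity x ->
    op_comp x i op_unit = x;
  op_comp_seq : forall x y z i j, op_mem x -> op_mem y -> op_mem z ->
    0 < i <= op_arity x -> 0 < j <= op_arity y ->
    op_comp (op_comp x i y) (i + j).-1 z = op_comp x i (op_comp y j z);
  op_comp_par : forall x y z i j, op_mem x -> op_mem y -> op_mem z ->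
    0 < i -> i < j -> j <= op_arity x ->
    op_comp (op_comp x i y) (j + op_arity y).-1 z =
    op_comp (op_comp x j z) i y
}.

Inductive generated_mem (O : operad) (G : O -> Prop) : O -> Prop :=
| generated_unit : generated_mem G (op_unit O)
| generated_gen x : op_mem x -> G x -> generated_mem G x
| generated_comp x i y : generated_mem G x -> generated_mem G y ->
    0 < i <= op_arity x -> generated_mem G (op_comp x i y).

Lemma generated_memW (O : operad) (G : O -> Prop) x :
  generated_mem G x -> op_mem x.
Proof.
elim=> [|//|y i z _ my _ mz iy]; first exact: op_unit_mem.
exact: op_comp_mem.
Qed.

Definition generated_suboperad (O : operad) (G : O -> Prop) : operad.
Proof.
apply: (@Operad O (generated_mem G) (@op_arity O) (op_unit O) (@op_comp O)).
- by move=> x /generated_memW; apply: op_arity_gt0.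
- exact: generated_unit.
- exact: op_arity_unit.
- exact: generated_comp.
- by move=> x i y /generated_memW ? /generated_memW ?; apply: op_arity_comp.
- by move=> x /generated_memW; apply: op_unit_comp.
- by move=> x i /generated_memW; apply: op_comp_unit.
- move=> x y z i j /generated_memW ? /generated_memW ? /generated_memW ?.
  exact: op_comp_seq.
- move=> x y z i j /generated_memW ? /generated_memW ? /generated_memW ?.
  exact: op_comp_par.
Defined.

Inductive operad_congruence (O : operad) (r : O -> O -> Prop) : O -> O -> Prop :=
| cong_base x y : r x y -> operad_congruence r x y
| cong_refl x : op_mem x -> operad_congruence r x x
| cong_sym x y : operad_congruence r x y -> operad_congruence r y x
| cong_trans x y z : operad_congruence r x y -> operad_congruence r y z ->
    operad_congruence r x z
| cong_comp x x' y y' i : operad_congruence r x x' ->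
    operad_congruence r y y' -> 0 < i <= op_arity x ->
    operad_congruence r (op_comp x i y) (op_comp x' i y').

(* Syntax trees on a set S of generators all of which are of arity 2. *)
Inductive stree (S : Type) := leaf | node of S & stree S & stree S.
Arguments leaf {S}.

Section TreeChoice.
Variable S : choiceType.

Fixpoint stree_encode (t : stree S) : GenTree.tree S :=
  if t is node s l r
  then GenTree.Node 1 [:: GenTree.Leaf s; stree_encode l; stree_encode r]
  else GenTree.Node 0 [::].

Fixpoint stree_decode (t : GenTree.tree S) : option (stree S) :=
  match t with
  | GenTree.Node 0 [::] => Some leaf
  | GenTree.Node 1 [:: GenTree.Leaf s; l; r] =>
      if (stree_decode l, stree_decode r) is (Some l', Some r')
      then Some (node s l' r') else None
  | _ => None
  end.

Lemma stree_encodeK : pcancel stree_encode stree_decode.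
Proof. by elim=> //= s l -> r ->. Qed.

HB.instance Definition _ := Choice.copy (stree S) (pcan_type stree_encodeK).
End TreeChoice.

Section Trees.
Variable S : Type.
Implicit Types (t u : stree S).

Fixpoint leaves t := if t is node _ l r then leaves l + leaves r else 1.

Fixpoint nodes t := if t is node _ l r then (nodes l + nodes r).+1 else 0.

Definition corolla (s : S) : stree S := node s leaf leaf.

Fixpoint tree_comp t (i : nat) u : stree S :=
  if t is node s l r then
    if i <= leaves l then node s (tree_comp l i u) r
    else node s l (tree_comp r (i - leaves l) u)
  else u.

(* The full composition t o (us_1, ..., us_n), n the number of leaves of t. *)
Fixpoint graft t (us : seq (stree S)) : stree S :=
  if t is node s l r then
    node s (graft l (take (leaves l) us)) (graft r (drop (leaves l) us))
  else head leaf us.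

Lemma leaves_gt0 t : 0 < leaves t.
Proof. by elim: t => //= s l hl r hr; lia. Qed.

Lemma leaves_comp t i u : 0 < i <= leaves t ->
  leaves (tree_comp t i u) = (leaves t + leaves u).-1.
Proof.
elim: t i => [|s l IHl r IHr] i /= hi; first by lia.
have := leaves_gt0 l; have := leaves_gt0 r.
by case: ifP => /= hil; rewrite ?IHl ?IHr; lia.
Qed.

Lemma tree_comp_leaf t i : tree_comp t i leaf = t.
Proof. by elim: t i => //= s l IHl r IHr i; case: ifP; rewrite ?IHl ?IHr. Qed.

Lemma tree_comp_seq t u v i j : 0 < i <= leaves t -> 0 < j <= leaves u ->
  tree_comp (tree_comp t i u) (i + j).-1 v = tree_comp t i (tree_comp u j v).
Proof.
elim: t i => [|s l IHl r IHr] i /= hi hj.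
  by congr tree_comp; lia.
have := leaves_gt0 u; case: ifP => /= hil hu.
  rewrite leaves_comp; last by lia.
  by rewrite ifT ?IHl //; lia.
rewrite ifF; last by lia.
congr node; rewrite -IHr //; last by lia.
by congr tree_comp; lia.
Qed.

Lemma tree_comp_par t u v i j : 0 < i -> i < j -> j <= leaves t ->
  tree_comp (tree_comp t i u) (j + leaves u).-1 v =
  tree_comp (tree_comp t j v) i u.
Proof.
elim: t i j => [|s l IHl r IHr] i j /= i0 ij hj; first by lia.
have hu := leaves_gt0 u; have hv := leaves_gt0 v.
case: (leqP j (leaves l)) => hjl.
  rewrite ifT /=; last by lia.
  rewrite !leaves_comp; try lia.
  by rewrite !ifT ?IHl //; lia.
case: (leqP i (leaves l)) => hil /=.
  rewrite leaves_comp; last by lia.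
  rewrite ifF; last by lia.
  rewrite ifT //; congr node.
  by congr tree_comp; lia.
rewrite !ifF; try lia.
congr node; rewrite -IHr; try lia.
by congr tree_comp; lia.
Qed.
End Trees.

Definition free_operad (S : choiceType) : operad.
Proof.
apply: (@Operad (stree S) (fun=> True) (@leaves S) leaf (@tree_comp S)) => //.
- by move=> x _; apply: leaves_gt0.
- by move=> x i y _ _; apply: leaves_comp.
- by move=> x i _ _; apply: tree_comp_leaf.
- by move=> x y z i j _ _ _; apply: tree_comp_seq.
- by move=> x y z i j _ _ _; apply: tree_comp_par.
Defined.

Definition binary_gens (S : Type) (O : operad) (g : S -> O) :=
  forall s, op_mem (g s) /\ op_arity (g s) = 2.

(* The unique operad morphism from the free operad to O extending g: see
   tree_eval_corolla and tree_eval_comp. *)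
Fixpoint tree_eval (S : Type) (O : operad) (g : S -> O) (t : stree S) : O :=
  if t is node s l r
  then op_comp (op_comp (g s) 2 (tree_eval g r)) 1 (tree_eval g l)
  else op_unit O.

Section Eval.
Variables (S : Type) (O : operad) (g : S -> O).
Hypothesis gP : binary_gens g.

Lemma tree_evalP t :
  op_mem (tree_eval g t) /\ op_arity (tree_eval g t) = leaves t.
Proof.
elim: t => [|s l [ml al] r [mr ar]] /=.
  by split; [apply: op_unit_mem | apply: op_arity_unit].
have [ms as2] := gP s; have l0 := leaves_gt0 l; have r0 := leaves_gt0 r.
have m2 : op_mem (op_comp (g s) 2 (tree_eval g r)).
  by apply: op_comp_mem => //; lia.
have a2 : op_arity (op_comp (g s) 2 (tree_eval g r)) = (leaves r).+1.
  by rewrite op_arity_comp ?ar ?as2.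
split; first by apply: op_comp_mem => //; lia.
by rewrite op_arity_comp ?a2 ?al //; lia.
Qed.

Lemma tree_eval_corolla s : tree_eval g (corolla s) = g s.
Proof.
have [ms as2] := gP s.
by rewrite /= !op_comp_unit // as2.
Qed.

Lemma tree_eval_comp t i u : 0 < i <= leaves t ->
  tree_eval g (tree_comp t i u) = op_comp (tree_eval g t) i (tree_eval g u).
Proof.
have [mu au] := tree_evalP u.
elim: t i => [|s l IHl r IHr] i /= hi.
  have -> : i = 1 by lia.
  by rewrite op_unit_comp.
have [ms as2] := gP s; have [ml al] := tree_evalP l.
have [mr ar] := tree_evalP r.
have l0 := leaves_gt0 l; have r0 := leaves_gt0 r.
have m2 : op_mem (op_comp (g s) 2 (tree_eval g r)).
  by apply: op_comp_mem => //; lia.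
have a2 : op_arity (op_comp (g s) 2 (tree_eval g r)) = (leaves r).+1.
  by rewrite op_arity_comp ?ar ?as2.
case: ifP => hil /=.
  rewrite IHl; last by lia.
  by rewrite -op_comp_seq ?a2 ?al //; lia.
rewrite IHr; last by lia.
rewrite -op_comp_seq ?as2 ?ar //; last by lia.
set j := (2 + _).-1.
rewrite -op_comp_par ?a2 //; try (rewrite /j; lia).
by congr op_comp; rewrite /j al; lia.
Qed.
End Eval.

(* g induces an isomorphism from the quotient of the free operad on S by the
   operad congruence generated by r to O. *)
Definition presents (S : choiceType) (O : operad) (g : S -> O)
    (r : stree S -> stree S -> Prop) : Prop :=
  [/\ binary_gens g,
      forall x : O, op_mem x -> exists t, tree_eval g t = x
    & forall t u, tree_eval g t = tree_eval g u <->
        @operad_congruence (free_operad S) r t u].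

Section Rewriting.
Variables (S : Type) (r : stree S -> stree S -> Prop).

Inductive rewrite_step : stree S -> stree S -> Prop :=
| step_root p q us : r p q -> size us = leaves p ->
    rewrite_step (graft p us) (graft q us)
| step_left s t t' u : rewrite_step t t' ->
    rewrite_step (node s t u) (node s t' u)
| step_right s t u u' : rewrite_step u u' ->
    rewrite_step (node s t u) (node s t u').

Definition rewrites := clos_refl_trans (stree S) rewrite_step.

Definition quadratic_rule := forall p q, r p q -> nodes p = 2 /\ nodes q = 2.

Definition terminating := well_founded (fun t' t => rewrite_step t t').

Definition confluent := forall t u v, rewrites t u -> rewrites t v ->
  exists2 w, rewrites u w & rewrites v w.

Definition normal_form t := forall t', ~ rewrite_step t t'.
End Rewriting.

(* The set B of syntax trees is a Poincare-Birkhoff-Witt basis of the operad O,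
   relatively to the family g of binary generators. *)
Definition pbw_basis (S : choiceType) (O : operad) (g : S -> O)
    (B : stree S -> Prop) : Prop :=
  exists r : stree S -> stree S -> Prop,
    [/\ quadratic_rule r, terminating r, confluent r, presents g r
      & forall t, B t <-> normal_form r t].

(* (O, g) is a binary quadratic presentation: all the relations between
   syntax trees follow from those between trees with two internal nodes.
   Linearly: the operad of spans of O is F(E)/(R), with E the span of S and
   R, inside the span of the trees with two internal nodes, the kernel of
   the evaluation. *)
Definition binary_quadratic (S : choiceType) (O : operad) (g : S -> O) : Prop :=
  presents g (fun t u =>
    [/\ nodes t = 2, nodes u = 2 & tree_eval g t = tree_eval g u]).

(* The cherries of t, that is, the nodes s both of whose children are leaves:
   for each of them, the list contains (t', i, s, e) where
   t = t' o_i corolla s and e is the number of nodes of t which come after s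
   in prefix order. *)
Fixpoint cherries (S : Type) (t : stree S) : seq (stree S * nat * S * nat) :=
  match t with
  | leaf => [::]
  | node s leaf leaf => [:: (leaf, 1, s, 0)]
  | node s l r =>
      [seq let: (l', i, c, e) := x in (node s l' r, i, c, e + nodes r)
         | x <- cherries l] ++
      [seq let: (r', i, c, e) := x in (node s l r', leaves l + i, c, e)
         | x <- cherries r]
  end.

Section Koszul.
Local Open Scope ring_scope.

(* Throughout, the linear operad is the operad P = K<O> of spans of O, with
   quadratic presentation F(E)/(R) as in binary_quadratic. *)
Variables (K : fieldType) (S : finType) (O : operad) (g : S -> O).

(* The element of F(E) with coefficients a p c on p o_1 c and b p c on p o_2 c
   belongs to R. *)
Definition in_R (a b : S -> S -> K) : Prop :=
  \sum_(p : S) \sum_(c : S)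
     (<< a p c *g op_comp (g p) 1 (g c) >> +
      << b p c *g op_comp (g p) 2 (g c) >>) = 0 :> {malg K[O]}.

(* The Koszul dual cooperad C(sE, s^2 R), as a subspace of the cofree
   conilpotent cooperad on sE: a combination f of syntax trees belongs to it
   when, for every pair of adjacent nodes (p, c) and every fixed surrounding
   (context C o_i _, subtrees t1, t2, t3), the two-node part lies in s^2 R.
   The nodes are of degree 1 and are ordered by prefix order; bringing c next
   to p in p (t1, c (t2, t3)) exchanges it with the nodes of t1, hence the
   sign. *)
Definition in_koszul_dual (f : stree S -> K) : Prop :=
  forall (C t1 t2 t3 : stree S) (i : nat), (0 < i <= leaves C)%N ->
    in_R (fun p c => f (tree_comp C i (node p (node c t1 t2) t3)))
         (fun p c => (-1) ^+ nodes t1 *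
                     f (tree_comp C i (node p t1 (node c t2 t3)))).

(* Elements t (w_1, ..., w_k) of the composite F^c(sE) o P, where t has k
   leaves and the w_i are basis elements of P, are encoded as pairs (t, w). *)
Definition koszul_space : Type := {malg K[(stree S * seq O)%type]}.

(* Arity N component of the Koszul complex, in degree k - 1: the sum of the
   C(sE, s^2 R)(k) (x) P(n_1) (x) ... (x) P(n_k) over n_1 + ... + n_k = N. *)
Definition koszul_chain (N k : nat) (z : koszul_space) : Prop :=
  (forall t w, (t, w) \in msupp z ->
     [/\ leaves t = k, size w = k, (forall x, x \in w -> op_mem x)
       & sumn [seq op_arity x | x <- w] = N]) /\
  (forall w, in_koszul_dual (fun t => z@_(t, w))).

(* The differential splits off a top corolla s of the tree, moves it to the
   end of the prefix order (hence the sign), and multiplies it, as an element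
   of P, with the two elements of P grafted on it. *)
Definition koszul_diff_basis (t : stree S) (w : seq O) : koszul_space :=
  \sum_(x <- cherries t)
    let: (t', i, s, e) := x in
    let a := nth (op_unit O) w i.-1 in
    let b := nth (op_unit O) w i in
    (-1) ^+ e *:
      << (t', take i.-1 w ++ op_comp (op_comp (g s) 2 b) 1 a :: drop i.+1 w) >>.

Definition koszul_diff (z : koszul_space) : koszul_space :=
  \sum_(x <- msupp z) z@_x *: koszul_diff_basis x.1 x.2.

(* The homology of the Koszul complex is the unit operad: its component of
   arity 1, which is P(1) = K for a quadratic presentation, is left out. *)
Definition koszul_acyclic : Prop :=
  forall (N k : nat) (z : koszul_space), (1 < N)%N ->
    koszul_chain N k z -> koszul_diff z = 0 ->
    exists2 z', koszul_chain N k.+1 z' & koszul_diff z' = z.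
End Koszul.

(* The operad K<O> is (binary, finitely generated) quadratic and Koszul.  In a
   binary quadratic presentation, g is a bijection onto the elements of arity
   2, so that the Koszul complex only depends on O. *)
Definition koszul_operad (K : fieldType) (O : operad) : Prop :=
  exists (S : finType) (g : S -> O),
    binary_quadratic g /\ koszul_acyclic K g.

Section Pluriassociative.
Variable gamma : nat.

(* The monoid {0} U [gamma] for the product max. *)
Notation letter := 'I_gamma.+1.
Notation letter_mul := (@Order.max _ letter).

Definition word_comp (u : seq letter) (i : nat) (v : seq letter) : seq letter :=
  take i.-1 u ++ [seq letter_mul (nth ord0 u i.-1) x | x <- v] ++ drop i u.

Lemma letter_mul0 a : letter_mul a ord0 = a.
Proof. exact/max_l/leq0n. Qed.

Lemma word_compE a x b v :
  word_comp (a ++ x :: b) (size a).+1 v = a ++ map (letter_mul x) v ++ b.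
Proof.
rewrite /word_comp /= take_size_cat // nth_cat ltnn subnn /=.
by rewrite drop_cat ltnNge leqnSn /= subSnn /= drop0.
Qed.

Lemma word_split (u : seq letter) i : 0 < i <= size u ->
  exists a x b, u = a ++ x :: b /\ i = (size a).+1.
Proof.
move=> hi; exists (take i.-1 u), (nth ord0 u i.-1), (drop i u).
have -> : i = i.-1.+1 by lia.
rewrite -drop_nth ?cat_take_drop ?size_take /=; last by lia.
by split=> //; rewrite ifT //; lia.
Qed.

Definition TM_operad : operad.
Proof.
apply: (@Operad (seq letter) (fun w => 0 < size w) size [:: ord0] word_comp) => //.
- move=> x i y /= hx hy /word_split[a [c [b [-> ->]]]].
  by rewrite word_compE !size_cat size_map !addn_gt0 hy orbT.
- move=> x i y /= hx hy /word_split[a [c [b [-> ->]]]].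
  by rewrite word_compE !size_cat size_map /=; lia.
- move=> x hx; rewrite /word_comp /= cats0 -[RHS]map_id.
  by apply: eq_map => c; rewrite maxC letter_mul0.
- move=> x i /= hx /word_split[a [c [b [-> ->]]]].
  by rewrite word_compE /= letter_mul0.
- move=> x y z i j /= _ _ _ /word_split[a [c [b [-> ->]]]].
  move=> /word_split[a' [c' [b' [-> ->]]]]; rewrite !word_compE !map_cat /=.
  have -> : size a + (size a').+1
    = (size (a ++ map (letter_mul c) a')).+1 by rewrite size_cat size_map /=; lia.
  rewrite -catA cat_cons catA word_compE -!catA -!map_comp.
  do 3?congr cat; apply: eq_map => d /=; exact/esym/maxA.
- move=> x y z i j /= hx hy hz i0 ij hj.
  have /word_split[a [c [b [xE iE]]]] : 0 < i <= size x.
    by rewrite i0 (leq_trans (ltnW ij)).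
  have : 0 < j - i <= size b.
    by move: hj; rewrite xE size_cat /= iE; lia.
  move=> /word_split[a' [c' [b' [bE jE]]]]; rewrite xE bE iE word_compE.
  have -> : j = (size (a ++ c :: a')).+1 by rewrite size_cat /=; lia.
  rewrite -cat_cons catA word_compE -catA cat_cons word_compE.
  rewrite catA catA.
  have -> : ((size (a ++ c :: a')).+1 + size y).-1
    = (size ((a ++ map (letter_mul c) y) ++ a')).+1.
    by rewrite !size_cat /= size_map /=; lia.
  by rewrite word_compE -!catA.
Defined.

(* inl a and inr a are the generators "left dash" and "right dash" with index
   a + 1, where a : 'I_gamma. *)
Definition dias_label : finType := ('I_gamma + 'I_gamma)%type.

Definition dias_word (s : dias_label) : TM_operad :=
  match s with
  | inl a => [:: ord0; lift ord0 a]
  | inr a => [:: lift ord0 a; ord0]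
  end.

Definition Dias : operad :=
  @generated_suboperad TM_operad (fun w => exists s, w = dias_word s).

Definition dias_gen (s : dias_label) : Dias := dias_word s.

Definition hook (u v : seq 'I_gamma) : stree dias_label :=
  foldl (fun t a => node (inl a) t leaf)
    (foldr (fun a t => node (inr a) leaf t) leaf u) v.

Definition hook_tree (t : stree dias_label) : Prop := exists u v, t = hook u v.
End Pluriassociative.

(* Main.v *)
(* Hooks evaluate bijectively onto the words of Dias, and every syntax tree
   rewrites to the hook with the same value; this gives the quadratic
   presentation and the Poincare-Birkhoff-Witt basis.

   For the Koszul complex, the Koszul dual cooperad has a basis indexed by the
   planar binary trees y with labelled edges: read the vertices of y in infix
   order as inputs; any bracketing t of these inputs receives, at each of its
   nodes, the label of the path of y between the topmost vertices of the two
   sides of the node, and the basis element is the signed sum of all the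
   labelled bracketings so obtained.  On this basis the Koszul complex becomes
   the chain complex of a semisimplicial set: a cell is a tree y with a word on
   each vertex, and the i-th face merges the i-th and (i+1)-st vertices and
   multiplies their words.  An acyclic matching, which splits a letter off one
   of the words and turns it into a new leaf of y, then contracts the complex
   in all arities greater than 1. *)
From HB Require Import structures.
Require Import Defs.
From mathcomp Require Import all_boot all_order all_algebra.
From mathcomp Require Import zify ring.
From Stdlib Require Import Relations.

Set Implicit Arguments.
Unset Strict Implicit.
Unset Printing Implicit Defensive.

Import Order.TTheory GRing.Theory.

(** * Words and hooks *)

(** The words of [Dias gamma] are those with exactly one 0, and a generator applied to two words
    keeps the 0 of one side only. Cutting a labelled tree y between two consecutive vertices behaves
    alike: the side of the root gets 0 and the other side a nonzero maximum, so every cut names a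
    generator. Two bracketings that differ by one rotation read the same three letters on y, which
    makes their terms cancel in R. That nothing else lies in the dual cooperad is a triangularity
    argument: a dual element is determined by its values on the trees all of whose adjacent pairs of
    nodes are non-hooks, and each y has exactly one such bracketing. The obstacle in the matching is
    that merging two vertices may create a new place where a letter can be split off. The place of
    the splitting is therefore the last vertex that fails a condition stable under merging: having a
    left child and a word ending with 0. Once a letter has been split off there, only the two merges
    of the new leaf with its neighbours can lead to cells that can be split again: one undoes the
    splitting, the other lowers a lexicographic rank. *)

Section Words.
Variable gamma : nat.
Notation letter := 'I_gamma.+1.
Notation label := (dias_label gamma).
Notation lmax := (@Order.max _ letter).
Notation ev := (tree_eval (@dias_gen gamma)).
Implicit Types (s : label) (w : seq letter).

(** A label is handled through the two letters of its word, a pair exactly one member of which is 0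
    ([label_pairP], [label_pair_xor]). This treats both kinds of generators at once. *)
Definition label_pair s : letter * letter :=
  match s with
  | inl a => (ord0, lift ord0 a)
  | inr a => (lift ord0 a, ord0)
  end.

Lemma dias_wordE s : dias_word s = [:: (label_pair s).1; (label_pair s).2].
Proof. by case: s. Qed.

Lemma label_pair_inj : injective label_pair.
Proof.
move=> [a|a] [b|b] //= E; congr (_ _).
  exact: (@lift_inj _ ord0 a b (congr1 snd E)).
exact: (@lift_inj _ ord0 a b (congr1 fst E)).
Qed.

Lemma label_pairP x y : (x == ord0) (+) (y == ord0) ->
  exists s, label_pair s = (x, y).
Proof.
case: (unliftP ord0 x) => [a ->|->]; case: (unliftP ord0 y) => [b ->|->] //= _.
  by exists (inr a).
by exists (inl b).
Qed.

Lemma label_pair_xor s : ((label_pair s).1 == ord0) (+) ((label_pair s).2 == ord0).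
Proof. by case: s. Qed.

Lemma lmax_eq0 x y : (lmax x y == ord0) = (x == ord0) && (y == ord0).
Proof. by rewrite -!val_eqE /Order.max ltEord; case: ifP => /=; lia. Qed.

Lemma lmax0 : left_id ord0 lmax.
Proof. by move=> x; rewrite maxC letter_mul0. Qed.

(** Defined for all pairs of letters, so that it applies directly to the pairs read on labelled
    trees. *)
Definition word_mul (p : letter * letter) w w' : seq letter :=
  map (lmax p.1) w ++ map (lmax p.2) w'.

Lemma op_comp_dias s w w' :
  op_comp (op_comp (@dias_gen gamma s) 2 w') 1 w = word_mul (label_pair s) w w'
    :> Dias gamma.
Proof.
rewrite /= /dias_gen dias_wordE /word_mul /word_comp /= cats0.
by rewrite drop0.
Qed.

Lemma evalE s l r : ev (node s l r) = word_mul (label_pair s) (ev l) (ev r).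
Proof. exact: op_comp_dias. Qed.

Lemma size_word_mul p w w' : size (word_mul p w w') = size w + size w'.
Proof. by rewrite size_cat !size_map. Qed.

Lemma count0_map x w : count_mem ord0 (map (lmax x) w) =
  (x == ord0) * count_mem ord0 w.
Proof.
rewrite count_map; case: eqP => [->|/eqP x0] /=.
  by rewrite mul1n; apply: eq_count => a /=; rewrite lmax0.
rewrite mul0n -(count_pred0 w); apply: eq_count => a /=.
by rewrite lmax_eq0 (negPf x0).
Qed.

Definition pointed w := count_mem ord0 w == 1.

Lemma pointed_mul p w w' : (p.1 == ord0) (+) (p.2 == ord0) ->
  pointed w -> pointed w' -> pointed (word_mul p w w').
Proof.
rewrite /pointed /word_mul count_cat !count0_map.
by move=> + /eqP -> /eqP ->; case: (_ == _); case: (_ == _).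
Qed.

Lemma pointed_eval t : pointed (ev t).
Proof.
elim: t => [|s l IHl r IHr]; first by rewrite /pointed.
by rewrite evalE pointed_mul // label_pair_xor.
Qed.

Lemma binary_dias_gen : binary_gens (@dias_gen gamma).
Proof.
move=> s; split; last by case: s.
apply: generated_gen; first by case: s.
by exists s.
Qed.

Lemma size_eval t : size (ev t) = leaves t.
Proof. by have [_] := tree_evalP binary_dias_gen t. Qed.

Lemma nodesE (S : Type) (t : stree S) : (nodes t).+1 = leaves t.
Proof. by elim: t => //= s l <- r <-; lia. Qed.

Definition lifts (u : seq 'I_gamma) : seq letter := map (lift ord0) u.

Lemma pointedP w : pointed w -> exists u v, w = lifts u ++ ord0 :: lifts v.
Proof.
have nolift : forall v, count_mem ord0 v = 0 -> exists u, v = lifts u.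
  elim=> [|a v IHv] /=; first by exists [::].
  case: (unliftP ord0 a) => [b ->|->] //= /IHv[u ->].
  by exists (b :: u).
elim: w => [//|a w IHw]; rewrite /pointed /=.
case: (unliftP ord0 a) => [b ->|->] /=.
  by rewrite add0n => /IHw[u [v ->]]; exists (b :: u), v.
rewrite add1n eqSS => /eqP /nolift[v ->].
by exists [::], v.
Qed.

Lemma map_max0 w : map (lmax ord0) w = w.
Proof. by rewrite -[RHS]map_id; apply: eq_map => a; rewrite lmax0. Qed.

Lemma eval_hook u v : ev (hook u v) = lifts u ++ ord0 :: lifts v.
Proof.
have hr : ev (foldr (fun a t => node (inr a) leaf t) leaf u) = rcons (lifts u) ord0.
  elim: u => [//|a u IHu]; rewrite [foldr _ _ _]/= evalE IHu /word_mul /=.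
  by rewrite map_max0 letter_mul0.
rewrite /hook -cat_rcons -hr; elim: v (foldr _ _ _) => [|a v IHv] t /=.
  by rewrite cats0.
by rewrite IHv evalE /word_mul map_max0 /= letter_mul0 -catA.
Qed.

(** Composition replaces a letter by a word with one 0 if that letter is 0 and with none otherwise,
    so the number of zeros is kept. Conversely every word with a single 0 is the value of a hook. *)
Lemma pointed_mem w : op_mem (w : Dias gamma) <-> pointed w.
Proof.
split=> [|/pointedP[u [v ->]]]; last first.
  by rewrite -eval_hook; have [] := tree_evalP binary_dias_gen (hook u v).
elim=> [//|x _ [s ->]|x i y mx px my py]; first by case: s.
case/word_split => [a [c [b [xE ->]]]].
rewrite /= xE word_compE /pointed !count_cat count0_map (eqP py).
by move: px; rewrite /pointed xE count_cat /= muln1.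
Qed.

Lemma lifts_inj u v u' v' :
  lifts u ++ ord0 :: lifts v = lifts u' ++ ord0 :: lifts v' -> u = u' /\ v = v'.
Proof.
have inj0 : injective (lift (@ord0 gamma)) by apply: lift_inj.
elim: u u' => [|a u IHu] [|a' u'] //=; first by case=> /(inj_map inj0).
by move=> E; have /inj0 -> := congr1 (head ord0) E;
   have /IHu[-> ->] := congr1 behead E.
Qed.

Fixpoint right_comb (t : stree label) :=
  if t is node (inr _) leaf r then right_comb r else t == leaf.

Fixpoint hookb (t : stree label) :=
  match t with
  | leaf => true
  | node (inl _) l leaf => hookb l
  | node (inr _) leaf r => right_comb r
  | _ => false
  end.

Lemma right_combP t :
  right_comb t -> exists u, t = foldr (fun a t => node (inr a) leaf t) leaf u.
Proof.
elim: t => [|[a|a] [|sl ll rl] IHl r IHr] //=; first by exists [::].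
by case/IHr => u ->; exists (a :: u).
Qed.

Lemma right_comb_hookb t : right_comb t -> hookb t.
Proof. by case: t => [|[a|a] [|sl ll rl] r]. Qed.

Lemma hookbP t : reflect (hook_tree t) (hookb t).
Proof.
apply: (iffP idP) => [|[u [v ->]]]; last first.
  rewrite /hook; set t0 := foldr _ _ _.
  have : hookb t0.
    by apply: right_comb_hookb; rewrite {}/t0; elim: u.
  by elim: v {u} t0 => [|a v IHv] t0 //= h; apply: IHv.
elim: t => [|[a|a] l IHl r IHr] /=; first by exists [::], [::].
  case: r {IHr} => // /IHl[u [v ->]]; exists u, (rcons v a).
  by rewrite /hook foldl_rcons.
case: l {IHl} => // /right_combP[u ->].
by exists (a :: u), [::].
Qed.

Lemma eval_hook_inj t t' : hookb t -> hookb t' -> ev t = ev t' -> t = t'.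
Proof.
move=> /hookbP[u [v ->]] /hookbP[u' [v' ->]].
by rewrite !eval_hook => /lifts_inj[-> ->].
Qed.

Lemma eval_to_hook t : exists2 h, hookb h & ev h = ev t.
Proof.
have [u [v E]] := pointedP (pointed_eval t).
exists (hook u v); first by apply/hookbP; exists u, v.
by rewrite eval_hook E.
Qed.

Lemma eval_nodes t t' : ev t = ev t' -> nodes t = nodes t'.
Proof. by move/(congr1 size); rewrite !size_eval -!nodesE => -[]. Qed.

(** The relations are oriented through their values: a two-node tree which is not a hook goes to the
    hook with the same value, which is unique by [eval_hook_inj]. *)
Inductive to_hook (p q : stree label) : Prop :=
  ToHook of nodes p = 2 & ~~ hookb p & hookb q & ev p = ev q.

Lemma nodes2 (S : Type) (t : stree S) : nodes t = 2 ->
  exists p c, t = node p (corolla c) leaf \/ t = node p leaf (corolla c).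
Proof.
case: t => //= p [|c [|? ? ?] [|? ? ?]] [|d [|? ? ?] [|? ? ?]] //=; try lia.
  by exists p, d; right.
by exists p, c; left.
Qed.

Lemma quadratic_to_hook : quadratic_rule to_hook.
Proof. by move=> p q [n2 _ _ /eval_nodes <-]. Qed.

(** A two-node pattern at the root of a hook is itself a hook, and the subtrees of a hook are
    hooks. *)
Lemma hookb_normal t t' : rewrite_step to_hook t t' -> ~~ hookb t.
Proof.
elim=> [p q us [n2 /negP pN _ _] _|[a|a] t1 t2 u _ /negP IH|[a|a] u t1 t2 _ /negP IH].
- apply/negP => h; move: n2 h pN.
  move=> /nodes2[[a|a] [[b|b] [->|->]]] /= h pN; try exact: pN.
  by move: h; case: (head _ _).
- by apply/negP; case: u.
- by apply/negP; case: t1 IH.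
- by apply/negP; case: t1 IH.
- by apply/negP; case: u => // h; apply: IH; apply: right_comb_hookb.
Qed.

(** When both subtrees are hooks, the failure shows in two nodes at the root: an internal right
    child of [inl], an internal left child of [inr], or an [inl] node as right child of [inr]. *)
Lemma not_hookb_step t : ~~ hookb t -> exists t', rewrite_step to_hook t t'.
Proof.
have root p us : nodes p = 2 -> ~~ hookb p -> size us = 3 ->
    exists t', rewrite_step to_hook (graft p us) t'.
  move=> n2 pN us3; have [q hq E] := eval_to_hook p.
  exists (graft q us); apply: step_root; first by split.
  by rewrite us3 -nodesE n2.
elim: t => [//|s l IHl r IHr].
have [hl|/IHl[l' hl'] _] := boolP (hookb l); last first.
  by exists (node s l' r); apply: step_left.
have [hr|/IHr[r' hr'] _] := boolP (hookb r); last first.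
  by exists (node s l r'); apply: step_right.
case: s => a.
  case: r {IHr} hr => [|c r1 r2] _; first by rewrite /= hl.
  by move=> _; apply: (root (node (inl a) leaf (corolla c)) [:: l; r1; r2]).
case: l {IHl} hl => [|c l1 l2] _ => [|_]; last first.
  by apply: (root (node (inr a) (corolla c) leaf) [:: l1; l2; r]).
case: r {IHr} hr => [|[b|b] r1 r2] //=; last by case: r1 => //= ->.
by move=> _ _; apply: (root (node (inr a) leaf (corolla (inl b))) [:: leaf; r1; r2]).
Qed.

Lemma hookb_normal_form t : hookb t <-> normal_form to_hook t.
Proof.
split=> [h t' /hookb_normal /negP //|nf].
by apply: contraPT nf => /not_hookb_step[t' st] nf; apply: nf st.
Qed.

(* Both weights depend only on the shape of the tree and the directions of its
   nodes.  The first one decreases along all the rules, except for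
   [x |- (y -| z) -> (x |- y) -| z], which leaves it unchanged and decreases
   the second one. *)
Fixpoint weight1 (t : stree label) :=
  match t with
  | leaf => 0
  | node (inl _) l r => weight1 l + weight1 r + nodes r
  | node (inr _) l r => weight1 l + weight1 r + nodes l
  end.

Fixpoint weight2 (t : stree label) :=
  match t with
  | leaf => 0
  | node (inl _) l r => weight2 l + weight2 r
  | node (inr _) l r => weight2 l + weight2 r + nodes r
  end.

Definition weight_lt (t' t : stree label) :=
  nodes t' = nodes t /\
  (weight1 t' < weight1 t \/ weight1 t' = weight1 t /\ weight2 t' < weight2 t).

Lemma weight_le t : weight1 t <= nodes t * nodes t /\ weight2 t <= nodes t * nodes t.
Proof.
elim: t => [|[a|a] l [l1 l2] r [r1 r2]] //=; have := leq0n (nodes l * nodes r);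
  move: (nodes l) (nodes r) l1 l2 r1 r2 => m n; nia.
Qed.

Lemma weight_lt_node_l s l l' r :
  weight_lt l' l -> weight_lt (node s l' r) (node s l r).
Proof. by rewrite /weight_lt; case: s => a /=; lia. Qed.

Lemma weight_lt_node_r s l r r' :
  weight_lt r' r -> weight_lt (node s l r') (node s l r).
Proof. by rewrite /weight_lt; case: s => a /=; lia. Qed.

Lemma weight_lt_comp C i t t' : weight_lt t' t ->
  weight_lt (tree_comp C i t') (tree_comp C i t).
Proof.
move=> h; elim: C i => [//|s l IHl r IHr] i /=.
by case: ifP => _; [apply: weight_lt_node_l | apply: weight_lt_node_r].
Qed.

(* The second factor exceeds all values of [weight2], so the sum orders trees
   of the same size lexicographically. *)
Definition weight t := weight1 t * (nodes t * nodes t).+1 + weight2 t.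

Lemma weight_ltE t' t : weight_lt t' t -> weight t' < weight t.
Proof.
rewrite /weight => -[E h]; have [_] := weight_le t'; rewrite E.
move: (nodes t * nodes t) => B h2; case: h => [h1|[-> h1]]; last by lia.
by apply: (@leq_trans ((weight1 t').+1 * B.+1)); [lia|nia].
Qed.

Lemma rewrite_weight t t' : rewrite_step to_hook t t' -> weight_lt t' t.
Proof.
elim=> [p q us [n2 pN qh E] us3|s t1 t2 u _|s u t1 t2 _]; last 2 first.
- exact: weight_lt_node_l.
- exact: weight_lt_node_r.
have n2' : nodes q = 2 by rewrite -(eval_nodes E).
have {us3}[x [y [z ->]]] : exists x y z, us = [:: x; y; z].
  move: us3; rewrite -nodesE n2.
  by case: us => [|x [|y [|z [|]]]] // _; exists x, y, z.
move: E pN qh; have /nodes2[p0 [c0 pE]] := n2; have /nodes2[p1 [c1 qE]] := n2'.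
rewrite /weight_lt.
(* The weights ignore the indices of the labels, so it is enough to remember which letters vanish. A
   finite check on the directions of the four nodes remains. *)
move/(congr1 (map (fun x => x == ord0))).
have lift0 a : (lift ord0 a == @ord0 gamma) = false by [].
case: pE => ->; case: qE => ->; case: p0; case: c0; case: p1; case: c1 => a b c d;
  rewrite !evalE /= /word_mul /= ?lmax_eq0 ?lift0 ?eqxx //= => _ _ _; try lia.
Qed.
End Words.

(** * The rewriting of syntax trees to hooks *)

Section PBW.
Variable gamma : nat.
Notation ev := (tree_eval (@dias_gen gamma)).
Notation to_hook := (@to_hook gamma).

Lemma to_hook_terminating : terminating to_hook.
Proof.
move=> t; have [n] := ubnP (weight t); elim: n t => [|n IH] t tn; first by rewrite ltn0 in tn.
by constructor => t' /rewrite_weight/weight_ltE t't; apply: IH; lia.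
Qed.

Section Congruence.
Variable S : choiceType.
Variables (r : stree S -> stree S -> Prop).
Notation cong := (@operad_congruence (free_operad S) r).

Lemma node_comp (s : S) l t : node s l t = tree_comp (tree_comp (corolla s) 2 t) 1 l.
Proof. by []. Qed.

Lemma cong_treeR x : cong x x.
Proof. exact: (@cong_refl (free_operad S)). Qed.

Lemma cong_tree_comp x x' y y' i : cong x x' -> cong y y' -> 0 < i <= leaves x ->
  cong (tree_comp x i y) (tree_comp x' i y').
Proof. exact: (@cong_comp (free_operad S)). Qed.

Lemma cong_node (s : S) l l' t t' : cong l l' -> cong t t' ->
  cong (node s l t) (node s l' t').
Proof.
move=> cl ct; rewrite (node_comp _ l) (node_comp _ l').
apply: cong_tree_comp => //; apply: cong_tree_comp => //; exact: cong_treeR.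
Qed.

(** Grafting from right to left keeps the remaining positions unshifted. *)
Lemma graft_comp3 (p : stree S) x y z : nodes p = 2 ->
  graft p [:: x; y; z] = tree_comp (tree_comp (tree_comp p 3 z) 2 y) 1 x.
Proof. by move/nodes2=> [a [b [->|->]]]. Qed.

Lemma cong_rewrite t t' : quadratic_rule r -> rewrite_step r t t' -> cong t t'.
Proof.
move=> quad; elim=> [p q us pq us3|s t1 t2 u _ IH|s u t1 t2 _ IH]; last 2 first.
- by apply: cong_node => //; apply: cong_treeR.
- by apply: cong_node => //; apply: cong_treeR.
have [p2 q2] := quad _ _ pq.
have {us3}[x [y [z ->]]] : exists x y z, us = [:: x; y; z].
  move: us3; rewrite -nodesE p2.
  by case: us => [|x [|y [|z [|]]]] // _; exists x, y, z.
have px : leaves p = 3 by rewrite -nodesE p2.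
rewrite !graft_comp3 //.
have y0 := leaves_gt0 y; have z0 := leaves_gt0 z.
apply: cong_tree_comp; last by rewrite !leaves_comp ?px //; lia.
  apply: cong_tree_comp; last by rewrite !leaves_comp ?px //; lia.
    apply: cong_tree_comp; last by rewrite px.
      exact: (@cong_base (free_operad S)).
    exact: cong_treeR.
  exact: cong_treeR.
exact: cong_treeR.
Qed.

Lemma cong_rewrites t t' : quadratic_rule r -> rewrites r t t' -> cong t t'.
Proof.
move=> quad; elim=> [x y /cong_rewrite|x|x y z _ xy _ yz]; first exact.
  exact: (@cong_refl (free_operad S)).
exact: (@cong_trans (free_operad S)) xy yz.
Qed.

Lemma cong_eval (O : operad) (g : S -> O) t t' : binary_gens g ->
  (forall p q, r p q -> tree_eval g p = tree_eval g q) ->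
  cong t t' -> tree_eval g t = tree_eval g t'.
Proof.
move=> gP rE; elim=> //.
- by move=> x y z _ -> _ ->.
- move=> x x' y y' i _ IHx _ IHy /= i_x.
  rewrite !tree_eval_comp // ?IHx ?IHy //.
  have [_ <-] := tree_evalP gP x'; rewrite -IHx.
  by have [_ ->] := tree_evalP gP x.
Qed.

Lemma congW (r' : stree S -> stree S -> Prop) t t' : (forall p q, r p q -> r' p q) ->
  cong t t' -> @operad_congruence (free_operad S) r' t t'.
Proof.
move=> rr'; elim=> [x y /rr'|x m|x y _|x y z _ xy _|x x' y y' i _ cx _ cy ix].
- exact: (@cong_base (free_operad S)).
- exact: (@cong_refl (free_operad S)).
- exact: (@cong_sym (free_operad S)).
- exact: (@cong_trans (free_operad S)) xy.
- exact: (@cong_comp (free_operad S)).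
Qed.
End Congruence.

Lemma rewrites_to_hook t : exists2 h, hookb h & rewrites to_hook t h.
Proof.
have [n] := ubnP (weight t); elim: n t => [|n IH] t tn; first by rewrite ltn0 in tn.
have [ht|/not_hookb_step[t' st]] := boolP (hookb t).
  by exists t => //; apply: rt_refl.
have [|h hh t'h] := IH t'; first by have := weight_ltE (rewrite_weight st); lia.
by exists h => //; apply: rt_trans t'h; apply: rt_step.
Qed.

Lemma cong_to_hook_eval t t' : @operad_congruence (free_operad _) to_hook t t' ->
  ev t = ev t'.
Proof. by apply: cong_eval; [apply: binary_dias_gen|move=> p q []]. Qed.

Lemma rewrites_eval t t' : rewrites to_hook t t' -> ev t = ev t'.
Proof.
by move=> h; apply: cong_to_hook_eval; apply: cong_rewrites h; apply: quadratic_to_hook.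
Qed.

(** Evaluation is invariant under rewriting and injective on hooks, so all normal forms of a tree
    agree; no critical pair has to be examined. *)
Lemma to_hook_confluent : confluent to_hook.
Proof.
move=> t u v tu tv; have [h hh uh] := rewrites_to_hook u.
have [h' hh' vh'] := rewrites_to_hook v; exists h => //.
suff -> : h = h' by [].
apply: eval_hook_inj => //.
by rewrite -(rewrites_eval uh) -(rewrites_eval vh') -(rewrites_eval tu) (rewrites_eval tv).
Qed.

Lemma to_hook_presents : presents (@dias_gen gamma) to_hook.
Proof.
split; first exact: binary_dias_gen.
  move=> w /pointed_mem/pointedP[u [v ->]].
  by exists (hook u v); rewrite eval_hook.
move=> t u; split=> [E|]; last exact: cong_to_hook_eval.
have [h hh th] := rewrites_to_hook t; have [h' hh' uh'] := rewrites_to_hook u.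
have hE : h = h'.
  by apply: eval_hook_inj => //; rewrite -(rewrites_eval th) -(rewrites_eval uh').
have quad := @quadratic_to_hook gamma.
apply: (@cong_trans (free_operad _)); first exact: cong_rewrites th.
by apply: (@cong_sym (free_operad _)); rewrite hE; apply: cong_rewrites uh'.
Qed.

Lemma hook_pbw_basis : pbw_basis (@dias_gen gamma) (@hook_tree gamma).
Proof.
exists to_hook; split.
- exact: quadratic_to_hook.
- exact: to_hook_terminating.
- exact: to_hook_confluent.
- exact: to_hook_presents.
- by move=> t; rewrite -hookb_normal_form; split=> /hookbP.
Qed.

Lemma dias_binary_quadratic : binary_quadratic (@dias_gen gamma).
Proof.
have [bin surj E] := to_hook_presents; split=> // t u; split; last first.
  by apply: cong_eval => // p q [].
move/E; apply: congW => p q pq; have [p2 q2] := quadratic_to_hook pq.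
by case: pq.
Qed.
End PBW.

(** * Labelled binary trees *)

(* A binary tree y with labelled edges is encoded as a term of type stree: leaf
   is the empty tree, and node a l r is a vertex whose edge to its parent is
   labelled a, with left and right subtrees l and r.  Labels of edges are
   nonzero.  The label 0 marks the root of a whole tree; the other labels of a
   root arise in subtrees, and stand for a path to a vertex outside of them. *)
Section Vtrees.
Variable gamma : nat.
Notation letter := 'I_gamma.+1.
Notation lmax := (@Order.max _ letter).
Notation vtree := (stree letter).
Implicit Types (y l r : vtree) (a b c : letter).

Definition root_label y := if y is node a _ _ then a else ord0.
Definition set_root b y := if y is node _ l r then node b l r else leaf.
(** Lengthens the path above the root by [b]; labels along a path are combined by the maximum. *)
Definition raise b y := if y is node a l r then node (lmax b a) l r else leaf.
Notation reset := (set_root ord0).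

Fixpoint all_pos y :=
  if y is node a l r then [&& a != ord0, all_pos l & all_pos r] else true.
Definition inner_pos y :=
  if y is node _ l r then all_pos l && all_pos r else true.

(* The restriction of y to its first n vertices in infix order: paths through
   the deleted vertices are contracted, and labelled by their maximum. *)
Fixpoint vtake n y : vtree :=
  if y is node a l r then
    if n <= nodes l then raise a (vtake n l) else node a l (vtake (n - (nodes l).+1) r)
  else leaf.

Fixpoint vdrop n y : vtree :=
  if y is node a l r then
    if n <= nodes l then node a (vdrop n l) r else raise a (vdrop (n - (nodes l).+1) r)
  else leaf.

Lemma nodes_raise b y : nodes (raise b y) = nodes y. Proof. by case: y. Qed.
Lemma nodes_set_root b y : nodes (set_root b y) = nodes y. Proof. by case: y. Qed.
Lemma raise0 y : raise ord0 y = y. Proof. by case: y => //= a l r; rewrite lmax0. Qed.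
Lemma raise_raise a b y : raise a (raise b y) = raise (lmax a b) y.
Proof. by case: y => //= c l r; rewrite maxA. Qed.
Lemma set_root_raise c b y : set_root c (raise b y) = set_root c y.
Proof. by case: y. Qed.
Lemma set_root_set_root c b y : set_root c (set_root b y) = set_root c y.
Proof. by case: y. Qed.
Lemma raise_reset y : raise (root_label y) (reset y) = y.
Proof. by case: y => //= a l r; rewrite letter_mul0. Qed.
Lemma root_raise b y : 0 < nodes y -> root_label (raise b y) = lmax b (root_label y).
Proof. by case: y. Qed.

Lemma nodes_vtake n y : nodes (vtake n y) = minn n (nodes y).
Proof.
elim: y n => [|a l IHl r IHr] n /=; first by rewrite minn0.
by case: ifP => h; rewrite ?nodes_raise /= ?IHl ?IHr; lia.
Qed.

Lemma nodes_vdrop n y : nodes (vdrop n y) = nodes y - n.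
Proof.
elim: y n => [|a l IHl r IHr] n //=.
by case: ifP => h; rewrite ?nodes_raise /= ?IHl ?IHr; lia.
Qed.

Definition nodes_v := (nodes_vtake, nodes_vdrop, nodes_raise, nodes_set_root).

Lemma vtake_oversize n y : nodes y <= n -> vtake n y = y.
Proof.
elim: y n => [|a l IHl r IHr] n //= h.
by rewrite ifF ?IHr //; lia.
Qed.

Lemma vtake0 y : vtake 0 y = leaf.
Proof. by elim: y => //= a l ->. Qed.

Lemma vdrop0 y : vdrop 0 y = y.
Proof. by elim: y => //= a l -> r _. Qed.

Lemma vdrop_oversize n y : nodes y <= n -> vdrop n y = leaf.
Proof.
elim: y n => [|a l IHl r IHr] n //= h.
by rewrite ifF ?IHr //; lia.
Qed.

Lemma vtake_raise n b y : vtake n (raise b y) = raise b (vtake n y).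
Proof. by case: y => //= a l r; case: ifP; rewrite ?raise_raise. Qed.

Lemma vdrop_raise n b y : vdrop n (raise b y) = raise b (vdrop n y).
Proof. by case: y => //= a l r; case: ifP; rewrite ?raise_raise. Qed.

Lemma vtake_reset n y : vtake n y = raise (root_label y) (vtake n (reset y)).
Proof. by rewrite -vtake_raise raise_reset. Qed.

Lemma vdrop_reset n y : vdrop n y = raise (root_label y) (vdrop n (reset y)).
Proof. by rewrite -vdrop_raise raise_reset. Qed.

Lemma vtake_vtake m n y : m <= n -> vtake m (vtake n y) = vtake m y.
Proof.
elim: y m n => [|a l IHl r IHr] m n //= mn.
case: (leqP n (nodes l)) => hn /=.
  by rewrite vtake_raise IHl // ifT //; lia.
case: leqP => hm //; rewrite IHr //; lia.
Qed.

Lemma vdrop_vdrop m n y : vdrop m (vdrop n y) = vdrop (n + m) y.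
Proof.
elim: y m n => [|a l IHl r IHr] m n //=.
case: (leqP n (nodes l)) => hn /=; rewrite ?nodes_v.
  case: leqP => hm; first by rewrite IHl ifT //; lia.
  by rewrite ifF; [congr (raise _ (vdrop _ _))|]; lia.
rewrite ifF ?vdrop_raise ?IHr; last lia.
by congr (raise _ (vdrop _ _)); lia.
Qed.

Lemma vdrop_vtake m n y : vdrop m (vtake (m + n) y) = vtake n (vdrop m y).
Proof.
elim: y m n => [|a l IHl r IHr] m n //=.
case: (leqP (m + n) (nodes l)) => h /=.
  rewrite vdrop_raise IHl ifT /= ?nodes_v; last lia.
  by rewrite ifT //; lia.
case: (leqP m (nodes l)) => hm /=; rewrite ?nodes_v.
  by rewrite ifF; [congr (node _ _ (vtake _ _))|]; lia.
have -> : m + n - (nodes l).+1 = (m - (nodes l).+1) + n by lia.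
by rewrite IHr vtake_raise.
Qed.

Lemma all_pos_raise b y : all_pos y -> all_pos (raise b y).
Proof. by case: y => //= a l r /and3P[a0 -> ->]; rewrite lmax_eq0 (negPf a0) andbF. Qed.

Lemma all_pos_inner y : all_pos y -> inner_pos y.
Proof. by case: y => //= a l r /and3P[_ -> ->]. Qed.

Lemma inner_raise b y : inner_pos (raise b y) = inner_pos y. Proof. by case: y. Qed.
Lemma inner_set_root b y : inner_pos (set_root b y) = inner_pos y. Proof. by case: y. Qed.

Lemma all_pos_vtake n y : all_pos y -> all_pos (vtake n y).
Proof.
elim: y n => [|a l IHl r IHr] n //= /and3P[a0 hl hr].
by case: ifP => _; [apply/all_pos_raise/IHl | rewrite /= a0 hl IHr].
Qed.

Lemma all_pos_vdrop n y : all_pos y -> all_pos (vdrop n y).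
Proof.
elim: y n => [|a l IHl r IHr] n //= /and3P[a0 hl hr].
by case: ifP => _; [rewrite /= a0 hr IHl | apply/all_pos_raise/IHr].
Qed.

Lemma inner_vtake n y : inner_pos y -> inner_pos (vtake n y).
Proof.
case: y => //= a l r /andP[hl hr]; case: ifP => _.
  by rewrite inner_raise all_pos_inner ?all_pos_vtake.
by rewrite /= hl all_pos_vtake.
Qed.

Lemma inner_vdrop n y : inner_pos y -> inner_pos (vdrop n y).
Proof.
case: y => //= a l r /andP[hl hr]; case: ifP => _.
  by rewrite /= hr all_pos_vdrop.
by rewrite inner_raise all_pos_inner ?all_pos_vdrop.
Qed.

Lemma root_all_pos y : all_pos y -> 0 < nodes y -> root_label y != ord0.
Proof. by case: y => //= a l r /and3P[]. Qed.

(* The roots of the two parts of y cut after the n-th vertex, one of which is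
   the root of y, labeled by the path from the root of y. *)
Definition cut n y := (root_label (vtake n (reset y)), root_label (vdrop n (reset y))).

Lemma cut_raise b n y : cut n (raise b y) = cut n y.
Proof. by rewrite /cut set_root_raise. Qed.

Lemma cutE n a l r : inner_pos (node a l r) -> 0 < n < nodes (node a l r) ->
  cut n (node a l r) = if n <= nodes l then (root_label (vtake n l), ord0)
                       else (ord0, root_label (vdrop (n - (nodes l).+1) r)).
Proof. by rewrite /cut /= => ih hn; case: ifP => _; rewrite /= ?raise0. Qed.

(** The part which contains the root of y gets 0, the other one a maximum of nonzero edge labels.
    Hence each cut is the pair of a unique generator. *)
Lemma cut_xor n y : inner_pos y -> 0 < n < nodes y ->
  ((cut n y).1 == ord0) (+) ((cut n y).2 == ord0).
Proof.
case: y => [|a l r]; first by rewrite /=; lia.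
move=> ih hn; rewrite cutE //; move/andP: ih => [hl hr]; case: ifP => h /=.
  by rewrite (negPf (root_all_pos _ _)) ?all_pos_vtake ?nodes_v //; lia.
by rewrite (negPf (root_all_pos _ _)) ?all_pos_vdrop ?nodes_v //; move: hn => /=; lia.
Qed.

Lemma lmax_cut1 n y : 0 < n -> 0 < nodes y ->
  lmax (root_label y) (cut n y).1 = root_label (vtake n y).
Proof. by move=> n0 y0; rewrite vtake_reset root_raise ?nodes_v //; lia. Qed.

Lemma lmax_cut2 n y : n < nodes y ->
  lmax (root_label y) (cut n y).2 = root_label (vdrop n y).
Proof. by move=> ny; rewrite vdrop_reset root_raise ?nodes_v //; lia. Qed.
End Vtrees.

(** * Elements of the Koszul dual cooperad *)

Section Compat.
(* Otherwise /= replaces dias_label by the sum type in some arguments only. *)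
Local Opaque dias_label.
Variable gamma : nat.
Notation letter := 'I_gamma.+1.
Notation label := (dias_label gamma).
Notation lmax := (@Order.max _ letter).
Notation vtree := (stree letter).
Notation reset := (set_root (@ord0 gamma)).
Implicit Types (y : vtree) (t C T : stree label).

(* Whether t is the bracketing of the vertices of y, labelled by the paths in y
   between the two sides of each node. *)
Fixpoint compat t y :=
  if t is node s l r then
    [&& label_pair s == cut (leaves l) y, compat l (vtake (leaves l) y)
      & compat r (vdrop (leaves l) y)]
  else nodes y == 1.

Lemma compat_node s l r y : compat (node s l r) y =
  [&& label_pair s == cut (leaves l) y, compat l (vtake (leaves l) y)
    & compat r (vdrop (leaves l) y)].
Proof. by []. Qed.

Lemma compat_leaves t y : compat t y -> leaves t = nodes y.
Proof.
elim: t y => [|s l IHl r IHr] y /=; first by move/eqP.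
case/and3P=> _ /IHl hl /IHr hr; move: (leaves_gt0 r).
by move: hl hr; rewrite !nodes_v; lia.
Qed.

Lemma compat_raise b t y : compat t (raise b y) = compat t y.
Proof.
elim: t y => [|s l IHl r IHr] y /=; first by rewrite nodes_v.
by rewrite cut_raise vtake_raise vdrop_raise IHl IHr.
Qed.

Lemma compat_set_root b t y : compat t (set_root b y) = compat t y.
Proof.
suff E z : compat t z = compat t (reset z).
  by rewrite E set_root_set_root -E.
by rewrite -{1}(raise_reset z) compat_raise.
Qed.

(* A subtree T constrains y only through the restriction z of y to the inputs
   of T. *)
Lemma compat_context C i n y : 0 < i <= leaves C -> inner_pos y ->
  exists (B : bool) z, inner_pos z /\
    forall T, leaves T = n -> compat (tree_comp C i T) y = B && compat T z.
Proof.
elim: C i y => [|s l IHl r IHr] i y /= hi hy.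
  by exists true, y; split=> // T; rewrite (_ : i = 1) //; lia.
case: (leqP i (leaves l)) => hil.
  have [|B [z [hz E]]] := IHl i (vtake (leaves l + n).-1 y) _ (inner_vtake _ hy).
    by lia.
  exists [&& label_pair s == cut (leaves l + n).-1 y, B
           & compat r (vdrop (leaves l + n).-1 y)], z; split=> // T Tn /=.
  by rewrite leaves_comp ?Tn ?E //; try lia; rewrite -!andbA; do 2 congr andb; rewrite andbC.
have [|B [z [hz E]]] := IHr (i - leaves l) (vdrop (leaves l) y) _ (inner_vdrop _ hy).
  by lia.
exists [&& label_pair s == cut (leaves l) y, compat l (vtake (leaves l) y) & B], z.
by split=> // T Tn /=; rewrite E // -!andbA.
Qed.

(** Parity of the permutation from the prefix order of the nodes to their infix order: its
    inversions are the pairs made of a node and a node of its left subtree. In infix order, the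
    nodes of all bracketings of the same inputs stand for the same gaps between inputs, which makes
    signs comparable. *)
Fixpoint parity (S : Type) (t : stree S) : bool :=
  if t is node _ l r then odd (nodes l) (+) parity l (+) parity r else false.

Lemma nodes_comp (S : Type) (U : stree S) i V :
  nodes (tree_comp U i V) = nodes U + nodes V.
Proof. by elim: U i => [|s l IHl r IHr] i //=; case: ifP => /= _; rewrite ?IHl ?IHr; lia. Qed.

Lemma parity_context (S : Type) (U : stree S) i n :
  exists b, forall V, nodes V = n -> parity (tree_comp U i V) = b (+) parity V.
Proof.
elim: U i => [|s l IHl r IHr] i /=; first by exists false.
case: (leqP i (leaves l)) => _.
  have [b E] := IHl i; exists (odd (nodes l + n) (+) b (+) parity r) => V Vn /=.
  by rewrite nodes_comp E // Vn -!addbA; do 2 congr addb; rewrite addbC.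
have [b E] := IHr (i - leaves l); exists (odd (nodes l) (+) parity l (+) b) => V Vn /=.
by rewrite E // !addbA.
Qed.

Definition word3l (p c : letter * letter) := [:: lmax p.1 c.1; lmax p.1 c.2; p.2].
Definition word3r (p c : letter * letter) := [:: p.1; lmax p.2 c.1; lmax p.2 c.2].

Lemma op_comp1_dias (p c : label) :
  op_comp (@dias_gen gamma p) 1 (@dias_gen gamma c) = word3l (label_pair p) (label_pair c)
   :> Dias gamma.
Proof. by rewrite /= /dias_gen !dias_wordE. Qed.

Lemma op_comp2_dias (p c : label) :
  op_comp (@dias_gen gamma p) 2 (@dias_gen gamma c) = word3r (label_pair p) (label_pair c)
   :> Dias gamma.
Proof. by rewrite /= /dias_gen !dias_wordE. Qed.

(** The letters of three consecutive blocks of vertices. Both bracketings of the blocks produce this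
    word, hence the same basis element in the relation of R. *)
Definition pieces a b y :=
  [:: root_label (vtake a (reset y)); root_label (vtake b (vdrop a (reset y)));
      root_label (vdrop (a + b) (reset y))].

Lemma word3l_cut a b y : 0 < a -> 0 < b -> a < nodes y ->
  word3l (cut (a + b) y) (cut a (vtake (a + b) y)) = pieces a b y.
Proof.
move=> a0 b0 ay; rewrite /word3l [vtake (a + b) y]vtake_reset cut_raise.
set z := vtake (a + b) (reset y).
rewrite -[(cut (a + b) y).1]/(root_label z).
have z0 : 0 < nodes z by rewrite !nodes_v; lia.
have az : a < nodes z by rewrite !nodes_v; lia.
by rewrite lmax_cut1 // lmax_cut2 // vtake_vtake ?leq_addr // vdrop_vtake.
Qed.

Lemma word3r_cut a b y : 0 < a -> 0 < b -> a + b < nodes y ->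
  word3r (cut a y) (cut b (vdrop a y)) = pieces a b y.
Proof.
move=> a0 b0 aby; rewrite /word3r [vdrop a y]vdrop_reset cut_raise.
set z := vdrop a (reset y).
rewrite -[(cut a y).2]/(root_label z).
have z0 : b < nodes z by rewrite !nodes_v; lia.
by rewrite lmax_cut1 ?lmax_cut2 ?vdrop_vdrop //; lia.
Qed.

Lemma compat3l p c t1 t2 t3 y : compat (node p (node c t1 t2) t3) y =
  (label_pair p == cut (leaves t1 + leaves t2) y) &&
  (label_pair c == cut (leaves t1) (vtake (leaves t1 + leaves t2) y)) &&
  [&& compat t1 (vtake (leaves t1) y), compat t2 (vtake (leaves t2) (vdrop (leaves t1) y))
    & compat t3 (vdrop (leaves t1 + leaves t2) y)].
Proof. by rewrite /= vtake_vtake ?leq_addr // vdrop_vtake -!andbA. Qed.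

Lemma compat3r p c t1 t2 t3 y : compat (node p t1 (node c t2 t3)) y =
  (label_pair p == cut (leaves t1) y) &&
  (label_pair c == cut (leaves t2) (vdrop (leaves t1) y)) &&
  [&& compat t1 (vtake (leaves t1) y), compat t2 (vtake (leaves t2) (vdrop (leaves t1) y))
    & compat t3 (vdrop (leaves t1 + leaves t2) y)].
Proof. by rewrite /= vdrop_vdrop; do !bool_congr. Qed.

Section Dual.
Variable K : fieldType.
Local Open Scope ring_scope.

Definition dual_elt y t : K := (-1) ^+ parity t *+ compat t y.

Lemma sum_pairs (P Q : letter * letter) (x : K)
    (W : letter * letter -> letter * letter -> seq letter) :
  (P.1 == ord0) (+) (P.2 == ord0) -> (Q.1 == ord0) (+) (Q.2 == ord0) ->
  \sum_(p : label) \sum_(c : label)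
     << x *+ ((label_pair p == P) && (label_pair c == Q)) *g
        W (label_pair p) (label_pair c) : Dias gamma >>
  = << x *g W P Q : Dias gamma >> :> {malg K[Dias gamma]}.
Proof.
case: P Q => [P1 P2] [Q1 Q2] /label_pairP[p0 pE] /label_pairP[c0 cE].
rewrite (bigD1 p0) //= (bigD1 c0) //= !big1 => [|p pp0|c cc0].
- by rewrite !addr0 pE cE !eqxx.
- rewrite big1 // => c _; rewrite -pE (inj_eq (@label_pair_inj gamma)) (negPf pp0).
  by rewrite mulr0n monalgU0.
- rewrite -cE (inj_eq (@label_pair_inj gamma)) (negPf cc0) andbF.
  by rewrite mulr0n monalgU0.
Qed.

Lemma eq_in_R (a b a' b' : label -> label -> K) :
  (forall p c, a p c = a' p c) -> (forall p c, b p c = b' p c) ->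
  in_R (@dias_gen gamma) a b -> in_R (@dias_gen gamma) a' b'.
Proof.
move=> aa bb; rewrite /in_R => H; rewrite -[RHS]H; apply: eq_bigr => p _; apply: eq_bigr => c _.
by rewrite aa bb.
Qed.

(** On each of the two sides of a relation at most one pair (p, c) is compatible with y. The two
    composites both equal [pieces], and their coefficients, the sign for [t1] included, are
    opposite. *)
Lemma dual_elt_in y : inner_pos y -> in_koszul_dual (@dias_gen gamma) (dual_elt y).
Proof.
move=> hy C t1 t2 t3 i hi.
have n1 := leaves_gt0 t1; have n2 := leaves_gt0 t2; have n3 := leaves_gt0 t3.
pose n := (leaves t1 + leaves t2 + leaves t3)%N.
have [B [z [hz cE]]] := compat_context n hi hy.
have [b pE] := parity_context C i n.-1.
have lT p c : leaves (node p (node c t1 t2) t3) = n /\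
              leaves (node p t1 (node c t2 t3)) = n by rewrite /n /=; lia.
have nT p c : nodes (node p (node c t1 t2) t3) = n.-1 /\
              nodes (node p t1 (node c t2 t3)) = n.-1.
  by have [] := lT p c; rewrite -!nodesE /n -!nodesE /=; lia.
pose B' := B && [&& compat t1 (vtake (leaves t1) z),
  compat t2 (vtake (leaves t2) (vdrop (leaves t1) z))
    & compat t3 (vdrop (leaves t1 + leaves t2) z)].
(* The coefficient of the left-nested tree. Rotating changes the parity by [nodes t1] plus one; the
   first part is absorbed by the sign in [in_koszul_dual], the second makes the coefficients
   opposite. *)
pose x : K := (-1) ^+ (b (+) (odd (nodes t2)) (+) true (+) parity t1 (+) parity t2 (+) parity t3)
   *+ B'.
apply: (@eq_in_R
  (fun p c => x *+ ((label_pair p == cut (leaves t1 + leaves t2) z) &&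
    (label_pair c == cut (leaves t1) (vtake (leaves t1 + leaves t2) z))))
  (fun p c => - x *+ ((label_pair p == cut (leaves t1) z) &&
    (label_pair c == cut (leaves t2) (vdrop (leaves t1) z))))).
- move=> p c; rewrite /dual_elt cE ?pE; try by case: (lT p c); case: (nT p c).
  rewrite compat3l /x -mulrnA mulnb [B && (_ && _)]andbCA -/B' andbC.
  congr (_ ^+ _ *+ _); rewrite /= oddD /=.
  by case: (b); case: (parity t1); case: (parity t2); case: (parity t3); do 2 case: (odd _).
- move=> p c; rewrite /dual_elt cE ?pE; try by case: (lT p c); case: (nT p c).
  rewrite compat3r [B && (_ && _)]andbCA -/B' mulrnAr -signr_odd -signr_addb.
  rewrite /x -mulNrn -signrN -mulrnA mulnb andbC.
  congr (_ ^+ _ *+ _); rewrite /=.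
  by case: (b); case: (parity t1); case: (parity t2); case: (parity t3); do 2 case: (odd _).
have [B0|/negPf B0] := boolP B'; last first.
  rewrite /in_R big1 // => p _; rewrite big1 // => c _.
  by rewrite /x B0 mulr0n oppr0 !mul0rn !monalgU0 addr0.
have zn : nodes z = n.
  move/andP: B0 => [_ /and3P[/compat_leaves h1 /compat_leaves h2 /compat_leaves h3]].
  by move: h1 h2 h3; rewrite !nodes_v; lia.
move: n1 n2 n3 zn; rewrite /n => n1 n2 n3 zn; rewrite /in_R.
under eq_bigr => p _ do
  (under eq_bigr => c _ do rewrite op_comp1_dias op_comp2_dias; rewrite big_split).
rewrite big_split /= (sum_pairs _ word3l) ?(sum_pairs _ word3r).
- rewrite word3l_cut ?word3r_cut ?zn //; try lia.
  by rewrite -monalgUD subrr monalgU0.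
all: apply: cut_xor; rewrite ?inner_vtake ?inner_vdrop ?nodes_v //; lia.
Qed.
End Dual.
End Compat.

(** * Critical trees *)

Lemma leaves_node (S : Type) (s : S) l r : leaves (node s l r) = leaves l + leaves r.
Proof. by []. Qed.

Lemma node_comp_l (S : Type) (s : S) C i T r : i <= leaves C ->
  node s (tree_comp C i T) r = tree_comp (node s C r) i T.
Proof. by move=> /= ->. Qed.

Lemma node_comp_r (S : Type) (s : S) C i T l : 0 < i ->
  node s l (tree_comp C i T) = tree_comp (node s l C) (leaves l + i) T.
Proof. by move=> i0 /=; rewrite addKn ifF //; lia. Qed.

Lemma mcoeff_sum (T : choiceType) (G : zmodType) I (r : seq I) (P : pred I)
    (F : I -> {malg G[T]}) x :
  mcoeff x (\sum_(i <- r | P i) F i)%R = (\sum_(i <- r | P i) mcoeff x (F i))%R.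
Proof. exact: (raddf_sum (mcoeff x)). Qed.

Section Critical.
Variable gamma : nat.
Notation letter := 'I_gamma.+1.
Notation label := (dias_label gamma).
Notation vtree := (stree letter).
Notation reset := (set_root (@ord0 gamma)).
Implicit Types (y : vtree) (t C T : stree label).

Definition valid_root y := (root_label y == ord0) && inner_pos y.

Definition inr_root t := if t is node (inr _) _ _ then true else false.

(** The trees all of whose pairs of adjacent nodes are non-hooks, that is, left sides of the
    rewriting rule: the two-node hooks are the patterns of [not_critical]. *)
Fixpoint critical t :=
  match t with
  | leaf => true
  | node (inl _) l r => (l == leaf) && critical r
  | node (inr _) l r =>
    [&& critical l, critical r & ~~ inr_root r]
  end.

(* The tree y whose basis element has t as leading term. *)
Fixpoint vtree_of t : vtree :=
  match t with
  | leaf => node ord0 leaf leaf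
  | node (inl a) _ r => node ord0 leaf (set_root (lift ord0 a) (vtree_of r))
  | node (inr a) l r =>
    node ord0 (set_root (lift ord0 a) (vtree_of l))
      (if vtree_of r is node _ _ r' then r' else leaf)
  end.

Lemma set_root_label y : set_root (root_label y) y = y.
Proof. by case: y. Qed.

Lemma all_pos_set_root b y : b != ord0 -> inner_pos y -> all_pos (set_root b y).
Proof. by case: y => //= a l r -> /andP[-> ->]. Qed.

(** This is the free slot in which [vtree_of] attaches the tree of the left subtree of an [inr]
    node. *)
Lemma vtree_of_no_left t : critical t -> ~~ inr_root t ->
  exists r, vtree_of t = node ord0 leaf r.
Proof.
case: t => [|[a|a] l r] //= _ _; last by eexists.
by eexists.
Qed.

Lemma compat_inl a t r b : 0 < nodes r -> root_label r = lift ord0 a -> compat t r ->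
  compat (node (inl a) leaf t) (node b leaf r).
Proof.
move=> r0 ra tr; rewrite /= /cut /= !vdrop0 ?vtake0 ?raise0 ra eqxx.
by rewrite compat_raise.
Qed.

Lemma compat_inr a t1 t2 l r b : 0 < nodes l -> root_label l = lift ord0 a -> compat t1 l ->
  compat t2 (node b leaf r) -> compat (node (inr a) t1 t2) (node b l r).
Proof.
move=> l0 la c1 c2; rewrite /= /cut /= (compat_leaves c1) leqnn /=.
by rewrite vtake_oversize // vdrop_oversize // raise0 la eqxx compat_raise c1.
Qed.

Lemma vtree_ofP t : critical t ->
  valid_root (vtree_of t) /\ compat t (vtree_of t).
Proof.
elim: t => [|[a|a] l IHl r IHr] // /andP.
  case=> /eqP -> {l IHl} /IHr[/andP[vr0 vr] cr].
  have nr : 0 < nodes (vtree_of r) by rewrite -(compat_leaves cr) leaves_gt0.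
  split; first by rewrite /valid_root /= all_pos_set_root.
  rewrite [vtree_of _]/=; apply: compat_inl; rewrite ?nodes_v ?compat_set_root //.
  by move: nr; case: (vtree_of r).
case=> /IHl[/andP[vl0 vl] cl] /andP[kr nr].
have [/andP[vr0 vr] cr] := IHr kr.
have nl : 0 < nodes (vtree_of l) by rewrite -(compat_leaves cl) leaves_gt0.
have [r' rE] := vtree_of_no_left kr nr.
move: vr cr; rewrite [vtree_of (node _ _ _)]/= rE => /andP[_ vr] cr.
split; first by rewrite /valid_root /= all_pos_set_root.
apply: compat_inr; rewrite ?nodes_v ?compat_set_root //.
by move: nl; case: (vtree_of l).
Qed.

(** The root of t determines the root of y. Below [inl], the left side is a single input, which must
    be the root of y. Below [inr], the cut falls inside or at the end of the left subtree of y;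
    since the right part is not [inr]-rooted, it has no left subtree, so the cut is at the end. *)
Lemma compat_critical t y : critical t -> valid_root y -> compat t y -> y = vtree_of t.
Proof.
elim: t y => [|s l IHl r IHr] y.
  case: y => // a l r _ /andP[/eqP /= -> _].
  by case: l r => [|? ? ?] [|? ? ?] //=; lia.
move=> kt vy cy; have := compat_leaves cy; have := leaves_gt0 l; have := leaves_gt0 r.
case: y vy cy => [|a l' r']; first by rewrite /=; lia.
move=> /andP[/= /eqP -> {a} iy] cy r0 l0 sz.
move: cy; rewrite cutE //=; last by lia.
clear l0 r0; have reset0 x : all_pos x -> valid_root (reset x).
  by move=> /all_pos_inner h; rewrite /valid_root inner_set_root h andbT; case: (x).
move/andP: (iy) => [pl pr].
case: s kt => a /=.
  case/andP => /eqP lE kr; rewrite lE /=.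
  case: l' sz iy pl => [|? ? ?] /= sz iy pl; last by case/and3P => /eqP/(congr1 snd).
  rewrite vdrop0 vtake0 raise0 => /and3P[/eqP/(congr1 snd) /= ra _ cr]; rewrite ra.
  rewrite -(IHr (reset r')) ?set_root_set_root ?set_root_label ?reset0 //.
  by rewrite compat_set_root.
case/and3P => kl kr' nr; case: leqP => [hn|_]; last by case/and3P => /eqP/(congr1 fst).
case/and3P => /eqP/(congr1 fst) /= la.
have [r'' rE] := vtree_of_no_left kr' nr.
move=> cl cr.
have := IHr _ kr' _ cr; rewrite rE /valid_root /= pr all_pos_vdrop // => /(_ isT) [dE r'E].
have {}hn : nodes l' <= leaves l.
  by have := congr1 (@nodes _) dE; rewrite nodes_v /=; lia.
move: la cl; rewrite !vtake_oversize // raise0 => la cl.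
rewrite la -(IHl (reset l')) ?set_root_set_root ?set_root_label ?reset0 ?r'E //.
by rewrite compat_set_root.
Qed.

(** The root of y is bracketed with its right subtree before its left one: this puts an [inl] node
    below an [inr] node, as a critical tree requires. *)
Lemma critical_ex y : inner_pos y -> 0 < nodes y -> exists2 t, critical t & compat t y.
Proof.
elim: y => [//|a l IHl r IHr] /= /andP[pl pr] _.
have lab x : x != ord0 -> exists b : 'I_gamma, x = lift ord0 b.
  by case: (unliftP ord0 x) => [b ->|-> //]; exists b.
have [t1 k1 [n1 c1]] : exists2 t, critical t &
    ~~ inr_root t /\ compat t (node a leaf r).
  case: r pr IHr => [|b rl rr] pr IHr; first by exists leaf.
  have [t kt ct] := IHr (all_pos_inner pr) isT.
  have /lab[b' bE] := root_all_pos pr isT.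
  exists (node (inl b') leaf t); first by rewrite /= kt.
  by split; last exact: (@compat_inl _ _ (node b rl rr)).
case: l pl IHl => [|b ll lr] pl IHl; first by exists t1.
have [t kt ct] := IHl (all_pos_inner pl) isT.
have /lab[b' bE] := root_all_pos pl isT.
exists (node (inr b') t t1); first by rewrite /= kt k1 n1.
exact: (@compat_inr _ _ _ (node b ll lr)).
Qed.

Lemma not_critical t : ~~ critical t -> exists C i,
  [/\ 0 < i <= leaves C &
      (exists a c t1 t2 t3, t = tree_comp C i (node (inl a) (node c t1 t2) t3)) \/
      (exists a b t1 t2 t3, t = tree_comp C i (node (inr a) t1 (node (inr b) t2 t3)))].
Proof.
elim: t => [//|s l IHl r IHr].
have [kl|/IHl[C [i [hi H]]] _] := boolP (critical l); last first.
  exists (node s C r), i; split.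
    by rewrite leaves_node; case/andP: hi => -> /leq_trans -> //; apply: leq_addr.
  case/andP: hi => _ hi.
  case: H => [[a [c [t1 [t2 [t3 ->]]]]]|[a [c [t1 [t2 [t3 ->]]]]]]; [left|right];
    by exists a, c, t1, t2, t3; rewrite node_comp_l.
have [kr|/IHr[C [i [hi H]]] _] := boolP (critical r); last first.
  exists (node s l C), (leaves l + i); split.
    by rewrite leaves_node leq_add2l addn_gt0 leaves_gt0; case/andP: hi.
  case/andP: hi => hi _.
  case: H => [[a [c [t1 [t2 [t3 ->]]]]]|[a [c [t1 [t2 [t3 ->]]]]]]; [left|right];
    by exists a, c, t1, t2, t3; rewrite node_comp_r.
case: s => a /=; rewrite ?kl ?kr /=.
  rewrite andbT; case: l {IHl} kl => // c t1 t2 _ _.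
  by exists leaf, 1; split=> //; left; exists a, c, t1, t2, r.
case: r {IHr} kr => // -[b|b] t2 t3 //= _ _.
by exists leaf, 1; split=> //; right; exists a, b, l, t2, t3.
Qed.

Lemma lift0F (a : 'I_gamma) : (lift ord0 a == @ord0 gamma) = false.
Proof. by []. Qed.

(** The third letter comes from [p] alone; being nonzero, it forces [p] to be [inl a0], which leaves
    the letters of [c] unchanged. Thus a two-node hook occurs in its relation with no other
    left-nested tree. *)
Lemma word3l_inl (p c c0 : label) a0 :
  (word3l (label_pair p) (label_pair c) == word3l (label_pair (inl a0)) (label_pair c0))
  = (p == inl a0) && (c == c0).
Proof.
apply/eqP/andP => [|[/eqP -> /eqP ->] //].
move=> E; have E2 : (label_pair p).2 = lift ord0 a0 := congr1 (nth ord0 ^~ 2) E.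
case: p E E2 => a E E2; last by have := lift0F a0; rewrite -E2 eqxx.
have := congr1 (nth ord0 ^~ 1) E; have := congr1 (nth ord0 ^~ 0) E.
rewrite /= !lmax0 => E0 E1; split; first by rewrite (@lift_inj _ ord0 _ _ E2).
by apply/eqP/label_pair_inj; rewrite [LHS]surjective_pairing E0 E1 -surjective_pairing.
Qed.

Lemma word3r_inr (p c : label) a0 b0 :
  (word3r (label_pair p) (label_pair c) ==
   word3r (label_pair (inr a0)) (label_pair (inr b0))) = (p == inr a0) && (c == inr b0).
Proof.
apply/eqP/andP => [|[/eqP -> /eqP ->] //].
move=> E; have E0 : (label_pair p).1 = lift ord0 a0 := congr1 (nth ord0 ^~ 0) E.
case: p E E0 => a E E0; first by have := lift0F a0; rewrite -E0 eqxx.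
have := congr1 (nth ord0 ^~ 2) E; have := congr1 (nth ord0 ^~ 1) E.
rewrite /= !lmax0 => E1 E2; split; first by rewrite (@lift_inj _ ord0 _ _ E0).
by apply/eqP/label_pair_inj; rewrite [LHS]surjective_pairing E1 E2.
Qed.

Lemma weight_lt_word3r (p c c0 : label) a0 t1 t2 t3 :
  word3r (label_pair p) (label_pair c) = word3l (label_pair (inl a0)) (label_pair c0) ->
  weight_lt (node (inl a0) (node c0 t1 t2) t3) (node p t1 (node c t2 t3)).
Proof.
move/(congr1 (map (fun x => x == ord0))).
by rewrite /weight_lt; case: p; case: c; case: c0 => a b d;
   rewrite /word3l /word3r /= ?lmax_eq0 ?lift0F ?eqxx //= => _; lia.
Qed.

Lemma weight_lt_word3l (p c : label) a0 b0 t1 t2 t3 :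
  word3l (label_pair p) (label_pair c) = word3r (label_pair (inr a0)) (label_pair (inr b0)) ->
  weight_lt (node (inr a0) t1 (node (inr b0) t2 t3)) (node p (node c t1 t2) t3).
Proof.
move/(congr1 (map (fun x => x == ord0))).
by rewrite /weight_lt; case: p; case: c => a b;
   rewrite /word3l /word3r /= ?lmax_eq0 ?lift0F ?eqxx //= => _; lia.
Qed.

Section Spanning.
Variable K : fieldType.
Local Open Scope ring_scope.
Variable f : stree label -> K.
Hypothesis f_dual : in_koszul_dual (@dias_gen gamma) f.

(** Membership in R, read on the coefficient of a single word [W]. *)
Lemma dual_relation C t1 t2 t3 i (W : seq letter) : (0 < i <= leaves C)%N ->
  \sum_(p : label) \sum_(c : label)
    (f (tree_comp C i (node p (node c t1 t2) t3))
       *+ (word3l (label_pair p) (label_pair c) == W) +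
     ((-1) ^+ nodes t1 * f (tree_comp C i (node p t1 (node c t2 t3))))
       *+ (word3r (label_pair p) (label_pair c) == W)) = 0.
Proof.
move=> hi; have := f_dual t1 t2 t3 hi; rewrite /in_R.
move/(congr1 (mcoeff (W : Dias gamma))); rewrite mcoeff0 => H; rewrite -[RHS]H.
rewrite mcoeff_sum; apply: eq_bigr => p _; rewrite mcoeff_sum; apply: eq_bigr => c _.
by rewrite op_comp1_dias op_comp2_dias mcoeffD !mcoeffU.
Qed.

(* By induction on the weight, read backwards: the relation of R through a
   normal pair of nodes expresses f at a tree by its values at trees of greater
   weight. *)
Lemma dual_eq0 : (forall t, critical t -> f t = 0) -> forall t, f t = 0.
Proof.
move=> f0 t.
(* By [weight_le], an upper bound of [weight] over the trees with as many nodes as t; the induction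
   climbs towards it. *)
pose bound (t : stree label) :=
  (nodes t * nodes t * (nodes t * nodes t).+1 + nodes t * nodes t)%N.
have [n] := ubnP (bound t - weight t).
elim: n t => [|n IH] t; first by rewrite ltn0.
have [/f0 //|/not_critical[C [i [hi H]]] tn] := boolP (critical t).
have {IH tn} IH T T' : t = tree_comp C i T -> weight_lt T T' -> f (tree_comp C i T') = 0.
  move=> tE /(weight_lt_comp C i); rewrite -tE => lt; apply: IH.
  have [nE _] := lt; have := weight_ltE lt; have [w1 w2] := weight_le (tree_comp C i T').
  move: tn; rewrite /bound -nE /weight -nE.
  move: w1 w2; rewrite -nE; move: (nodes t * nodes t)%N => B; nia.
have step x (A B : label -> label -> K) (p0 c0 : label) :
    \sum_p \sum_c (A p c + B p c) = 0 ->
    (forall p c, A p c = x *+ ((p == p0) && (c == c0))) ->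
    (forall p c, B p c = 0) -> x = 0.
  move=> S0 AE BE; rewrite -[RHS]S0.
  under eq_bigr => p _ do (under eq_bigr => c _ do rewrite AE BE addr0).
  rewrite (bigD1 p0) //= (bigD1 c0) //= !eqxx !big1 ?addr0 // => [p /negPf pp0|c /negPf ->].
    by rewrite big1 // => c _; rewrite pp0.
  by rewrite andbF.
case: H => [[a0 [c0 [t1 [t2 [t3 tE]]]]]|[a0 [b0 [t1 [t2 [t3 tE]]]]]].
  have S0 := dual_relation t1 t2 t3 (word3l (label_pair (inl a0)) (label_pair c0)) hi.
  apply: (step _ _ _ (inl a0) c0 S0) => p c.
    rewrite word3l_inl; case: eqP => [->|_] //=; case: eqP => [->|_] //=.
    by rewrite tE.
  case: eqP => // E; have lt := weight_lt_word3r t1 t2 t3 E.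
  by rewrite (IH _ _ tE lt) mulr0 mul0rn.
have S0 := dual_relation t1 t2 t3 (word3r (label_pair (inr a0)) (label_pair (inr b0))) hi.
have : (-1) ^+ nodes t1 * f t = 0.
  move: S0; under eq_bigr => p _ do (under eq_bigr => c _ do rewrite addrC).
  move=> S0.
  apply: (step _ _ _ (inr a0) (inr b0) S0) => p c.
    rewrite word3r_inr; case: eqP => [->|_] //=; case: eqP => [->|_] //=.
    by rewrite tE.
  case: eqP => // E; have lt := weight_lt_word3l t1 t2 t3 E.
  by rewrite (IH _ _ tE lt) mul0rn.
by move/eqP; rewrite mulf_eq0 signr_eq0 /= => /eqP.
Qed.
End Spanning.
End Critical.

(** * Faces of labelled binary trees *)

Section Faces.
Local Opaque dias_label.
Variable gamma : nat.
Notation letter := 'I_gamma.+1.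
Notation label := (dias_label gamma).
Notation vtree := (stree letter).
Implicit Types (y l r : vtree) (t : stree label) (a b c : letter).

(* Merges the i-th and (i+1)-st vertices, counted from 0, by deleting the lower
   one of the two. *)
Fixpoint del i y : vtree :=
  if y is node a l r then
    if i < nodes l then node a (if i.+1 < nodes l then del i l else vtake i l) r
    else node a l (if i == nodes l then vdrop 1 r else del (i - (nodes l).+1) r)
  else leaf.

(** The cut of the restriction to the vertices i and i+1: 0 on the side of the upper one and, on the
    other side, the label of the path between them. *)
Definition lbl i y := cut 1 (vtake 2 (vdrop i y)).

Lemma nodes_del i y : i.+1 < nodes y -> nodes (del i y) = (nodes y).-1.
Proof.
elim: y i => [|a l IHl r IHr] i //= h.
case: (ltnP i (nodes l)) => h1 /=.
  by case: (ltnP i.+1 (nodes l)) => h2; rewrite ?IHl ?nodes_v; lia.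
case: eqP => h2; first by rewrite nodes_v; lia.
by rewrite IHr; lia.
Qed.

Lemma del_raise i b y : del i (raise b y) = raise b (del i y).
Proof. by case: y => //= a l r; case: ifP. Qed.

Lemma del_set_root i b y : del i (set_root b y) = set_root b (del i y).
Proof. by case: y => //= a l r; case: ifP. Qed.

Lemma root_del i y : root_label (del i y) = root_label y.
Proof. by case: y => //= a l r; case: ifP. Qed.

Lemma vtake_del n i y : i < n -> i.+1 < nodes y -> vtake n (del i y) = del i (vtake n.+1 y).
Proof.
elim: y n i => [|a l IHl r IHr] n i //= hin hi.
case: (ltnP i (nodes l)) => h1 /=.
  case: (ltnP i.+1 (nodes l)) => h2 /=; rewrite ?nodes_del ?nodes_v //.
    case: (ltnP n (nodes l)) => h3.
      by rewrite ifT ?IHl ?del_raise //; lia.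
    by rewrite ifF /= ?h1 ?h2 //; [congr (node _ _ (vtake _ _))|]; lia.
  case: (ltnP n (nodes l)) => h3; first by lia.
  rewrite ifF /= ?h1 ?ifF //; try lia.
  by congr (node _ _ (vtake _ _)); lia.
case: (ltnP n (nodes l)) => h3; first by lia.
case: eqP => h2.
  rewrite ifF /=; last lia.
  rewrite h2 ltnn eqxx -vdrop_vtake; congr (node _ _ (vdrop _ (vtake _ _))); lia.
rewrite ifF /= ?ifF //; try lia.
rewrite IHr; try lia.
by congr (node _ _ (del _ (vtake _ _))); lia.
Qed.

Lemma vdrop_del n i y : i < n -> i.+1 < nodes y -> vdrop n (del i y) = vdrop n.+1 y.
Proof.
elim: y n i => [|a l IHl r IHr] n i //= hin hi.
case: (ltnP i (nodes l)) => h1 /=.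
  case: (ltnP i.+1 (nodes l)) => h2 /=; rewrite ?nodes_del ?nodes_v //.
    case: (ltnP n (nodes l)) => h3.
      by rewrite ifT ?IHl //; lia.
    by rewrite ifF /=; [congr (raise _ (vdrop _ _))|]; lia.
  case: (ltnP n (nodes l)) => h3; first by lia.
  by rewrite ifF /=; [congr (raise _ (vdrop _ _))|]; lia.
case: (ltnP n (nodes l)) => h3; first by lia.
rewrite ifF /=; last lia.
case: eqP => h2; first by rewrite vdrop_vdrop; congr (raise _ (vdrop _ _)); lia.
by rewrite IHr; [congr (raise _ (vdrop _ _))| |]; lia.
Qed.

Lemma vtake_le_del n i y : n <= i -> i.+1 < nodes y -> vtake n (del i y) = vtake n y.
Proof.
elim: y n i => [|a l IHl r IHr] n i //= hin hi.
case: (ltnP i (nodes l)) => h1 /=.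
  rewrite [in RHS]ifT; last lia.
  case: (ltnP i.+1 (nodes l)) => h2 /=; rewrite ?nodes_del ?nodes_v //.
    by rewrite ifT ?IHl //; lia.
  by rewrite ifT ?vtake_vtake //; lia.
case: (leqP n (nodes l)) => h3 //.
case: eqP => h2; first by lia.
by rewrite IHr //; lia.
Qed.

Lemma vdrop_le_del n i y : n <= i -> i.+1 < nodes y ->
  vdrop n (del i y) = del (i - n) (vdrop n y).
Proof.
elim: y n i => [|a l IHl r IHr] n i //= hin hi.
case: (ltnP i (nodes l)) => h1 /=.
  rewrite [in RHS]ifT /= ?nodes_v; last lia.
  rewrite [in RHS]ifT; last lia.
  case: (ltnP i.+1 (nodes l)) => h2 /=; rewrite ?nodes_del ?nodes_v //.
    by rewrite ifT ?IHl // ?ifT //; lia.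
  rewrite ifT ?ifF //; try lia.
  by rewrite -vdrop_vtake; congr (node _ (vdrop _ (vtake _ _)) _); lia.
case: (leqP n (nodes l)) => h3 /=.
  rewrite nodes_v [in RHS]ifF; last lia.
  case: eqP => h2; first by rewrite h2 eqxx.
  rewrite ifF; last lia.
  by congr (node _ _ (del _ _)); lia.
case: eqP => h2; first by lia.
rewrite IHr ?del_raise //; try lia.
by congr (raise _ (del _ _)); lia.
Qed.

Lemma all_pos_del i y : all_pos y -> all_pos (del i y).
Proof.
elim: y i => [|a l IHl r IHr] i //= /and3P[a0 hl hr].
case: ifP => _ /=; rewrite a0 ?hl ?hr ?andbT /=; case: ifP => _;
  rewrite ?IHl ?IHr ?all_pos_vtake ?all_pos_vdrop //.
Qed.

Lemma inner_del i y : inner_pos y -> inner_pos (del i y).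
Proof.
case: y => //= a l r /andP[hl hr].
case: ifP => _ /=; rewrite ?hl ?hr ?andbT /=; case: ifP => _;
  rewrite ?all_pos_del ?all_pos_vtake ?all_pos_vdrop //.
Qed.

Lemma valid_root_del i y : valid_root y -> valid_root (del i y).
Proof. by move=> /andP[y0 iy]; rewrite /valid_root root_del y0 inner_del. Qed.

Lemma lbl_vtake n i y : i.+1 < n -> lbl i (vtake n y) = lbl i y.
Proof.
move=> h; rewrite /lbl; have -> : n = i + (n - i) by lia.
by rewrite vdrop_vtake vtake_vtake //; lia.
Qed.

Lemma lbl_vdrop n i y : lbl i (vdrop n y) = lbl (n + i) y.
Proof. by rewrite /lbl vdrop_vdrop. Qed.

Lemma lbl_del_gt i j y : i.+1 < j -> j.+1 < nodes y -> lbl i (del j y) = lbl i y.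
Proof.
move=> ij jy; rewrite /lbl vdrop_le_del //; last by lia.
by rewrite vtake_le_del ?nodes_v //; lia.
Qed.

Lemma lbl_del_lt i j y : i < j -> i.+1 < nodes y -> lbl j (del i y) = lbl j.+1 y.
Proof. by move=> ij iy; rewrite /lbl vdrop_del. Qed.

Lemma lbl_xor i y : inner_pos y -> i.+1 < nodes y ->
  ((lbl i y).1 == ord0) (+) ((lbl i y).2 == ord0).
Proof.
move=> iy hi; apply: cut_xor; first exact/inner_vtake/inner_vdrop.
by rewrite !nodes_v; lia.
Qed.

Lemma cut_del_lt n i y : i < n -> i.+1 < nodes y -> cut n (del i y) = cut n.+1 y.
Proof.
move=> h iy; rewrite /cut -del_set_root vtake_del ?nodes_v //.
by rewrite vdrop_del ?nodes_v // root_del.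
Qed.

Lemma cut_del_ge n i y : n <= i -> i.+1 < nodes y -> cut n (del i y) = cut n y.
Proof.
move=> h iy; rewrite /cut -del_set_root vtake_le_del ?nodes_v //.
by rewrite vdrop_le_del ?nodes_v // root_del.
Qed.

(** Both words are the [pieces] of the restriction of y to three consecutive vertices. This is what
    makes the two ways of merging three words agree. *)
Lemma lbl_adjacent i y : i.+2 < nodes y ->
  word3l (lbl i (del i y)) (lbl i y) = word3r (lbl i (del i.+1 y)) (lbl i.+1 y).
Proof.
move=> iy; set z := vtake 3 (vdrop i y).
have zn : nodes z = 3 by rewrite !nodes_v; lia.
have -> : lbl i (del i y) = cut 2 z.
  rewrite /lbl vdrop_le_del //; last by lia.
  rewrite subnn vtake_del ?nodes_v //; last by lia.
  by rewrite -/z cut_del_lt // zn.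
have -> : lbl i (del i.+1 y) = cut 1 z.
  rewrite /lbl vdrop_le_del // subSnn vtake_del ?nodes_v //; last by lia.
  by rewrite -/z cut_del_ge // zn.
have -> : lbl i y = cut 1 (vtake (1 + 1) z) by rewrite /lbl vtake_vtake.
have -> : lbl i.+1 y = cut 1 (vdrop 1 z).
  by rewrite /lbl /z (vdrop_vtake 1 2) vdrop_vdrop addn1.
by rewrite (@word3l_cut _ 1 1 z) ?word3r_cut ?zn.
Qed.

(** Splitting a corolla off a bracketing of y gives a bracketing of a face of y, and the label of
    the corolla is forced. The differential thereby becomes a sum of faces. *)
Lemma compat_del t s i y : i < leaves t -> nodes y = (leaves t).+1 ->
  compat (tree_comp t i.+1 (corolla s)) y =
  compat t (del i y) && (label_pair s == lbl i y).
Proof.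
elim: t i y => [|s0 l IHl r IHr] i y.
  case: i => // _ yn; rewrite /= nodes_del ?yn // !nodes_v yn /= andbT.
  by rewrite /lbl vdrop0 vtake_oversize ?yn.
rewrite leaves_node => hi yn; have l0 := leaves_gt0 l; have r0 := leaves_gt0 r.
have [hil|hil] := ltnP i (leaves l).
  rewrite -node_comp_l //.
  have lE : leaves (tree_comp l i.+1 (corolla s)) = (leaves l).+1.
    by rewrite leaves_comp //=; lia.
  rewrite !compat_node lE IHl ?nodes_v //; last by lia.
  by rewrite cut_del_lt ?vtake_del ?vdrop_del ?lbl_vtake //; lia.
have -> : i.+1 = leaves l + (i - leaves l).+1 by lia.
rewrite -node_comp_r // !compat_node IHr ?nodes_v //; try lia.
by rewrite cut_del_ge ?vtake_le_del ?vdrop_le_del ?lbl_vdrop ?subnKC //; lia.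
Qed.

(* Identities between faces of trees follow, by this extensionality, from the
   associativity of the composition of bracketings. *)
Lemma vtree_ext y y' : valid_root y -> valid_root y' -> 0 < nodes y ->
  (forall t, compat t y -> compat t y') -> y = y'.
Proof.
move=> vy vy' y0 H; have [t kt ty] : exists2 t, critical t & compat t y.
  by apply: critical_ex => //; case/andP: vy.
by rewrite (compat_critical kt vy ty) -(compat_critical kt vy' (H _ ty)).
Qed.

Lemma lbl_label i y : inner_pos y -> i.+1 < nodes y ->
  exists s : label, label_pair s = lbl i y.
Proof. by move=> iy /(lbl_xor iy) /label_pairP[s]; rewrite -surjective_pairing; exists s. Qed.

(** A bracketing of the smaller tree is extended by two corollas. For i = j they are nested, and the
    right-nested pair is exchanged with the left-nested one in the same context; for i < j they are
    grafted in parallel and commute. *)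
Lemma del_del i j y : valid_root y -> i <= j -> j.+2 < nodes y ->
  del i (del j.+1 y) = del j (del i y).
Proof.
move=> vy ij jy; have /andP[_ iy] := vy.
apply: vtree_ext; rewrite ?valid_root_del // ?nodes_del //; try lia.
move=> t ct; have tn : leaves t = (nodes y).-2.
  by rewrite (compat_leaves ct) !nodes_del //; lia.
have [s sE] : exists s : label, label_pair s = lbl i (del j.+1 y).
  by apply: lbl_label; rewrite ?inner_del ?nodes_del //; lia.
have [s' s'E] : exists s : label, label_pair s = lbl j.+1 y by apply: lbl_label.
have leaves_t k x : k < leaves t -> leaves (tree_comp t k.+1 (corolla x)) = (leaves t).+1.
  by move=> kt; rewrite leaves_comp /=; lia.
have : compat (tree_comp (tree_comp t i.+1 (corolla s)) j.+2 (corolla s')) y.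
  rewrite compat_del ?leaves_t ?s'E ?eqxx ?andbT //; try lia.
  rewrite compat_del ?sE ?eqxx ?andbT ?ct //; first by lia.
  by rewrite nodes_del ?leaves_t //; lia.
move: ij; rewrite leq_eqVlt => /predU1P[ijE|ij].
  move: s'E jy; rewrite -ijE => s'E jy.
  have -> : i.+2 = (i.+1 + 2).-1 by lia.
  rewrite tree_comp_seq //; last by lia.
  have [||B [z [iz zE]]] := @compat_context _ t i.+1 3 y; [lia|done|].
  rewrite zE //= => /andP[hB hz].
  have zn : nodes z = 3 by have := compat_leaves (t := node s leaf (corolla s')) hz.
  have /label_pairP[p pE] : ((cut 2 z).1 == ord0) (+) ((cut 2 z).2 == ord0).
    by apply: cut_xor; rewrite ?zn.
  have /label_pairP[q qE] :
      ((cut 1 (vtake 2 z)).1 == ord0) (+) ((cut 1 (vtake 2 z)).2 == ord0).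
    by apply: cut_xor; rewrite ?inner_vtake ?nodes_v ?zn.
  have : compat (tree_comp t i.+1 (tree_comp (corolla p) 1 (corolla q))) y.
    rewrite -surjective_pairing in pE; rewrite -surjective_pairing in qE.
    rewrite zE // hB [tree_comp (corolla p) _ _]/= compat3l pE qE !eqxx.
    by rewrite /= !nodes_v zn.
  rewrite -tree_comp_seq //; last by lia.
  rewrite addn1 /= compat_del ?leaves_t //; try lia.
  by case/andP; rewrite compat_del ?nodes_del //; lia.
have -> : j.+2 = (j.+1 + leaves (corolla s)).-1 by rewrite /=; lia.
rewrite tree_comp_par //; last by lia.
rewrite compat_del ?leaves_t //; try lia.
by case/andP; rewrite compat_del ?nodes_del //; lia.
Qed.
End Faces.

(** * Insertion of a leaf *)

Section Insertion.
Variable gamma : nat.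
Notation letter := 'I_gamma.+1.
Notation vtree := (stree letter).
Implicit Types (y l r : vtree) (a b c : letter).

(* Whether the (i+1)-st vertex is above the i-th one. *)
Definition up i y := (lbl i y).2 == ord0.

Lemma lbl_down i y : inner_pos y -> i.+1 < nodes y -> ((lbl i y).1 == ord0) = ~~ up i y.
Proof. by move=> iy hi; have := lbl_xor iy hi; rewrite /up; do 2 case: (_ == _). Qed.

(** The zeros of the word in [lbl_adjacent]: both sides of the three identities say that i+2,
    respectively i+1, respectively i, is the highest of these three vertices. *)
Lemma up_adjacent i y : inner_pos y -> i.+2 < nodes y ->
  [/\ up i (del i y) = up i (del i.+1 y) && up i.+1 y,
      ~~ up i (del i y) && up i y = up i (del i.+1 y) && ~~ up i.+1 y
    & ~~ up i (del i y) && ~~ up i y = ~~ up i (del i.+1 y)].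
Proof.
move=> iy hi; have := lbl_adjacent hi.
move/(congr1 (map (fun x => x == ord0))); rewrite /= !lmax_eq0 !lbl_down ?inner_del ?nodes_del //;
  try lia.
by case.
Qed.

Lemma lbl_node i a l r : inner_pos (node a l r) -> i < nodes l + nodes r ->
  lbl i (node a l r) =
  if i.+1 < nodes l then lbl i l
  else if i.+1 == nodes l then (root_label (vdrop i l), ord0)
  else if i == nodes l then (ord0, root_label (vtake 1 r))
  else lbl (i - (nodes l).+1) r.
Proof.
move=> iy hi; rewrite /lbl /=.
case: (leqP i (nodes l)) => h1; last first.
  by rewrite !ifF ?vtake_raise ?cut_raise //; lia.
rewrite /= nodes_v; case: (leqP 2 (nodes l - i)) => h2.
  by rewrite cut_raise ifT //; lia.
rewrite ifF; last lia.
rewrite cutE; last by rewrite /= !nodes_v; lia.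
  2: by case/andP: iy => h h'; rewrite /= all_pos_vdrop ?all_pos_vtake.
rewrite nodes_v; case: eqP => h3.
  by rewrite ifT ?vtake_oversize ?nodes_v //; lia.
rewrite ifF ?ifT //; try lia.
have -> : i = nodes l by lia.
by rewrite subnn vdrop0; congr (_, root_label (vtake _ _)); lia.
Qed.

Lemma up_node i a l r : inner_pos (node a l r) -> i < nodes l + nodes r ->
  up i (node a l r) =
  if i.+1 < nodes l then up i l
  else if i.+1 == nodes l then true
  else if i == nodes l then false
  else up (i - (nodes l).+1) r.
Proof.
move=> iy hi; rewrite /up lbl_node //.
case: ifP => // h1; case: ifP => // h2; case: ifP => // h3 /=.
apply: negbTE; apply: root_all_pos; last by rewrite nodes_v; lia.
by apply: all_pos_vtake; case/andP: iy.
Qed.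

(** Each gap of the infix order contains exactly one empty subtree, so the number [g] of vertices
    before the new leaf determines where it hangs. *)
Fixpoint ins g c y : vtree :=
  if y is node a l r then
    if g <= nodes l then node a (ins g c l) r
    else node a l (ins (g - (nodes l).+1) c r)
  else node c leaf leaf.

Lemma nodes_ins g c y : nodes (ins g c y) = (nodes y).+1.
Proof. by elim: y g => [|a l IHl r IHr] g //=; case: ifP => _ /=; rewrite ?IHl ?IHr; lia. Qed.

Lemma all_pos_ins g c y : c != ord0 -> all_pos y -> all_pos (ins g c y).
Proof.
move=> c0; elim: y g => [|a l IHl r IHr] g /=; first by rewrite c0.
by case/and3P => a0 hl hr; case: ifP => _ /=; rewrite a0 ?IHl ?IHr ?hl ?hr.
Qed.

Lemma inner_ins g c y : c != ord0 -> inner_pos y -> inner_pos (ins g c y).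
Proof.
case: y => //= a l r c0 /andP[hl hr].
by case: ifP => _ /=; rewrite ?all_pos_ins ?hl ?hr.
Qed.

Lemma valid_root_ins g c y : c != ord0 -> 0 < nodes y -> valid_root y ->
  valid_root (ins g c y).
Proof.
move=> c0 y0 /andP[r0 iy]; rewrite /valid_root inner_ins // andbT.
by case: y y0 r0 {iy} => //= a l r _; case: ifP.
Qed.

Lemma all_pos_nodes a l r : inner_pos (node a l r) -> inner_pos l /\ inner_pos r.
Proof. by case/andP => /all_pos_inner ? /all_pos_inner. Qed.

(** The last hypothesis says that the vertex q has no right child; the new leaf then becomes its
    right child. *)
Lemma ins_below_left q c y : inner_pos y -> c != ord0 -> q < nodes y ->
  q.+1 = nodes y \/ up q y ->
  del q (ins q.+1 c y) = y /\ lbl q (ins q.+1 c y) = (ord0, c).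
Proof.
elim: y q => [|a l IHl r IHr] q // iy c0 qy hq.
have [il ir] := all_pos_nodes iy.
have iy' g : inner_pos (ins g c (node a l r)) by apply: inner_ins.
move: (iy' q.+1); rewrite [ins _ _ _]/=; case: (ltnP q (nodes l)) => h1 {}iy'.
  have [|E1 E2] := IHl q il c0 h1.
    case: (eqVneq q.+1 (nodes l)) => h2; [by left|right].
    case: hq => [/=|]; first by lia.
    by rewrite up_node ?ifT //; lia.
  rewrite /= nodes_ins ltnW ?ltnS // h1 E1; split=> //.
  by rewrite lbl_node ?nodes_ins ?ltnS ?h1 //; lia.
case: (ltnP (nodes l) q) => h2.
  have hE : q.+1 - (nodes l).+1 = (q - (nodes l).+1).+1 by lia.
  have [||E1 E2] := IHr (q - (nodes l).+1) ir c0.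
  - by move: qy => /=; lia.
  - case: hq => [|h] /=; first by left; lia.
    case: (eqVneq (q - (nodes l).+1).+1 (nodes r)) => [|h3]; first by left.
    by right; move: h; rewrite up_node //= ?ifF //; move: qy => /=; lia.
  rewrite /= hE ifF ?ifF ?E1; try lia.
  split=> //; move: iy'; rewrite hE => iy'.
  by rewrite lbl_node ?nodes_ins ?ifF ?E2 //; move: qy => /=; lia.
have {h1 h2} qE : q = nodes l by lia.
have rE : r = leaf.
  case: r {IHr ir iy'} iy qy hq => // b rl rr iy qy [/=|]; first by lia.
  by rewrite up_node //= ?qE ?ltnn ?eqxx ?ifF //; lia.
rewrite {}rE {}qE subnn /= ltnn eqxx; split=> //.
by rewrite lbl_node /= ?ltnNge ?leqnSn ?eqxx /= ?ifF //; [lia|case/andP: iy => ->; rewrite c0|lia].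
Qed.

Lemma ins_below_right q c y : inner_pos y -> c != ord0 -> q < nodes y ->
  q = 0 \/ ~~ up q.-1 y ->
  del q (ins q c y) = y /\ lbl q (ins q c y) = (c, ord0).
Proof.
elim: y q => [|a l IHl r IHr] q // iy c0 qy hq.
have [il ir] := all_pos_nodes iy.
have iy' g : inner_pos (ins g c (node a l r)) by apply: inner_ins.
move: (iy' q); rewrite [ins _ _ _]/=; case: (ltngtP q (nodes l)) => h1 {}iy'.
- have [|E1 E2] := IHl q il c0 h1.
    case: hq => [|h]; first by left.
    case: (posnP q) => [|q0]; first by left.
    by right; move: h; rewrite up_node //= ?ifT //; lia.
  rewrite /= nodes_ins ltnW ?ltnS // h1 E1; split=> //.
  by rewrite lbl_node ?nodes_ins ?ltnS ?h1 //; lia.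
- have [||E1 E2] := IHr (q - (nodes l).+1) ir c0.
  - by move: qy => /=; lia.
  - case: hq => [|h] /=; first by left; lia.
    case: (posnP (q - (nodes l).+1)) => [|h3]; first by left.
    right; move: h; rewrite up_node //= ?ifF; try lia; last by move: qy => /=; lia.
    by have -> : q.-1 - (nodes l).+1 = (q - (nodes l).+1).-1 by lia.
  rewrite /= ifF ?ifF ?E1; try lia.
  split=> //.
  by rewrite lbl_node ?nodes_ins ?ifF ?E2 //; move: qy => /=; lia.
have lE : l = leaf.
  case: l {IHl il iy'} iy qy hq h1 => // b ll lr iy qy hq h1.
  have {hq} : ~~ up q.-1 (node a (node b ll lr) r) by case: hq => // q0; move: h1; rewrite q0.
  by rewrite up_node //= h1 /= ?ltnn ?eqxx //; lia.
rewrite {}lE in h1 iy iy' *; rewrite {}h1 /=; split=> //.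
by rewrite lbl_node.
Qed.

(* The last hypothesis says that the vertex q+1 is a leaf whose parent is q: its
   neighbour q+2, if any, lies above both. *)
Lemma del_ins_left q c y : inner_pos y -> q.+1 < nodes y -> lbl q y = (ord0, c) ->
  q.+2 = nodes y \/ up q.+1 y && up q (del q y) -> y = ins q.+1 c (del q y).
Proof.
elim: y q => [|a l IHl r IHr] q // iy qy.
have [il ir] := all_pos_nodes iy; have /andP[pl pr] := iy.
rewrite lbl_node //.
case: (ltnP q.+1 (nodes l)) => h1.
  have dE : del q (node a l r) = node a (del q l) r by rewrite /= h1 ifT //; lia.
  have iE : ins q.+1 c (node a (del q l) r) = node a (ins q.+1 c (del q l)) r.
    by rewrite /= nodes_del // ifT //; lia.
  rewrite dE iE => lE hq; rewrite -IHl //.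
  case: (eqVneq q.+2 (nodes l)) => h2; [by left|right].
  have {hq} : up q.+1 (node a l r) && up q (node a (del q l) r).
    by case: hq => //=; lia.
  have h3 : q.+2 < nodes l by lia.
  rewrite up_node ?h3 //; last by lia.
  rewrite up_node /= ?nodes_del ?all_pos_del //; last by lia.
  by rewrite ifT //; lia.
case: eqP => h2.
  case=> /eqP; rewrite (negPf (root_all_pos _ _)) ?all_pos_vdrop ?nodes_v //; lia.
case: eqP => h3.
  case=> cE hq; rewrite /= h3 ltnn eqxx /= ifF ?subnn; last by lia.
  have r1 : nodes r = 1.
    case: hq => [/=|/andP[_]]; first by lia.
    rewrite /= h3 ltnn eqxx; case: (ltnP 1 (nodes r)) => [r1|]; last by move: qy => /=; lia.
    by rewrite up_node /= ?pl ?all_pos_vdrop ?nodes_v ?ltnn ?eqxx ?ifF //; lia.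
  rewrite vdrop_oversize ?r1 //; move: cE; rewrite vtake_oversize ?r1 //=.
  by case: r r1 {IHr ir iy qy pr hq} => // b [|? ? ?] [|? ? ?] //= _ <-.
have {h1 h2 h3} lq : nodes l < q by lia.
set k := q - (nodes l).+1; have kE : q = k + (nodes l).+1 by lia.
have kr : k.+1 < nodes r by move: qy => /=; lia.
have dE : del q (node a l r) = node a l (del k r) by rewrite /= !ifF //; lia.
have iE : ins q.+1 c (node a l (del k r)) = node a l (ins k.+1 c (del k r)).
  by rewrite /= ifF; [congr (node _ _ (ins _ _ _))|]; lia.
rewrite dE iE => lE hq; rewrite -IHr //.
case: (eqVneq k.+2 (nodes r)) => h4; [by left|right].
have {hq} : up q.+1 (node a l r) && up q (node a l (del k r)) by case: hq => //=; lia.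
rewrite up_node; [|done|lia].
rewrite up_node; [|by rewrite /= pl all_pos_del|by rewrite nodes_del //; lia].
rewrite !ifF; try lia.
by have -> : q.+1 - (nodes l).+1 = k.+1 by lia.
Qed.

(** Mirror image of [del_ins_left]: q is a leaf whose parent is q+1, and its neighbour q-1, if any,
    lies above both. *)
Lemma del_ins_right q c y : inner_pos y -> q.+1 < nodes y -> lbl q y = (c, ord0) ->
  q = 0 \/ ~~ up q.-1 y && ~~ up q.-1 (del q y) -> y = ins q c (del q y).
Proof.
elim: y q => [|a l IHl r IHr] q // iy qy.
have [il ir] := all_pos_nodes iy; have /andP[pl pr] := iy.
rewrite lbl_node //.
case: (ltnP q.+1 (nodes l)) => h1.
  have dE : del q (node a l r) = node a (del q l) r by rewrite /= h1 ifT //; lia.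
  have iE : ins q c (node a (del q l) r) = node a (ins q c (del q l)) r.
    by rewrite /= nodes_del // ifT //; lia.
  rewrite dE iE => lE hq; rewrite -IHl //.
  case: (posnP q) => h2; [by left|right].
  have {hq} : ~~ up q.-1 (node a l r) && ~~ up q.-1 (node a (del q l) r).
    by case: hq => //=; lia.
  have h3 : q.-1.+1 < nodes l by lia.
  rewrite up_node ?h3 //; last by lia.
  rewrite up_node /= ?nodes_del ?all_pos_del //; last by lia.
  by rewrite ifT //; lia.
case: eqP => h2.
  case=> cE hq; have ql : q < nodes l by lia.
  rewrite /= ql ifF /=; last lia.
  rewrite nodes_v (_ : minn _ _ = q) ?leqnn; last lia.
  have q0 : q = 0.
    case: (posnP q) => // qpos; case: hq => // /andP[_].
    have -> : del q (node a l r) = node a (vtake q l) r by rewrite /= ql ifF //; lia.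
    have qn : nodes (vtake q l) = q by rewrite nodes_v; lia.
    rewrite up_node; [|by rewrite /= pr all_pos_vtake|by rewrite qn; lia].
    by rewrite qn prednK // ltnn eqxx.
  move: cE h2; rewrite q0 vdrop0 vtake0.
  by case: l {IHl il iy qy pl hq h1 ql} => // b [|? ? ?] [|? ? ?] //= <-.
case: eqP => h3.
  case=> _ /eqP; rewrite (negPf (root_all_pos _ _)) ?all_pos_vtake ?nodes_v //.
  by move: qy => /=; lia.
have {h1 h2 h3} lq : nodes l < q by lia.
set k := q - (nodes l).+1; have kE : q = k + (nodes l).+1 by lia.
have kr : k.+1 < nodes r by move: qy => /=; lia.
have dE : del q (node a l r) = node a l (del k r) by rewrite /= !ifF //; lia.
have iE : ins q c (node a l (del k r)) = node a l (ins k c (del k r)).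
  by rewrite /= ifF //; lia.
rewrite dE iE => lE hq; rewrite -IHr //.
case: (posnP k) => h4; [by left|right].
have {hq} : ~~ up q.-1 (node a l r) && ~~ up q.-1 (node a l (del k r)).
  by case: hq => //=; lia.
rewrite up_node; [|done|lia].
rewrite up_node; [|by rewrite /= pl all_pos_del|by rewrite nodes_del //; lia].
rewrite !ifF; try lia.
by have -> : q.-1 - (nodes l).+1 = k.-1 by lia.
Qed.
End Insertion.

(** * Cherries *)

Section Cherries.
Variable S : finType.
Implicit Types (t l r : stree S) (s : S).

(* The number of nodes of t which come, in prefix order, after the i-th leaf. *)
Fixpoint after t i :=
  if t is node _ l r then
    if i <= leaves l then after l i + nodes r else after r (i - leaves l)
  else 0.

Lemma cherries_node (s : S) (l r : stree S) : (l == leaf) && (r == leaf) = false ->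
  cherries (node s l r) =
    [seq (node s x.1.1.1 r, x.1.1.2, x.1.2, x.2 + nodes r) | x <- cherries l] ++
    [seq (node s l x.1.1.1, leaves l + x.1.1.2, x.1.2, x.2) | x <- cherries r].
Proof.
have E1 a : [seq (let: (l', i, c, e) := x in (node s l' a, i, c, e + nodes a))
     | x <- cherries l] = [seq (node s x.1.1.1 a, x.1.1.2, x.1.2, x.2 + nodes a) | x <- cherries l].
  by apply: eq_map => -[[[]]].
have E2 a : [seq (let: (r', i, c, e) := x in (node s a r', leaves a + i, c, e))
     | x <- cherries r]
     = [seq (node s a x.1.1.1, leaves a + x.1.1.2, x.1.2, x.2) | x <- cherries r].
  by apply: eq_map => -[[[]]].
move: E1 E2; case: l => [|sl ll lr]; case: r => [|sr rl rr] // E1 E2 _.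
- by rewrite -E2.
- by rewrite -E1.
- by rewrite -E1 -E2.
Qed.

Lemma mem_cherries t t' (i : nat) s (e : nat) :
  ((t', i, s, e) \in cherries t) =
  [&& 0 < i <= leaves t', t == tree_comp t' i (corolla s) & e == after t' i].
Proof.
elim: t t' i s e => [|s0 l IHl r IHr] t' i s e.
  rewrite in_nil; symmetry; apply/negbTE/negP => /and3P[hi /eqP E _].
  by case: t' hi E => //= ? ? ? _; case: ifP.
have [/andP[/eqP -> /eqP ->]|lr] := boolP ((l == leaf) && (r == leaf)).
  rewrite inE; apply/eqP/and3P => [[-> -> -> ->] //|[hi /eqP E /eqP ->]].
  case: t' hi E => [|s1 l1 r1] /= hi; first by case=> ->; congr (_, _, _, _); lia.
  case: ifP => h [_].
    by case: l1 h hi => [|? ? ?] //= h hi; case: ifP.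
  move=> _; case: r1 hi h => [|? ? ?] //= hi h; case: ifP => //.
rewrite cherries_node ?(negPf lr) // mem_cat.
apply/orP/and3P => [[|]|[hi /eqP E /eqP ->]].
- case/mapP => -[[[t1 j] c] f] /=; rewrite IHl => /and3P[hj /eqP -> /eqP ->] [-> -> -> ->].
  have jl : j <= leaves t1 by case/andP: hj.
  rewrite /= jl; split=> //; case/andP: hj => -> /leq_trans; apply; exact: leq_addr.
- case/mapP => -[[[t1 j] c] f] /=; rewrite IHr => /and3P[hj /eqP -> /eqP ->] [-> -> -> ->].
  have lj : (leaves l + j <= leaves l) = false.
    by case/andP: hj => j0 _; rewrite -[leqRHS]addn0 leq_add2l leqNgt j0.
  by case/andP: hj => j0 hj; rewrite /= lj addKn addn_gt0 j0 orbT leq_add2l.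
case: t' hi E => [|s1 l1 r1] /= hi.
  by case=> E1 E2 E3; move: lr; rewrite E2 E3.
case: ifP => h [-> E1 E2]; [left|right]; apply/mapP.
  exists (l1, i, s, after l1 i); last by rewrite /= E2.
  by rewrite IHl E1 !eqxx !andbT; lia.
exists (r1, i - leaves l1, s, after r1 (i - leaves l1)); last by rewrite /= E1 subnKC //; lia.
by rewrite IHr E2 !eqxx !andbT; lia.
Qed.

Lemma uniq_cherries t : uniq (cherries t).
Proof.
elim: t => [//|s l IHl r IHr].
have [/andP[/eqP -> /eqP ->] //|lr] := boolP ((l == leaf) && (r == leaf)).
rewrite cherries_node ?(negPf lr) // cat_uniq !map_inj_in_uniq ?IHl ?IHr /= ?andbT.
- apply/hasPn => x /mapP[[[[t1 j] c] f] /=]; rewrite mem_cherries => /and3P[hj _ _] ->.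
  apply/negP => /mapP[[[[t2 k] d] g] /=]; rewrite mem_cherries => /and3P[hk /eqP lE _].
  case=> E1 _ _ _ _; have := congr1 (@leaves S) lE.
  by rewrite leaves_comp // -E1 /=; have := leaves_gt0 l; lia.
- move=> [[[t1 j] c] f] [[[t2 k] d] g] _ _ /= [-> E -> ->].
  by congr (_, _, _, _); lia.
- move=> [[[t1 j] c] f] [[[t2 k] d] g] _ _ /= [-> -> -> E].
  by congr (_, _, _, _); lia.
Qed.

(** Regroups the cherries by the tree [t'] left over, so as to read off coefficients of the
    differential. *)
Lemma sum_cherries (V : zmodType) t t' (F : nat -> S -> nat -> V) :
  (\sum_(x <- cherries t | x.1.1.1 == t') F x.1.1.2 x.1.2 x.2 =
  \sum_(i < leaves t') \sum_(s : S | t == tree_comp t' i.+1 (corolla s))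
     F i.+1 s (after t' i.+1))%R.
Proof.
rewrite pair_big_dep /= -big_filter.
rewrite (perm_big [seq (t', i.1.+1, i.2, after t' i.1.+1) |
   i : 'I_(leaves t') * S <- enum predT & t == tree_comp t' i.1.+1 (corolla i.2)]) /=.
  by rewrite big_map big_filter big_enum_cond.
apply: uniq_perm; first by rewrite filter_uniq ?uniq_cherries.
  rewrite map_inj_in_uniq ?filter_uniq -?enumT ?enum_uniq //.
  by move=> [i a] [j b] _ _ /= [/ord_inj -> ->].
move=> [[[t1 i] s] e]; rewrite mem_filter mem_cherries /=.
apply/andP/mapP => [[/eqP -> /and3P[hi tE /eqP ->]]|[[j c]]].
  have hi' : i.-1 < leaves t' by lia.
  have iE : i = i.-1.+1 by lia.
  exists (Ordinal hi', s); last by rewrite /= -iE.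
  by rewrite mem_filter mem_enum /= -iE tE.
rewrite mem_filter /= => /andP[tE _] [-> -> -> ->].
by rewrite eqxx tE eqxx ltn_ord.
Qed.

(** Move the new node to the end: in prefix order it passes [after t i.+1] nodes of t, in infix
    order the [leaves t - i.+1] gaps on its right. *)
Lemma parity_comp_corolla t i s : i < leaves t ->
  parity (tree_comp t i.+1 (corolla s)) =
  parity t (+) odd (leaves t - i.+1) (+) odd (after t i.+1).
Proof.
elim: t i => [|s0 l IHl r IHr] i /=; first by case: i.
move=> hi.
case: (ltnP i (leaves l)) => h.
  rewrite /= nodes_comp /= IHl // addn1 /=.
  have -> : leaves l + leaves r - i.+1 = (leaves l - i.+1) + (nodes r).+1.
    by rewrite nodesE; lia.
  rewrite !oddD /=; move: (odd (nodes l)) (odd (nodes r)) (parity l) (parity r).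
  by move: (odd (leaves l - _)) (odd (after l _)) => [] [] [] [] [] [].
have -> : i.+1 - leaves l = (i - leaves l).+1 by lia.
rewrite /= IHr; last by lia.
have -> : leaves l + leaves r - i.+1 = leaves r - (i - leaves l).+1 by lia.
by rewrite !addbA.
Qed.

(** Bounds the height, which is simpler to enumerate; it serves only as a finite set containing the
    trees with at most [n] nodes. *)
Fixpoint trees n : seq (stree S) :=
  if n is n'.+1 then
    leaf :: [seq node x.1.1 x.1.2 x.2 |
               x <- [seq (y, r) | y <- [seq (s, l) | s <- enum S, l <- trees n'], r <- trees n']]
  else [:: leaf].

Lemma mem_trees n t : nodes t <= n -> t \in trees n.
Proof.
elim: n t => [|n IHn] [|s l r] //= h; rewrite inE /=.
apply/mapP; exists (s, l, r) => //; apply: allpairs_f; last by apply: IHn; lia.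
by apply: allpairs_f; rewrite ?mem_enum //; apply: IHn; lia.
Qed.
End Cherries.

(** * The Koszul complex on the dual basis *)

Section Lin.
Local Open Scope ring_scope.
Variables (K : fieldType) (A : choiceType) (V : lmodType K) (f : A -> V).

Definition lin (z : {malg K[A]}) : V := \sum_(x <- msupp z) z@_x *: f x.

Lemma linEw (d : {fset A}) z : (msupp z `<=` d)%fset -> lin z = \sum_(x <- d) z@_x *: f x.
Proof.
move=> zd; rewrite /lin (big_fset_incl _ zd) // => x _ /mcoeff_outdom ->.
by rewrite scale0r.
Qed.

Lemma lin_is_linear : linear lin.
Proof.
move=> a u v; pose d := (msupp u `|` msupp v `|` msupp (a *: u + v))%fset.
rewrite !(@linEw d); try by apply/fsubsetP => x xin; rewrite /d !in_fsetU xin ?orbT.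
rewrite scaler_sumr -big_split /=; apply: eq_bigr => x _.
by rewrite mcoeffD mcoeffZ scalerDl scalerA.
Qed.

HB.instance Definition _ := GRing.isLinear.Build K {malg K[A]} V *:%R lin lin_is_linear.

Lemma lin_sum I (r : seq I) (P : pred I) (F : I -> {malg K[A]}) :
  lin (\sum_(i <- r | P i) F i) = \sum_(i <- r | P i) lin (F i).
Proof. exact: linear_sum. Qed.

Lemma linZ c z : lin (c *: z) = c *: lin z.
Proof. exact: linearZ. Qed.

Lemma linU c x : lin << c *g x >> = c *: f x.
Proof.
by rewrite (linEw msuppU_le) big_seq_fset1 mcoeffUU.
Qed.
End Lin.

Section LinCoeff.
Local Open Scope ring_scope.
Variables (K : fieldType) (A B : choiceType).

Lemma mcoeff_lin (f : A -> {malg K[B]}) z x :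
  mcoeff x (lin f z) = \sum_(y <- msupp z) z@_y * mcoeff x (f y).
Proof. by rewrite mcoeff_sum; apply: eq_bigr => y _; rewrite mcoeffZ. Qed.

Definition supported (P : pred A) (z : {malg K[A]}) := forall x, x \in msupp z -> P x.

Lemma supported0 P : supported P 0.
Proof. by move=> x; rewrite msupp0. Qed.

Lemma supportedD P u v : supported P u -> supported P v -> supported P (u + v).
Proof. by move=> pu pv x /(fsubsetP (msuppD_le _ _)); rewrite in_fsetU => /orP[/pu|/pv]. Qed.

Lemma supportedZ P c u : supported P u -> supported P (c *: u).
Proof. by move=> pu x /(fsubsetP (msuppZ_le _ _)) /pu. Qed.

Lemma supportedU (P : pred A) (c : K) x : P x -> supported P << c *g x >>.
Proof. by move=> px y /(fsubsetP msuppU_le); rewrite in_fset1 => /eqP ->. Qed.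

Lemma supported_sum I (r : seq I) (Q : pred I) (F : I -> {malg K[A]}) P :
  (forall i, Q i -> supported P (F i)) -> supported P (\sum_(i <- r | Q i) F i).
Proof.
move=> H; elim/big_rec: _ => [|i u Qi pu]; first exact: supported0.
by apply: supportedD => //; apply: H.
Qed.
End LinCoeff.

Lemma supported_lin (K : fieldType) (A B : choiceType) (f : A -> {malg K[B]}) (P : pred A) Q z :
  supported P z -> (forall x, P x -> supported Q (f x)) -> supported Q (lin f z).
Proof.
move=> Pz H; rewrite /lin big_seq; apply: supported_sum => x /Pz Px.
by apply: supportedZ; apply: H.
Qed.

Section Koszul.
Local Opaque dias_label.
Variables (gamma : nat) (K : fieldType).
Notation letter := 'I_gamma.+1.
Notation label := (dias_label gamma).
Notation vtree := (stree letter).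
Notation word := (seq letter).
Notation gen := (@dias_gen gamma).
Implicit Types (y : vtree) (w : seq word) (t : stree label).

Definition merge_at (p : letter * letter) i w : seq word :=
  take i w ++ word_mul p (nth [:: ord0] w i) (nth [:: ord0] w i.+1) :: drop i.+2 w.

Notation cell := (stree letter * seq (seq letter))%type.
Implicit Types (m : cell).

Definition face i m : cell := (del i m.1, merge_at (lbl i m.1) i m.2).

(** The cells which index the basis of the arity [N] chains over trees with [k] inputs. *)
Definition valid N k m := [&& valid_root m.1, (nodes m.1 == k) && (0 < k), size m.2 == k,
  all (@pointed gamma) m.2 & sumn (map size m.2) == N].

Lemma size_merge p i w : i.+1 < size w -> size (merge_at p i w) = (size w).-1.
Proof. by move=> h; rewrite size_cat /= size_take size_drop ifT; lia. Qed.

Lemma take_nth2 (T : Type) (x0 : T) i (s : seq T) : i.+1 < size s ->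
  s = take i s ++ nth x0 s i :: nth x0 s i.+1 :: drop i.+2 s.
Proof. by move=> h; rewrite -!drop_nth ?cat_take_drop //; lia. Qed.

Lemma merge_sumn p i w : i.+1 < size w -> sumn (map size (merge_at p i w)) = sumn (map size w).
Proof.
move=> h; rewrite [in RHS](take_nth2 [:: ord0] h) /merge_at !map_cat !sumn_cat /= size_word_mul.
by lia.
Qed.

Lemma merge_pointed p i w : (p.1 == ord0) (+) (p.2 == ord0) -> i.+1 < size w ->
  all (@pointed gamma) w -> all (@pointed gamma) (merge_at p i w).
Proof.
move=> hp h; rewrite [in X in X -> _](take_nth2 [:: ord0] h) /merge_at !all_cat /=.
by case/and4P => -> h1 h2 ->; rewrite pointed_mul.
Qed.

Lemma valid_face N k i m : valid N k m -> i.+1 < k -> valid N k.-1 (face i m).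
Proof.
case/and5P => vy /andP[/eqP yk k0] /eqP wk wp /eqP wN ik.
have /andP[_ iy] := vy.
rewrite /valid /= valid_root_del // nodes_del ?yk // eqxx size_merge ?wk // eqxx.
by rewrite merge_pointed ?wk ?lbl_xor ?yk // merge_sumn ?wk // wN eqxx /= andbT; lia.
Qed.

Section Dual_elements.
Local Open Scope ring_scope.

Definition dual_cell m : koszul_space K label (Dias gamma) :=
  \sum_(t <- undup (trees label (nodes m.1)))
     << dual_elt K m.1 t *g ((t, m.2) : stree label * seq (Dias gamma)) >>.

Lemma dual_elt_nodes y t : dual_elt K y t != 0 -> leaves t = nodes y.
Proof.
by rewrite /dual_elt; case: (boolP (compat t y)) => [/compat_leaves //|_]; rewrite mulr0n eqxx.
Qed.

Lemma dual_cellE m t w :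
  mcoeff ((t, w) : stree label * seq (Dias gamma)) (dual_cell m) =
  dual_elt K m.1 t *+ (m.2 == w).
Proof.
rewrite /dual_cell mcoeff_sum.
under eq_bigr => u _ do rewrite mcoeffU xpair_eqE.
have [tn|tn] := boolP (t \in undup (trees label (nodes m.1))).
  rewrite (bigD1_seq t) ?undup_uniq //= eqxx big1 ?addr0 // => u /negPf ->.
  by rewrite mulr0n.
rewrite big1_seq => [|u /= un].
  case: (eqVneq (dual_elt K m.1 t) 0) => [->|/dual_elt_nodes tE]; first by rewrite mul0rn.
  case/negP: tn; rewrite mem_undup; apply: mem_trees; rewrite -tE -nodesE; lia.
by case: eqP => // E; rewrite -E un in tn.
Qed.

(** Among the [k.-1] gaps between [k] vertices, [k.-2 - i] lie to the right of gap i: the corolla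
    passes them when moved to the end in infix order. *)
Definition sgn_face k i : K := (-1) ^+ (k.-2 - i).

Definition boundary (a : {malg K[cell]}) : {malg K[cell]} :=
  lin (fun m => \sum_(i < (nodes m.1).-1) << sgn_face (nodes m.1) i *g face i m >>) a.

Lemma koszul_diff_basis_merge t w :
  koszul_diff_basis K gen t w =
  \sum_(x <- cherries t) (-1) ^+ x.2 *:
    << ((x.1.1.1, merge_at (label_pair x.1.2) x.1.1.2.-1 w)
         : stree label * seq (Dias gamma)) >>.
Proof.
apply: eq_big_seq => -[[[u i] s] e]; rewrite mem_cherries => /and3P[/andP[i0 _] _ _].
case: i i0 => [|i] i0; first by exfalso; rewrite ltnn in i0.
cbv beta iota zeta. rewrite op_comp_dias.
congr (_ *: << (_, _ ++ word_mul _ _ _ :: _) >>).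
Qed.

Lemma koszul_diff_basisE t w t' w' :
  mcoeff ((t', w') : stree label * seq (Dias gamma)) (koszul_diff_basis K gen t w) =
  \sum_(i < leaves t') \sum_(s : label | t == tree_comp t' i.+1 (corolla s))
     ((-1) ^+ after t' i.+1 *+ (merge_at (label_pair s) i w == w')).
Proof.
rewrite -(sum_cherries t t' (fun i s e => (-1) ^+ e *+ (merge_at (label_pair s) i.-1 w == w'))).
rewrite koszul_diff_basis_merge mcoeff_sum [RHS]big_mkcond; apply: eq_bigr => x _.
rewrite mcoeffZ mcoeffU xpair_eqE; case: (_ == t'); last by rewrite mulr0n mulr0.
by rewrite mulrnAr mulr1.
Qed.

(** For each tree [t'] and each input i, only the corolla labelled by [lbl i y] contributes, and
    [compat_del] identifies what remains with the face. By [parity_comp_corolla] the sign then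
    depends on i alone and not on [t']. *)
Lemma koszul_diff_dual m : valid_root m.1 ->
  koszul_diff gen (dual_cell m) =
  \sum_(i < (nodes m.1).-1) sgn_face (nodes m.1) i *: dual_cell (face i m).
Proof.
case: m => y w /= vy; apply/malgP => -[t' w'].
have linE : koszul_diff gen (dual_cell (y, w)) =
    lin (fun x => koszul_diff_basis K gen x.1 x.2) (dual_cell (y, w)) by [].
have -> : mcoeff ((t', w') : stree label * seq (Dias gamma)) (koszul_diff gen (dual_cell (y, w)))
  = \sum_(t <- undup (trees label (nodes y))) \sum_(i < leaves t') dual_elt K y t *
       \sum_(s : label | t == tree_comp t' i.+1 (corolla s))
         ((-1) ^+ after t' i.+1 *+ (merge_at (label_pair s) i w == w')).
  rewrite linE /dual_cell lin_sum mcoeff_sum; apply: eq_bigr => t _.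
  by rewrite linU mcoeffZ koszul_diff_basisE mulr_sumr.
rewrite exchange_big mcoeff_sum.
have Ei (i : 'I_(leaves t')) :
    \sum_(t <- undup (trees label (nodes y))) dual_elt K y t *
       \sum_(s | t == tree_comp t' i.+1 (corolla s))
         ((-1) ^+ after t' i.+1 *+ (merge_at (label_pair s) i w == w'))
    = \sum_s dual_elt K y (tree_comp t' i.+1 (corolla s)) *
         ((-1) ^+ after t' i.+1 *+ (merge_at (label_pair s) i w == w')).
  under eq_bigr => t _ do rewrite mulr_sumr big_mkcond.
  rewrite exchange_big /=; apply: eq_bigr => s _; rewrite -big_mkcond /=.
  set t := tree_comp _ _ _.
  have [tn|tn] := boolP (t \in undup (trees label (nodes y))).
    by rewrite -big_filter filter_pred1_uniq ?undup_uniq // big_seq1.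
  rewrite big1_seq => [|u /= /andP[/eqP -> un]]; last by rewrite un in tn.
  case: (eqVneq (dual_elt K y t) 0) => [->|/dual_elt_nodes tE]; first by rewrite mul0r.
  by case/negP: tn; rewrite mem_undup; apply: mem_trees; rewrite -tE -nodesE leqnSn.
rewrite (eq_bigr _ (fun i _ => Ei i)) {Ei}.
have [ty|ty] := eqVneq (nodes y) (leaves t').+1; last first.
  rewrite !big1 // => i _.
    rewrite mcoeffZ dual_cellE /=.
    case: (eqVneq (dual_elt K (del i y) t') 0) => [->|/dual_elt_nodes].
      by rewrite mul0rn mulr0.
    have iy : (i.+1 < nodes y)%N by have := ltn_ord i; lia.
    by rewrite nodes_del // => h; case/eqP: ty; rewrite h prednK // (leq_trans _ iy).
  rewrite big1 // => s _.
  case: (eqVneq (dual_elt K y (tree_comp t' i.+1 (corolla s))) 0) => [->|/dual_elt_nodes].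
    by rewrite mul0r.
  rewrite leaves_comp ?ltn_ord //= => h; by case/eqP: ty; rewrite -h addn2.
rewrite ty /=; apply: eq_bigr => i _; have ilt := ltn_ord i.
have /andP[_ iy] := vy.
have [s0 s0E] : exists s : label, label_pair s = lbl i y by apply: lbl_label; rewrite // ty ltnS.
rewrite (bigD1 s0) //= big1 => [|s /negPf ss0]; last first.
  rewrite /dual_elt compat_del // -s0E (inj_eq (@label_pair_inj gamma)) ss0 andbF.
  by rewrite mulr0n mul0r.
rewrite addr0 mcoeffZ dual_cellE /= /dual_elt compat_del // -s0E eqxx andbT /sgn_face /=.
rewrite parity_comp_corolla // !mulrnAr !mulrnAl; congr (_ *+ _ *+ _).
rewrite -[(-1) ^+ after _ _]signr_odd -[(-1) ^+ (_ - _)]signr_odd -!signr_addb addbK addbC.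
by have -> : ((leaves t').-1 - i = leaves t' - i.+1)%N by lia.
Qed.
End Dual_elements.
End Koszul.

(** * Semisimplicial identities *)

(** The terms with i < j cancel against those with j <= i, after a shift of j by one. *)
Lemma sum_face_face (K : fieldType) (V : lmodType K) n (F : nat -> nat -> V) :
  (forall i j, i <= j -> j < n -> F i j.+1 = F j i) ->
  (\sum_(j < n.+1) \sum_(i < n) (-1) ^+ (i + j) *: F i j = 0)%R.
Proof.
move=> H; pose G i j := ((-1) ^+ (i + j) *: F i j)%R.
have -> : (\sum_(j < n.+1) \sum_(i < n) G i j =
  (\sum_(j < n.+1) \sum_(i < n | (i < j)%N) G i j) +
  (\sum_(j < n.+1) \sum_(i < n | (j <= i)%N) G i j))%R.
  rewrite -big_split; apply: eq_bigr => j _ /=.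
  rewrite (bigID (fun i : 'I_n => (i < j)%N)) /=; congr (_ + _)%R.
  by apply: eq_bigl => i; rewrite -leqNgt.
rewrite big_ord_recl big_pred0 // add0r big_ord_recr /=.
rewrite [X in (_ + (_ + X))%R]big_pred0; last first.
  by move=> i; rewrite leqNgt ltn_ord.
rewrite addr0 -[RHS](addNr (\sum_(j < n) \sum_(i < n | (j <= i)%N) G i j)%R).
congr (_ + _)%R; rewrite -sumrN; under [RHS]eq_bigr => j _ do rewrite -sumrN.
rewrite [RHS](exchange_big_dep xpredT) //=; apply: eq_bigr => j _.
apply: eq_big => [i|i]; first by rewrite /bump leq0n add1n ltnS.
rewrite /bump leq0n add1n ltnS => ij.
by rewrite /G H // addnS exprS mulN1r scaleNr addnC.
Qed.

Lemma malgUZ (K : fieldType) (A : choiceType) (c : K) (x : A) :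
  (<< c *g x >> = c *: << x >> :> {malg K[A]})%R.
Proof. by apply/malgP => y; rewrite mcoeffZ !mcoeffU mulrnAr mulr1. Qed.

Section Chains.
Variables (gamma : nat) (K : fieldType).
Notation letter := 'I_gamma.+1.
Notation label := (dias_label gamma).
Notation vtree := (stree letter).
Notation word := (seq letter).
Notation cell := (stree letter * seq (seq letter))%type.
Implicit Types (y : vtree) (w : seq word) (t : stree label) (m : cell).

Lemma word_mul_l p q (a b c : word) :
  word_mul p (word_mul q a b) c =
  let W := word3l p q in
  map (Order.max (nth ord0 W 0)) a ++ map (Order.max (nth ord0 W 1)) b
    ++ map (Order.max (nth ord0 W 2)) c.
Proof.
rewrite /word_mul /= map_cat -catA -!map_comp.
by congr (_ ++ (_ ++ _)); apply: eq_map => x /=; rewrite maxA.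
Qed.

Lemma word_mul_r p q (a b c : word) :
  word_mul p a (word_mul q b c) =
  let W := word3r p q in
  map (Order.max (nth ord0 W 0)) a ++ map (Order.max (nth ord0 W 1)) b
    ++ map (Order.max (nth ord0 W 2)) c.
Proof.
rewrite /word_mul /= map_cat -!map_comp.
by congr (_ ++ (_ ++ _)); apply: eq_map => x /=; rewrite maxA.
Qed.

Lemma merge_cat p i (u v : seq word) a b : size u = i ->
  merge_at p i (u ++ a :: b :: v) = u ++ word_mul p a b :: v.
Proof.
move=> <-; rewrite /merge_at take_size_cat // !nth_cat ltnn subnn ltnNge leqnSn /= subSnn /=.
by congr (_ ++ _ :: _); rewrite drop_cat ltnNge -addn2 leq_addr /= addKn /= drop0.
Qed.

Lemma merge_merge_same p q p' q' i w : i.+2 < size w -> word3r p q = word3l p' q' ->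
  merge_at p i (merge_at q i.+1 w) = merge_at p' i (merge_at q' i w).
Proof.
move=> h E; rewrite (take_nth2 [:: ord0] (ltnW h)) (drop_nth [:: ord0] h).
set u := take i w; have us : size u = i by apply: size_takel; lia.
set a := nth _ w i; set b := nth _ w i.+1; set c := nth _ w i.+2.
rewrite [merge_at q' _ _]merge_cat // [RHS]merge_cat // -cat_rcons.
rewrite merge_cat ?size_rcons ?us // cat_rcons merge_cat //.
by rewrite word_mul_r E word_mul_l.
Qed.

Lemma merge_merge p q i j w : i < j -> j.+2 < size w ->
  merge_at p i (merge_at q j.+1 w) = merge_at q j (merge_at p i w).
Proof.
move=> ij h; rewrite (take_nth2 [:: ord0] h).
have js : size (take j.+1 w) = j.+1 by apply: size_takel; lia.
have h' : i.+1 < size (take j.+1 w) by lia.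
rewrite (take_nth2 [:: ord0] h').
set u := take i _; have us : size u = i by apply: size_takel; lia.
set v := drop _ (take _ _); have vs : size v = j - i.+1.
  by rewrite /v size_drop js; lia.
set a := nth _ _ i; set b := nth _ _ i.+1; set c := nth _ _ j.+1; set d := nth _ _ j.+2.
rewrite merge_cat; last by rewrite size_cat us /= vs; lia.
rewrite -!catA /= !merge_cat // -[in RHS]cat_cons [in RHS]catA merge_cat -?catA //.
by rewrite size_cat /= us vs; lia.
Qed.

Lemma face_face N k i j m : valid N k m -> i <= j -> j.+2 < k ->
  face i (face j.+1 m) = face j (face i m).
Proof.
case: m => y w /and5P[/= vy /andP[/eqP yk _] /eqP wk _ _] ij jk; have /andP[_ iy] := vy.
rewrite /face /= del_del ?yk //; congr pair.
move: (ij); rewrite leq_eqVlt => /predU1P[ijE|ij'].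
  by rewrite -ijE in jk *; apply: merge_merge_same; rewrite ?wk // lbl_adjacent ?yk.
by rewrite lbl_del_gt ?lbl_del_lt ?yk //; try lia; apply: merge_merge; rewrite ?wk.
Qed.

Local Open Scope ring_scope.
Notation boundary := (@boundary gamma K).

Lemma supported_boundary N k a : supported (valid N k) a ->
  supported (valid N k.-1) (boundary a).
Proof.
move=> va; apply: supported_lin va _ => m vm; apply: supported_sum => i _.
apply: supportedU; apply: valid_face => //; have := ltn_ord i.
by case/and5P: vm => _ /andP[/eqP yk _] _ _ _; rewrite -yk; lia.
Qed.

Lemma boundary_boundary N k a : supported (valid N k) a -> boundary (boundary a) = 0.
Proof.
move=> va; rewrite {2}/boundary /lin /boundary lin_sum big1_seq // => m /= /va vm.
rewrite linZ lin_sum.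
have /and5P[vy /andP[/eqP yk k0] _ _ _] := vm.
case: k k0 yk vm {va} => [|[|n]] // _ yk vm; rewrite yk /=.
  by rewrite big_ord0 scaler0.
pose F i j := << face i (face j m) >> : {malg K[cell]}.
(* The face signs have exponents [n - j] and [n.-1 - i]; a constant sign is factored out to leave
   the usual exponent [i + j]. *)
suff : \sum_(j < n.+1) lin (fun m0 => \sum_(i < (nodes m0.1).-1)
    << sgn_face K (nodes m0.1) i *g face i m0 >>) << sgn_face K n.+2 j *g face j m >> =
  ((-1) ^+ n * (-1) ^+ n.-1) *: \sum_(j < n.+1) \sum_(i < n) (-1) ^+ (i + j) *: F i j.
  move=> ->; rewrite (@sum_face_face K {malg K[cell]} n F).
    by rewrite !scaler0.
  by move=> i j ij jn; rewrite /F; have -> := face_face vm ij (jn : (j.+2 < n.+2)%N).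
rewrite scaler_sumr; apply: eq_bigr => j _; rewrite linU.
have vj : valid N n.+1 (face j m) := valid_face vm (ltn_ord j : (j.+1 < n.+2)%N).
have /and5P[_ /andP[/eqP -> _] _ _ _] := vj.
rewrite /= !scaler_sumr; apply: eq_bigr => i _.
have signB p q : (q <= p)%N -> (-1) ^+ (p - q) = (-1) ^+ p * (-1) ^+ q :> K.
  by move=> qp; rewrite -signr_odd oddB // signr_addb !signr_odd.
have i_lt := ltn_ord i; have j_lt := ltn_ord j.
have jn : (j <= n)%N by lia.
have in1 : (i <= n.-1)%N by lia.
have E : sgn_face K n.+2 j * sgn_face K n.+1 i = (-1) ^+ n * (-1) ^+ n.-1 * (-1) ^+ (i + j).
  rewrite -[sgn_face _ _ j]/((-1) ^+ (n - j)) -[sgn_face _ _ i]/((-1) ^+ (n.-1 - i)).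
  rewrite (signB _ _ jn) (signB _ _ in1) exprD.
  by rewrite [LHS]mulrACA [(-1) ^+ j * _]mulrC.
by rewrite [in LHS]malgUZ !scalerA E.
Qed.
End Chains.

(** * Comparison of the cell complex with the Koszul complex *)

Section VtreeOf.
Variable gamma : nat.
Implicit Types (t : stree (dias_label gamma)).

(** Together with [critical_ex] and [compat_critical], this makes critical trees correspond
    bijectively to nonempty valid trees y. *)
Lemma vtree_of_inj t t' : critical t -> critical t' -> vtree_of t = vtree_of t' -> t = t'.
Proof.
have ne t0 : critical t0 -> exists a l r, vtree_of t0 = node a l r.
  by case: t0 => [|[a|a] l r] _; do 3 eexists.
have inj0 a a' : lift ord0 a = lift ord0 a' :> 'I_gamma.+1 -> a = a' by exact: lift_inj.
elim: t t' => [|[a|a] l IHl r IHr] [|[a'|a'] l' r'] //=.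
- by move=> _ /andP[_ /ne[? [? [? ->]]]].
- by move=> _ /and3P[/ne[? [? [? ->]]]].
- by move=> /andP[_ /ne[? [? [? ->]]]].
- case/andP => /eqP -> kr /andP[/eqP -> kr'].
  have [b [x [y E]]] := ne _ kr; have [b' [x' [y' E']]] := ne _ kr'.
  have /andP[/eqP v _] := (vtree_ofP kr).1; have /andP[/eqP v' _] := (vtree_ofP kr').1.
  move=> H; have {}H : set_root (lift ord0 a) (vtree_of r) = set_root (lift ord0 a') (vtree_of r').
    by case: H.
  have aE : a = a'.
    by apply: inj0; have := congr1 (@root_label gamma) H; rewrite E E'.
  have rE : r = r'.
    apply: (IHr _ kr kr').
    rewrite -[vtree_of r]set_root_label -[vtree_of r']set_root_label v v'.
    by have := congr1 (set_root ord0) H; rewrite !set_root_set_root.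
  by rewrite aE rE.
- by move=> _ /and3P[/ne[? [? [? ->]]]].
- by move=> /and3P[/ne[? [? [? ->]]]].
- by move=> /and3P[/ne[? [? [? ->]]]].
case/and3P => kl kr nr /and3P[kl' kr' nr'] H.
have [x E] := vtree_of_no_left kr nr; have [x' E'] := vtree_of_no_left kr' nr'.
have /andP[/eqP v _] := (vtree_ofP kl).1; have /andP[/eqP v' _] := (vtree_ofP kl').1.
have Hl : set_root (lift ord0 a) (vtree_of l) = set_root (lift ord0 a') (vtree_of l').
  by case: H.
have [b [u [w F]]] := ne _ kl; have [b' [u' [w' F']]] := ne _ kl'.
have aE : a = a'.
  by apply: inj0; have := congr1 (@root_label gamma) Hl; rewrite F F'.
have lE : l = l'.
  apply: (IHl _ kl kl').
  rewrite -[vtree_of l]set_root_label -[vtree_of l']set_root_label v v'.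
  by have := congr1 (set_root ord0) Hl; rewrite !set_root_set_root.
have rE : r = r'.
  by apply: (IHr _ kr kr'); move: H; rewrite E E' => -[_ ->].
by rewrite aE lE rE.
Qed.
End VtreeOf.

Section DualSpace.
Local Open Scope ring_scope.
Variables (K : fieldType) (S : finType) (O : operad) (g : S -> O).
Notation dual := (@in_koszul_dual K S O g).

Lemma eq_dual f f' : (forall t, f t = f' t) -> dual f -> dual f'.
Proof.
move=> E H C t1 t2 t3 i hi; have := H C t1 t2 t3 i hi; rewrite /in_R => R.
by rewrite -[RHS]R; apply: eq_bigr => p _; apply: eq_bigr => c _; rewrite !E.
Qed.

Lemma dual0 : dual (fun=> 0 : K).
Proof.
move=> C t1 t2 t3 i hi; rewrite /in_R big1 // => p _; rewrite big1 // => c _.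
by rewrite mulr0 !monalgU0 addr0.
Qed.

Lemma dual_lin (a : K) f f' : dual f -> dual f' -> dual (fun t => a * f t + f' t).
Proof.
move=> H H' C t1 t2 t3 i hi; have := H C t1 t2 t3 i hi; have := H' C t1 t2 t3 i hi.
rewrite /in_R => R' R.
rewrite -[RHS](addr0 (0 : {malg K[O]})) -[X in _ = X + _](scaler0 _ a) -[in X in _ = X + _]R.
rewrite -[X in _ = _ + X]R' scaler_sumr -big_split; apply: eq_bigr => p _.
rewrite scaler_sumr -big_split; apply: eq_bigr => c _.
apply/malgP => x; rewrite !mcoeffD mcoeffZ mcoeffD !mcoeffU.
by do 2 case: (_ == x); rewrite ?mulr1n ?mulr0n; ring.
Qed.

Lemma dual_sum I (r : seq I) (c : I -> K) (F : I -> stree S -> K) :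
  (forall i, dual (F i)) -> dual (fun t => \sum_(i <- r) c i * F i t).
Proof.
move=> H; elim: r => [|i r IHr].
  by apply: eq_dual dual0 => t; rewrite big_nil.
by apply: eq_dual (dual_lin (c i) (H i) IHr) => t; rewrite big_cons.
Qed.
End DualSpace.

Section KoszulChains.
Local Opaque dias_label.
Local Open Scope ring_scope.
Variables (gamma : nat) (K : fieldType).
Notation letter := 'I_gamma.+1.
Notation label := (dias_label gamma).
Notation vtree := (stree letter).
Notation gen := (@dias_gen gamma).
Notation cell := (stree letter * seq (seq letter))%type.
Notation boundary := (@boundary gamma K).
Notation dual_cell := (@dual_cell gamma K).
Notation kcell := (stree label * seq (Dias gamma))%type.
Implicit Types (y : vtree) (t : stree label) (m : cell).

Definition dual_span (a : {malg K[cell]}) : koszul_space K label (Dias gamma) :=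
  lin dual_cell a.

Lemma dual_spanE a t (w : seq (Dias gamma)) : mcoeff ((t, w) : kcell) (dual_span a) =
  \sum_(m <- msupp a) a@_m * (dual_elt K m.1 t *+ (m.2 == w)).
Proof.
rewrite /dual_span /lin mcoeff_sum; apply: eq_bigr => m _.
by rewrite mcoeffZ dual_cellE.
Qed.

Lemma dual_span_dual N k a (w : seq (Dias gamma)) : supported (valid N k) a ->
  in_koszul_dual gen (fun t => mcoeff ((t, w) : kcell) (dual_span a)).
Proof.
move=> va.
(* [dual_sum] asks for a dual element at every index, so cells that are not valid get 0. *)
apply: (eq_dual (f := fun t => \sum_(m <- msupp a) a@_m *
   (if valid N k m && (m.2 == w) then dual_elt K m.1 t else 0))).
  move=> t; rewrite dual_spanE; apply: eq_big_seq => m /va ->.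
  by case: (_ == w).
apply: dual_sum => m; case: (boolP (valid N k m && (m.2 == w))) => [/andP[vm _]|_]; last first.
  exact: dual0.
by apply: dual_elt_in; have /and5P[/andP[_ iy] _ _ _ _] := vm.
Qed.

Lemma dual_elt_sign y t : compat t y -> dual_elt K y t = (-1) ^+ parity t.
Proof. by rewrite /dual_elt => ->. Qed.

Lemma dual_span_chain N k a : supported (valid N k) a -> koszul_chain gen N k (dual_span a).
Proof.
move=> va; split; last by move=> w; apply: dual_span_dual va.
move=> t w; rewrite -mcoeff_neq0 dual_spanE => nz.
have [m ma hm] : exists2 m, m \in msupp a & dual_elt K m.1 t *+ (m.2 == w) != 0.
  apply/hasP; apply: contraNT nz => /hasPn H; apply/eqP; apply: big1_seq => m /= ma.
  by have /negPn/eqP -> := H m ma; rewrite mulr0.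
have /and5P[vy /andP[/eqP yk k0] /eqP wk wp /eqP wN] := va _ ma.
case: (m.2 =P w) hm => [mw|_]; last by rewrite mulr0n eqxx.
rewrite mulr1n => /dual_elt_nodes tE; rewrite tE yk -mw; split=> //.
by move=> x xm; apply/pointed_mem; exact: (allP wp).
Qed.

Lemma koszul_diff_span N k a : supported (valid N k) a ->
  koszul_diff gen (dual_span a) = dual_span (boundary a).
Proof.
move=> va.
have -> : koszul_diff gen (dual_span a) =
  lin (fun x => koszul_diff_basis K gen x.1 x.2) (dual_span a) by [].
rewrite {1}/dual_span /boundary [in LHS]/(lin dual_cell a) lin_sum.
rewrite /dual_span [in RHS]/(lin _ a) lin_sum; apply: eq_big_seq => m /va vm.
rewrite !linZ; congr (_ *: _); rewrite [RHS]lin_sum.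
have /and5P[vy _ _ _ _] := vm.
transitivity (koszul_diff gen (dual_cell m)); first reflexivity.
rewrite (koszul_diff_dual K vy); apply: eq_bigr => i _.
by rewrite linU.
Qed.

(** The coefficient at a critical tree t with words w involves a single cell, the one with tree
    [vtree_of t] and words w. *)
Lemma dual_span_inj N k a : supported (valid N k) a -> dual_span a = 0 -> a = 0.
Proof.
move=> va E; apply/malgP => -[y w].
rewrite mcoeff0; apply: mcoeff_outdom; apply/negP => ma.
have /and5P[/= vy /andP[/eqP yk k0] _ _ _] := va _ ma.
have [t kt ct] : exists2 t, critical t & compat t y.
  by apply: critical_ex; [case/andP: vy|rewrite yk].
have yE := compat_critical kt vy ct.
have : mcoeff ((t, w) : kcell) (dual_span a) = 0 by rewrite E mcoeff0.
rewrite dual_spanE (bigD1_seq (y, w)) ?fset_uniq //= eqxx mulr1n big1_seq.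
  rewrite addr0 dual_elt_sign // => /eqP; rewrite mulf_eq0 signr_eq0 orbF.
  by rewrite mcoeff_eq0 ma.
move=> [y' w'] /= /andP[ne ma']; have /and5P[/= vy' _ _ _ _] := va _ ma'.
rewrite /dual_elt; case: (boolP (compat t y')) => [ct'|_]; last by rewrite mulr0n mul0rn mulr0.
case: (w' =P w) => [wE|_]; last by rewrite mulr0n mulr0.
by case/eqP: ne; rewrite wE yE -(compat_critical kt vy' ct').
Qed.

(** The candidate is built from the coefficients of z at critical trees. Its image and z then agree
    on critical trees, hence everywhere by [dual_eq0]. *)
Lemma chain_dual_span N k z : koszul_chain gen N k z ->
  exists2 a, supported (valid N k) a & dual_span a = z.
Proof.
case=> zsupp zdual.
pose a : {malg K[cell]} := \sum_(x <- msupp z | critical x.1)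
  << (-1) ^+ parity x.1 * z@_x *g ((vtree_of x.1, x.2) : cell) >>.
have va : supported (valid N k) a.
  rewrite /a big_seq_cond; apply: supported_sum => -[t w] /andP[zt /= kt].
  have [tk wk wm wN] := zsupp _ _ zt.
  have [vv cv] := vtree_ofP kt.
  apply: supportedU; apply/and5P; split.
  - exact: vv.
  - by rewrite -(compat_leaves cv) -tk eqxx leaves_gt0.
  - exact/eqP.
  - by apply/allP => x /wm/pointed_mem.
  - exact/eqP.
exists a; first exact: va.
have spanE t w : mcoeff ((t, w) : kcell) (dual_span a) =
  \sum_(x <- msupp z | critical x.1) (-1) ^+ parity x.1 * z@_x *
     (dual_elt K (vtree_of x.1) t *+ (x.2 == w)).
  rewrite /dual_span /a lin_sum mcoeff_sum; apply: eq_bigr => x _.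
  by rewrite linU mcoeffZ dual_cellE.
apply/malgP => -[t w]; apply/eqP; rewrite -subr_eq0; apply/eqP.
pose f t := -1 * mcoeff ((t, w) : kcell) z + mcoeff ((t, w) : kcell) (dual_span a).
suff f0 : f t = 0 by rewrite addrC -mulN1r.
apply: dual_eq0 => [|{}t kt].
  by apply: dual_lin; [apply: zdual|apply: dual_span_dual va].
rewrite /f spanE mulN1r.
have Ex x : x \in msupp z -> critical x.1 -> x != (t, w) ->
    (-1) ^+ parity x.1 * z@_x * (dual_elt K (vtree_of x.1) t *+ (x.2 == w)) = 0.
  case: x => u v _ /= ku; rewrite xpair_eqE /dual_elt.
  case: (v == w); last by rewrite mulr0n mulr0.
  case: (boolP (compat t _)) => [ct|_]; last by rewrite mulr0n mul0rn mulr0.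
  by rewrite (vtree_of_inj ku kt (compat_critical kt (vtree_ofP ku).1 ct)) eqxx.
have [zt|zt] := boolP ((t, w) \in msupp z).
  rewrite big_mkcond (bigD1_seq (t, w)) ?fset_uniq //= kt.
  rewrite big1_seq => [|x /= /andP[ne xz]]; last first.
    by case: ifP => // kx; apply: Ex.
  rewrite addr0 eqxx mulr1n (dual_elt_sign (vtree_ofP kt).2) mulrC mulrA -signr_addb addbb mul1r.
  by rewrite addNr.
rewrite (mcoeff_outdom zt) oppr0 add0r; apply: big1_seq => x /= /andP[kx xz].
by apply: Ex => //; apply: contraNneq zt => <-.
Qed.
End KoszulChains.

(** * Acyclic matchings *)

Section Morse.
Local Open Scope ring_scope.
Variables (K : fieldType) (M : choiceType) (d : M -> {malg K[M]}).
(* U and its complement are matched by h.  The matching is acyclic: besides m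
   itself, the elements of U in the boundary of h m have smaller rank. *)
Variables (P : nat -> pred M) (U : pred M) (h : M -> M) (rank : M -> nat) (c : M -> K).
Variable bound : nat.
Hypothesis rank_bound : forall k m, P k m -> (rank m <= bound)%N.
Hypothesis dd0 : forall k a, supported (P k) a -> lin d (lin d a) = 0.
Hypothesis hP : forall k m, P k m -> U m -> P k.+1 (h m).
Hypothesis hU : forall k m, P k m -> ~~ U m -> exists m', [/\ P k.-1 m', U m' & h m' = m].
Hypothesis c0 : forall m, c m != 0.
Hypothesis hd : forall k m, P k m -> U m ->
  supported (fun m' => P k m' && (U m' ==> (rank m' < rank m)%N)) (d (h m) - c m *: << m >>).

Lemma supportedW (Q Q' : pred M) a : (forall m, Q m -> Q' m) ->
  supported Q a -> supported Q' (a : {malg K[M]}).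
Proof. by move=> QQ' Qa m /Qa/QQ'. Qed.

Lemma supportedB (Q : pred M) u v : supported Q u -> supported Q v ->
  supported Q (u - v : {malg K[M]}).
Proof. by move=> Qu Qv; rewrite -scaleN1r; apply/supportedD/supportedZ. Qed.

Lemma malg_sum (a : {malg K[M]}) : a = \sum_(m <- msupp a) a@_m *: << m >>.
Proof.
rewrite {1}[a]monalgE; apply: eq_bigr => m _; exact: malgUZ.
Qed.

(** Elimination from the top: subtracting multiples of the boundaries of the [h m], for the m in U
    of the highest rank, leaves elements of U of smaller rank only. *)
Lemma reduce_rank k n a : supported (fun m => P k m && (U m ==> (rank m < n)%N)) a ->
  exists2 b, supported (P k.+1) b & supported (fun m => P k m && ~~ U m) (a - lin d b).
Proof.
elim: n a => [|n IHn] a sa.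
  exists 0; first exact: supported0.
  have -> : lin d 0 = 0 by rewrite /lin msupp0 big_seq_fset0.
  by rewrite subr0; apply: supportedW sa => m; rewrite implybF.
pose sel m := U m && (rank m == n).
pose b0 : {malg K[M]} := \sum_(m <- msupp a | sel m) (a@_m / c m) *: << h m >>.
have sb0 : supported (P k.+1) b0.
  rewrite /b0 big_seq_cond; apply: supported_sum => m /andP[ma /andP[Um _]].
  apply/supportedZ/supportedU; have /andP[Pm _] := sa _ ma; exact: hP.
have [|b1 sb1 H] := IHn (a - lin d b0).
  have -> : a - lin d b0 = \sum_(m <- msupp a | ~~ sel m) a@_m *: << m >>
      - \sum_(m <- msupp a | sel m) (a@_m / c m) *: (d (h m) - c m *: << m >>).
    rewrite {1}(malg_sum a) (bigID sel) /= [X in X - _]addrC -addrA; congr (_ + _).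
    rewrite /b0 lin_sum -!sumrN -big_split; apply: eq_bigr => m _ /=.
    rewrite linZ linU scale1r scalerBr scalerA divfK // opprB.
    by [].
  apply: supportedB.
    rewrite big_seq_cond; apply: supported_sum => m /andP[ma ns].
    apply/supportedZ/supportedU; have /andP[-> /implyP Um] := sa _ ma.
    apply/implyP => Um'; have := Um Um'; rewrite ltnS leq_eqVlt.
    by move: ns; rewrite /sel Um' /= => /negPf ->.
  rewrite big_seq_cond; apply: supported_sum => m /andP[ma /andP[Um /eqP rm]].
  apply: supportedZ; have /andP[Pm _] := sa _ ma.
  by rewrite -rm; apply: hd.
exists (b0 + b1); first exact: supportedD.
have -> : lin d (b0 + b1) = lin d b0 + lin d b1 by exact: linearD.
by rewrite opprD addrA.
Qed.

Lemma coeff_diag k m : P k m -> U m -> mcoeff m (d (h m)) = c m.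
Proof.
move=> Pm Um; apply/eqP; rewrite -subr_eq0.
have -> : mcoeff m (d (h m)) - c m = mcoeff m (d (h m) - c m *: << m >>).
  by rewrite mcoeffB mcoeffZ mcoeffUU mulr1.
rewrite mcoeff_eq0; apply/negP => /(hd Pm Um)/andP[_].
by rewrite Um ltnn.
Qed.

Lemma coeff_rank k m m' : P k m -> U m -> U m' -> m != m' -> mcoeff m' (d (h m)) != 0 ->
  (rank m' < rank m)%N.
Proof.
move=> Pm Um Um' /negPf mm' nz.
have : mcoeff m' (d (h m) - c m *: << m >>) != 0.
  by rewrite mcoeffB mcoeffZ mcoeffU mm' mulr0n mulr0 subr0.
by rewrite mcoeff_neq0 => /(hd Pm Um)/andP[_]; rewrite Um'.
Qed.

(** Otherwise each of the two would occur in the boundary attached to the other one, and would have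
    smaller rank than it. *)
Lemma h_inj k m m' : P k m -> U m -> P k m' -> U m' -> h m = h m' -> m = m'.
Proof.
move=> Pm Um Pm' Um' E; apply/eqP; apply: contraT => ne.
have lt1 : (rank m' < rank m)%N.
  by apply: (coeff_rank Pm Um Um' ne); rewrite E (coeff_diag Pm' Um').
have lt2 : (rank m < rank m')%N.
  by rewrite eq_sym in ne; apply: (coeff_rank Pm' Um' Um ne); rewrite -E (coeff_diag Pm Um).
by have := ltn_trans lt1 lt2; rewrite ltnn.
Qed.

(** The support consists of elements [h m']. The coefficient of [m'] in the boundary is that of
    [h m'] times a unit, plus contributions of [h m''] with [m''] of greater rank; these vanish by
    induction downwards from [bound]. *)
Lemma cycle_eq0 k a : supported (fun m => P k m && ~~ U m) a -> lin d a = 0 -> a = 0.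
Proof.
move=> sa da0.
have dec x : x \in msupp a -> exists m', [/\ P k.-1 m', U m' & h m' = x].
  by move=> /sa/andP[Px Ux]; apply: hU Px Ux.
suff H m' : P k.-1 m' -> U m' -> a@_(h m') = 0.
  apply/malgP => x; rewrite mcoeff0.
  case: (boolP (x \in msupp a)) => [/dec[m' [Pm Um <-]]|/mcoeff_outdom //].
  exact: H.
have [j] := ubnP (bound - rank m')%N; elim: j m' => [|j IHj] m' bj Pm Um.
  by rewrite ltn0 in bj.
have : mcoeff m' (lin d a) = 0 by rewrite da0 mcoeff0.
rewrite mcoeff_lin.
have E x : x \in msupp a -> a@_x * mcoeff m' (d x) = a@_x * (c m' *+ (x == h m')).
  move=> xa; have [m'' [Pm'' Um'' xE]] := dec _ xa; rewrite -{}xE in xa *.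
  have [mm|ne] := eqVneq m'' m'.
    by rewrite mm eqxx mulr1n (coeff_diag Pm Um).
  rewrite (_ : (h m'' == h m') = false); last first.
    by apply: contra_neqF ne => /eqP; apply: h_inj Pm'' Um'' Pm Um.
  rewrite mulr0n mulr0; apply/eqP; rewrite mulf_eq0 orbC.
  case: eqP => //= /eqP nz; have lt := coeff_rank Pm'' Um'' Um ne nz.
  by rewrite IHj //; have := rank_bound Pm''; move: bj lt; clear; lia.
rewrite (eq_big_seq _ E) => S0.
case: (boolP (h m' \in msupp a)) => [ha|/mcoeff_outdom //].
move: S0; rewrite (bigD1_seq (h m')) ?fset_uniq //= eqxx mulr1n big1 => [|x /negPf ->]; last first.
  by rewrite mulr0n mulr0.
by rewrite addr0 => /eqP; rewrite mulf_eq0 (negPf (c0 _)) orbF => /eqP.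
Qed.

Lemma morse_exact k a : supported (P k) a -> lin d a = 0 ->
  exists2 b, supported (P k.+1) b & lin d b = a.
Proof.
move=> sa da0; have [|b sb H] := @reduce_rank k bound.+1 a.
  by apply: supportedW sa => m Pm; rewrite Pm ltnS (rank_bound Pm) implybT.
exists b => //; apply/eqP; rewrite -subr_eq0 -opprB oppr_eq0; apply/eqP.
apply: cycle_eq0 H _; have -> : lin d (a - lin d b) = lin d a - lin d (lin d b) by exact: linearB.
by rewrite (dd0 sb) da0 subr0.
Qed.
End Morse.

(** * The matching on cells *)

Section SeqSurgery.
Variable T : Type.
Implicit Types (w : seq T).

Definition split_at n (a b : T) w := take n w ++ [:: a, b & drop n.+1 w].

Lemma size_split n a b w : n < size w -> size (split_at n a b w) = (size w).+1.
Proof. by move=> h; rewrite size_cat /= size_drop size_takel; lia. Qed.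

Lemma nth_split x n a b w j : n < size w -> nth x (split_at n a b w) j =
  if j < n then nth x w j else if j == n then a else if j == n.+1 then b else nth x w j.-1.
Proof.
move=> h; rewrite nth_cat size_takel; last lia.
case: ltnP => jn; first by rewrite nth_take.
case: eqP => [->|jn']; first by rewrite subnn.
case: eqP => [->|jn'']; first by rewrite subSnn.
have -> : j - n = (j - n.+2).+2 by lia.
by rewrite /= nth_drop; congr (nth _ _ _); lia.
Qed.

Lemma nth_split0 x n a b w : n < size w -> nth x (split_at n a b w) n = a.
Proof. by move=> h; rewrite nth_split // ltnn eqxx. Qed.

Lemma nth_split1 x n a b w : n < size w -> nth x (split_at n a b w) n.+1 = b.
Proof. by move=> h; rewrite nth_split // ltnNge leqnSn /= gtn_eqF // eqxx. Qed.

Lemma nth_split2 x n a b w j : n < size w -> n.+1 < j ->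
  nth x (split_at n a b w) j = nth x w j.-1.
Proof. by move=> h nj; rewrite nth_split // !ifF //; lia. Qed.

Lemma drop_split n a b w j : n < size w -> n < j -> drop j.+1 (split_at n a b w) = drop j w.
Proof.
move=> h nj; rewrite drop_cat size_takel; last lia.
rewrite ifF; last lia.
have -> : j.+1 - n = (j - n.+1).+2 by lia.
by rewrite /= drop_drop; congr (drop _ _); lia.
Qed.
End SeqSurgery.

Fixpoint last_index (Q : pred nat) n :=
  if n is n'.+1 then if Q n' then n' else last_index Q n' else 0.

Lemma last_indexP (Q : pred nat) n : Q 0 -> 0 < n ->
  [/\ last_index Q n < n, Q (last_index Q n)
    & forall i, last_index Q n < i < n -> ~~ Q i].
Proof.
move=> Q0; elim: n => // n IHn _ /=; case: (boolP (Q n)) => Qn.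
  by split=> // i; lia.
case: n Qn IHn => [|n] Qn IHn; first by rewrite Q0 in Qn.
have [//|h1 h2 h3] := IHn; split=> // [|i hi]; first by lia.
by case: (eqVneq i n.+1) => [-> //|ne]; apply: h3; lia.
Qed.

Section Matching.
Variables (gamma : nat) (N : nat).
Notation letter := 'I_gamma.+1.
Notation lmax := (@Order.max _ letter).
Notation vtree := (stree letter).
Notation word := (seq letter).
Notation cell := (stree letter * seq (seq letter))%type.
Notation unit_word := [:: (@ord0 gamma)].
Notation nthw := (nth [:: (@ord0 gamma)]).
Implicit Types (y : vtree) (w : seq word) (m v : cell) (x : word).

Definition ends0 x := last ord0 x == ord0.

(* The vertex i has a left child, and its word ends with 0. *)
Definition tail i m := [&& ends0 (nthw m.2 i), 0 < i & up i.-1 m.1].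

(** Well defined because the vertex 0 is never a tail. The vertices from the stopping one onwards
    form an ascending chain, each above the preceding one. *)
Definition stop m := last_index (fun i => ~~ tail i m) (nodes m.1).

Lemma stopP m : 0 < nodes m.1 ->
  [/\ stop m < nodes m.1, ~~ tail (stop m) m &
      forall i, stop m < i < nodes m.1 -> tail i m].
Proof.
move=> m0; have [|h1 h2 h3] := @last_indexP (fun i => ~~ tail i m) (nodes m.1) _ m0.
  by rewrite /tail andbF.
by split=> // i /h3; rewrite negbK.
Qed.

Lemma stop_le n m : 0 < nodes m.1 -> (forall i, n < i < nodes m.1 -> tail i m) -> stop m <= n.
Proof.
move=> m0 H; rewrite leqNgt; apply/negP => ns; have [sm /negP P _] := stopP m0.
by apply: P; apply: H; rewrite ns.
Qed.

Lemma stop_eq n m : n < nodes m.1 -> ~~ tail n m ->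
  (forall i, n < i < nodes m.1 -> tail i m) -> stop m = n.
Proof.
move=> nm /negP Pn H; have m0 : 0 < nodes m.1 by apply: leq_ltn_trans nm.
apply/eqP; rewrite eqn_leq stop_le //= leqNgt; apply/negP => sn.
by apply: Pn; have [_ _] := stopP m0; apply; rewrite sn.
Qed.

(* A cell whose stopping vertex carries the unit word is obtained from a cell
   with one vertex less by splitting off a letter next to its stopping vertex. *)
Definition splittable m := nthw m.2 (stop m) != unit_word.

(** If the word ends with 0, the stopping vertex has no left child, as it is not a tail; its first
    letter then labels a new left leaf. If not, its last letter is nonzero and labels a new right
    leaf, for which there is room since the next vertex, if any, lies above. The new leaf carries
    the unit word. *)
Definition split_cell m : cell :=
  let n := stop m in let x := nthw m.2 n in
  if ends0 x then (ins n (head ord0 x) m.1, split_at n unit_word (behead x) m.2)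
  else (ins n.+1 (last ord0 x) m.1, split_at n (belast (head ord0 x) (behead x)) unit_word m.2).

Definition right_length m := sumn (map size (drop (stop m).+1 m.2)).

(* Orders cells lexicographically: decreasing right_length, then increasing
   length of the word at the stopping vertex. *)
Definition rank m := (N - right_length m) * N.+1 + size (nthw m.2 (stop m)).

Lemma last_word_mul p x x' : x' != [::] -> last ord0 (word_mul p x x') = lmax p.2 (last ord0 x').
Proof.
case: x' => // a x' _; rewrite /word_mul last_cat /= last_map.
by [].
Qed.

Lemma ends0_word_mul p x x' : x' != [::] -> ends0 (word_mul p x x') = (p.2 == ord0) && ends0 x'.
Proof. by move=> h; rewrite /ends0 last_word_mul // lmax_eq0. Qed.

Lemma pointed_nil x : pointed x -> x != [::].
Proof. by case: x. Qed.

Lemma nth_merge p i w j : i.+1 < size w -> nthw (merge_at p i w) j =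
  if j < i then nthw w j else if j == i then word_mul p (nthw w i) (nthw w i.+1)
  else nthw w j.+1.
Proof.
move=> h; rewrite nth_cat size_takel; last lia.
case: ltnP => ji; first by rewrite nth_take.
case: eqP => [->|ji']; first by rewrite subnn.
have -> : j - i = (j - i.+1).+1 by lia.
by rewrite /= nth_drop; congr (nth _ _ _); lia.
Qed.

Lemma drop_merge p i w j : i.+1 < size w -> i < j -> drop j (merge_at p i w) = drop j.+1 w.
Proof.
move=> h ij; rewrite drop_cat size_takel; last lia.
rewrite ifF; last lia.
have -> : j - i = (j - i.+1).+1 by lia.
by rewrite /= drop_drop; congr (drop _ _); lia.
Qed.

Lemma merge_split p n a b w : n < size w -> word_mul p a b = nthw w n ->
  merge_at p n (split_at n a b w) = w.
Proof.
move=> h E; rewrite merge_cat ?size_takel //; last lia.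
by rewrite E -drop_nth ?cat_take_drop.
Qed.

Section Cell.
Variables (k : nat) (y : vtree) (w : seq word).
Hypothesis yw_valid : valid N k (y, w).

Lemma cell_facts : [/\ valid_root y, inner_pos y, nodes y = k, size w = k
  & forall i, i < k -> pointed (nthw w i)].
Proof.
case/and5P: yw_valid => /= vy /andP[/eqP yk _] /eqP wk /allP wp _.
split=> //; first by case/andP: vy.
by move=> i ik; apply: wp; rewrite mem_nth ?wk.
Qed.

Lemma tail_face_gt i j : i.+2 < j -> j < k -> tail j.-1 (face i (y, w)) = tail j (y, w).
Proof.
have [vy iy yk wk wp] := cell_facts => ij jk.
rewrite /tail /= nth_merge ?wk //; last lia.
rewrite ifF ?ifF; try lia.
rewrite prednK; last lia.
rewrite /up lbl_del_lt ?yk; try lia.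
have -> : j.-1.-1.+1 = j.-1 by lia.
by congr andb; congr andb; lia.
Qed.

Lemma tail_face_lt i j : j < i -> i.+1 < k -> tail j (face i (y, w)) = tail j (y, w).
Proof.
have [vy iy yk wk wp] := cell_facts => ji ik.
rewrite /tail /= nth_merge ?wk // ji.
case: (posnP j) => [->|j0]; first by rewrite !andbF.
by rewrite /up lbl_del_gt ?yk //; lia.
Qed.

Lemma tail_face_merged i : i.+1 < k -> tail i.+1 (y, w) -> 0 < i -> up i.-1 (del i y) ->
  tail i (face i (y, w)).
Proof.
have [vy iy yk wk wp] := cell_facts => ik /and3P[/= e _ u] i0 A.
rewrite /tail /= nth_merge ?wk // ltnn eqxx i0 A /= andbT.
by rewrite ends0_word_mul ?pointed_nil ?wp // e andbT; exact: u.
Qed.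

Lemma up_del_merged i : i.+1 < k -> 0 < i -> up i.-1 y -> up i y -> up i.-1 (del i y).
Proof.
have [vy iy yk wk wp] := cell_facts => ik i0 A B.
have h : i.-1.+2 < nodes y by rewrite yk; lia.
have := up_adjacent iy h; rewrite prednK // A B => -[].
by move: (up _ _) (up _ _) => [] [].
Qed.

Lemma tail_face_next i : i.+2 < k -> tail i.+2 (y, w) -> up i y ->
  tail i.+1 (face i (y, w)).
Proof.
have [vy iy yk wk wp] := cell_facts => ik /and3P[/= e _ u] A.
rewrite /tail /= nth_merge ?wk //; last lia.
rewrite ifF ?ifF ?e /=; try lia.
have := up_adjacent iy (i := i); rewrite yk => /(_ ik) [].
by rewrite A u; move: (up _ _) (up _ _) => [] [].
Qed.

(** A merge which avoids the stopping vertex keeps it stopping, with its unit word. To its right,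
    tails merge into tails; to its left, only a merge of its two predecessors could matter, and
    [up_adjacent] shows that it still has no left child. *)
Lemma not_splittable_face i : ~~ splittable (y, w) -> i.+1 < k ->
  i != stop (y, w) -> i.+1 != stop (y, w) -> ~~ splittable (face i (y, w)).
Proof.
have [vy iy yk wk wp] := cell_facts; rewrite /splittable negbK => /eqP /= wu ik ip ip'.
have k0 : 0 < nodes (y, w).1 by rewrite /= yk; lia.
have [pk np tp] := stopP k0; move: wu ip ip' pk np tp; set p := stop _ => wu ip ip' /= pk np tp.
rewrite yk in pk tp.
have fk : nodes (face i (y, w)).1 = k.-1 by rewrite /= nodes_del yk.
case: (ltnP i p) => hip.
  have hip' : i.+1 < p by lia.
  have E : stop (face i (y, w)) = p.-1.
    apply: stop_eq; rewrite ?fk; first lia.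
      case: (ltnP i.+2 p) => h; first by rewrite tail_face_gt.
      have pE : p = i.+2 by lia.
      move: np; rewrite /tail wu pE /= => B.
      have := up_adjacent iy (i := i); rewrite yk => /(_ _)[|-> _ _]; first by lia.
      by rewrite (negPf B) !andbF.
    move=> j hj; rewrite -[j]/(j.+1.-1) tail_face_gt; try lia.
    by apply: tp; lia.
  rewrite E negbK nth_merge ?wk // ifF ?ifF; try lia.
  by rewrite prednK ?wu //; lia.
have {hip ip ip'} pi : p < i by lia.
have E : stop (face i (y, w)) = p.
  apply: stop_eq; rewrite ?fk; first lia.
    by rewrite tail_face_lt.
  move=> j hj; case: (ltngtP j i) => ji.
  - by rewrite tail_face_lt //; apply: tp; lia.
  - case: (eqVneq j i.+1) => ji'.
      rewrite ji'; apply: tail_face_next; [lia|apply: tp; lia|].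
      by have /and3P[_ _] : tail i.+1 (y, w) by apply: tp; lia.
    by rewrite -[j]/(j.+1.-1) tail_face_gt; try lia; apply: tp; lia.
  rewrite ji; apply: tail_face_merged => //; [by apply: tp; lia|by lia|].
  apply: up_del_merged => //; first by lia.
    by have /and3P[_ _] : tail i (y, w) by apply: tp; lia.
  by have /and3P[_ _] : tail i.+1 (y, w) by apply: tp; lia.
by rewrite E negbK nth_merge ?wk // pi wu.
Qed.
End Cell.

Lemma word_last x : pointed x -> ~~ ends0 x ->
  let x' := belast (head ord0 x) (behead x) in
  [/\ x = rcons x' (last ord0 x), last ord0 x != ord0 & pointed x'].
Proof.
case: x => // a x px h; split=> //=; first by rewrite -lastI.
have {}h : (last a x == ord0) = false by apply: negbTE.
by move: px; rewrite /pointed lastI -cats1 count_cat /= h !addn0.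
Qed.

Lemma word_head x : pointed x -> ends0 x -> x != unit_word ->
  [/\ x = head ord0 x :: behead x, head ord0 x != ord0, ends0 (behead x)
    & pointed (behead x)].
Proof.
case: x => // a [|b x]; rewrite /pointed /ends0 /=.
  by move=> _ /eqP ->; rewrite eqxx.
move=> px e _; suff a0 : a != ord0 by split=> //; move: px; rewrite (negPf a0).
apply/eqP => a0; move: px; rewrite a0 eqxx add1n eqSS.
have : has (pred1 ord0) (b :: x) by apply/hasP; exists (last b x); rewrite ?mem_last.
by rewrite has_count /= lt0n => /negPf ->.
Qed.

Lemma word_mul0r c x : word_mul (ord0, c) x unit_word = rcons x c.
Proof. by rewrite /word_mul map_max0 /= letter_mul0 cats1. Qed.

Lemma word_mul0l c x : word_mul (c, ord0) unit_word x = c :: x.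
Proof. by rewrite /word_mul map_max0 /= letter_mul0. Qed.

(* q, c, a, b as in split_cell m = (ins q c m.1, split_at (stop m) a b m.2) *)
Inductive split_spec m q (c : letter) (a b : word) : Prop :=
  SplitSpec of c != ord0 & pointed a & pointed b
    & del (stop m) (ins q c m.1) = m.1
    & word_mul (lbl (stop m) (ins q c m.1)) a b = nthw m.2 (stop m)
    & size a + size b = size (nthw m.2 (stop m))
    & [/\ q = (stop m).+1, b = unit_word & ~~ up (stop m) (ins q c m.1)] \/
      [/\ q = stop m, a = unit_word, up (stop m) (ins q c m.1), ends0 b
        & stop m = 0 \/ ~~ up (stop m).-1 m.1].

Lemma split_cellP k m : valid N k m -> splittable m ->
  exists q c a b, split_cell m = (ins q c m.1, split_at (stop m) a b m.2) /\
    split_spec m q c a b.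
Proof.
case: m => y w vm; have [vy iy yk wk wp] := cell_facts vm.
have k0 : 0 < nodes (y, w).1 by rewrite /= yk; case/and5P: vm => _ /andP[].
have [/= nk nt tn] := stopP k0; move: nk nt tn.
rewrite /splittable /split_cell; set n := stop (y, w) => nk nt tn /= U.
have px : pointed (nthw w n) by apply: wp; rewrite -yk.
case: ifP => e.
  have [xE c0 eb pb] := word_head px e U; set c := head _ _ in xE c0 *.
  have hn : n = 0 \/ ~~ up n.-1 y.
    by move: nt; rewrite /tail /= e /=; case: (posnP n) => [|_]; [left|right].
  have [dE lE] := ins_below_right iy c0 nk hn.
  exists n, c, unit_word, (behead (nthw w n)); split=> //; split=> //=.
  - by rewrite lE word_mul0l -xE.
  - by rewrite [in RHS]xE.
  - by right; split=> //; rewrite /up lE eqxx.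
have [xE c0 pa] := word_last px (negbT e); set c := last _ _ in xE c0 *.
have hn : n.+1 = nodes y \/ up n y.
  case: (eqVneq n.+1 (nodes y)) => h; [by left|right].
  have /and3P[_ _] : tail n.+1 (y, w); last by [].
  by apply: tn; move: nk h; clear; lia.
have [dE lE] := ins_below_left iy c0 nk hn.
set x' := belast _ _ in xE pa *.
exists n.+1, c, x', unit_word; split=> //; split=> //=.
- by rewrite lE word_mul0r -xE.
- by rewrite [in RHS]xE size_rcons addn1.
- by left; split=> //; rewrite /up lE.
Qed.

Lemma sumn_drop (s : seq nat) n : sumn (drop n s) <= sumn s.
Proof. by rewrite -{2}(cat_take_drop n s) sumn_cat leq_addl. Qed.

Lemma stop_word_le v : stop v < size v.2 -> sumn (map size v.2) = N ->
  right_length v + size (nthw v.2 (stop v)) <= N.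
Proof.
move=> h <-; rewrite /right_length -[in X in _ <= X](cat_take_drop (stop v) v.2).
by rewrite (drop_nth unit_word h) map_cat sumn_cat /=; lia.
Qed.

Section Split.
Variables (k : nat) (m : cell).
Hypotheses (vm : valid N k m) (sm : splittable m).

Lemma nodes_k : nodes m.1 = k. Proof. by case/and5P: vm => _ /andP[/eqP]. Qed.
Lemma size_k : size m.2 = k. Proof. by case/and5P: vm => _ _ /eqP. Qed.
Lemma sum_N : sumn (map size m.2) = N. Proof. by case/and5P: vm => _ _ _ _ /eqP. Qed.

Lemma stop_k : [/\ stop m < k, ~~ tail (stop m) m & forall i, stop m < i < k -> tail i m].
Proof. by rewrite -nodes_k; apply: stopP; rewrite nodes_k; case/and5P: vm => _ /andP[]. Qed.

Lemma valid_split : valid N k.+1 (split_cell m).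
Proof.
have [q [c [a [b [-> [c0 pa pb _ _ sab _]]]]]] := split_cellP vm sm.
have [nk _ _] := stop_k.
have /and5P[vy /andP[_ k0] _ wp _] := vm.
rewrite /valid /= valid_root_ins ?nodes_k // nodes_ins nodes_k eqxx size_split ?size_k // eqxx /=.
have wE : m.2 = take (stop m) m.2 ++ nthw m.2 (stop m) :: drop (stop m).+1 m.2.
  by rewrite -drop_nth ?cat_take_drop // size_k.
rewrite /split_at; apply/andP; split.
  by move: wp; rewrite {1}wE !all_cat /= pa pb => /and3P[-> _ ->].
rewrite -sum_N [in X in _ == X]wE !map_cat !sumn_cat /= -sab; apply/eqP; lia.
Qed.

Lemma face_split : face (stop m) (split_cell m) = m.
Proof.
have [q [c [a [b [-> [_ _ _ dE wE _ _]]]]]] := split_cellP vm sm.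
have [nk _ _] := stop_k.
by rewrite /face /= dE merge_split ?size_k // -surjective_pairing.
Qed.

Lemma tail_split j : (stop m).+1 < j <= k -> tail j (split_cell m).
Proof.
move=> hj; have vs := valid_split; have [nk _ tn] := stop_k.
case: (ltnP (stop m).+2 j) => h.
  have fE := face_split; move: vs fE; case: (split_cell m) => y' w' vs fE.
  by rewrite -(tail_face_gt vs h) ?fE; [apply: tn|]; lia.
have {h hj} [-> h'] : j = (stop m).+2 /\ (stop m).+1 < k by lia.
have /and3P[e _ u] : tail (stop m).+1 m by apply: tn; lia.
have [q [c [a [b [E [c0 _ _ dE _ _ _]]]]]] := split_cellP vm sm; rewrite E /tail /=.
rewrite nth_split2 ?size_k // e /=.
have iy : inner_pos (ins q c m.1).
  by have /and5P[/andP[_ ?] _ _ _ _] := vm; apply: inner_ins.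
have hs : (stop m).+2 < nodes (ins q c m.1) by rewrite nodes_ins nodes_k.
have [] := up_adjacent iy hs; rewrite dE u.
by move: (up _ _) (up _ _) => [] [].
Qed.

(** The new leaf becomes the stopping vertex: it has no left child, and in the left case the old
    vertex, now with a left child and a word still ending with 0, is a tail. *)
Lemma stop_split : stop (split_cell m) =
    (if ends0 (nthw m.2 (stop m)) then stop m else (stop m).+1) /\
  ~~ splittable (split_cell m).
Proof.
have ts j := @tail_split j; have fs := face_split; have vs := valid_split.
have [nk _ tn] := stop_k.
have [q [c [a [b [E [c0 pa pb dE wE sab H]]]]]] := split_cellP vm sm.
have nk' : (stop m).+1 < nodes (split_cell m).1 by rewrite E /= nodes_ins nodes_k.
have sk : nodes (split_cell m).1 = k.+1 by rewrite E /= nodes_ins nodes_k.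
have iy : inner_pos (ins q c m.1).
  by have /and5P[/andP[_ ?] _ _ _ _] := vm; apply: inner_ins.
case: H => [[qE bE nu]|[qE aE nu eb hn]].
  have eF : ends0 (nthw m.2 (stop m)) = false.
    rewrite -wE ends0_word_mul bE //; apply/negbTE; rewrite negb_and.
    by move: nu; rewrite /up => ->.
  have sE : stop (split_cell m) = (stop m).+1.
    apply: stop_eq => //; last by move=> i hi; apply: ts; rewrite sk ltnS in hi.
    by rewrite E /tail /= (negPf nu) !andbF.
  rewrite eF sE; split=> //; rewrite /splittable sE negbK E /= nth_split1 ?size_k //.
  by rewrite bE.
have eT : ends0 (nthw m.2 (stop m)).
  by rewrite -wE ends0_word_mul ?pointed_nil // eb andbT; exact: nu.
have sE : stop (split_cell m) = stop m.
  apply: stop_eq; first exact: ltnW.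
    rewrite E /tail /=; case: (posnP (stop m)) => [|n0]; first by rewrite !andbF.
    have hn' : ~~ up (stop m).-1 m.1 by case: hn => // n0'; rewrite n0' in n0.
    have hs : (stop m).-1.+2 < nodes (ins q c m.1) by rewrite nodes_ins nodes_k prednK.
    have [] := up_adjacent iy hs; rewrite prednK // dE (negPf hn') andFb.
    by move: (up _ _) (up _ _) => [] []; rewrite ?andbF.
  move=> i; rewrite sk ltnS => /andP[hi ik].
  case: (ltnP (stop m).+1 i) => h; first by apply: ts; rewrite h.
  have -> : i = (stop m).+1 by apply/eqP; rewrite eqn_leq h.
  by rewrite E /tail /= nu nth_split1 ?size_k // eb.
rewrite eT sE; split=> //; rewrite /splittable sE negbK E /= nth_split0 ?size_k //.
by rewrite aE.
Qed.

Lemma special_face i : i < k -> splittable (face i (split_cell m)) ->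
  i = stop (split_cell m) \/ i.+1 = stop (split_cell m).
Proof.
move=> ik sf; have [_ nsp] := stop_split; have vs := valid_split.
case: (eqVneq i (stop (split_cell m))) => [|h1]; first by left.
case: (eqVneq i.+1 (stop (split_cell m))) => [|h2]; first by right.
move: vs nsp sf h1 h2; case: (split_cell m) => y' w' vs nsp sf h1 h2.
by have := not_splittable_face vs nsp ik h1 h2; rewrite sf.
Qed.

Lemma rank_lt v : valid N k v ->
  right_length m < right_length v \/
  right_length m = right_length v /\ size (nthw v.2 (stop v)) < size (nthw m.2 (stop m)) ->
  rank v < rank m.
Proof.
move=> vv; have /and5P[_ /andP[/eqP fn k0] /eqP fw _ /eqP fN] := vv.
have [nk _ _] := stop_k.
have := @stop_word_le m; rewrite size_k sum_N => /(_ nk erefl).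
have := @stop_word_le v; rewrite fw fN.
have [] := @stopP v; rewrite fn // => sv _ _ /(_ sv erefl).
rewrite /rank; clear; nia.
Qed.

(** The new right leaf is merged with the next vertex, whose word becomes longer by one letter. The
    stopping vertex does not move to the right, so this letter is counted. *)
Lemma rank_face_right i : i = (stop m).+1 -> i < k -> ~~ ends0 (nthw m.2 (stop m)) ->
  right_length m < right_length (face i (split_cell m)).
Proof.
move=> iE ik nE; have ts j := @tail_split j; have vs := valid_split.
have [nk _ tn] := stop_k.
have vf : valid N k (face i (split_cell m)) by apply: (valid_face vs).
have /and5P[_ /andP[/eqP fn k0] /eqP fw _ _] := vf.
have [q [c [a [b [E [c0 pa pb dE wE sab H]]]]]] := split_cellP vm sm.
have iy : inner_pos (ins q c m.1).
  by have /and5P[/andP[_ ?] _ _ _ _] := vm; apply: inner_ins.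
case: H => [[qE bE nu]|[qE aE nu eb hn]]; last first.
  by case/negP: nE; rewrite -wE ends0_word_mul ?pointed_nil // eb andbT; exact: nu.
have sk : i.+1 < size (split_at (stop m) a b m.2) by rewrite size_split ?size_k.
have fle : stop (face i (split_cell m)) <= stop m.
  apply: stop_le; rewrite fn // => j /andP[nj jk].
  have tS : tail i.+1 (split_cell m) by apply: ts; rewrite iE ltnSn -iE.
  have [/eqP jE|jE] := boolP (j == i).
    have /and3P[_ _ u] : tail (stop m).+1 m by apply: tn; rewrite ltnSn -iE.
    rewrite jE; move: vs; rewrite E => vs; rewrite E in tS.
    apply: (tail_face_merged vs) => //; first by rewrite iE.
    have hs : (stop m).+2 < nodes (ins q c m.1) by rewrite nodes_ins nodes_k ltnS -iE.
    have [] := up_adjacent iy hs; rewrite dE u iE /=.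
    by move: (up _ _) (up _ _) => [] [].
  have ij : i < j by move: nj jE; rewrite iE; clear; lia.
  have tSj : tail j.+1 (split_cell m).
    by apply: ts; move: nj jk; clear; lia.
  have tS2 : i.+2 <= k -> tail i.+2 (split_cell m).
    by move=> h; apply: ts; rewrite h iE ltnW.
  move: vs tS tSj tS2; case: (split_cell m) => y' w' vs tS tSj tS2.
  case: (eqVneq j i.+1) => jE'.
    rewrite jE' in jk *; apply: (tail_face_next vs) => //; first exact: tS2.
    by have /and3P[] := tS.
  rewrite -[j]/(j.+1.-1) (tail_face_gt vs) //.
  by move: ij jE'; clear; lia.
have : sumn (map size (drop (stop m).+1 (face i (split_cell m)).2)) <=
       right_length (face i (split_cell m)).
  rewrite /right_length -{1}(subnK (fle : (stop (face i (split_cell m))).+1 <= (stop m).+1)).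
  by rewrite -drop_drop map_drop sumn_drop.
apply: leq_trans; rewrite -iE (drop_nth unit_word) ?fw // /right_length.
rewrite -iE (drop_nth unit_word) ?size_k //=.
rewrite E /= nth_merge // ltnn eqxx drop_merge // size_word_mul.
rewrite drop_split ?size_k //; last by rewrite iE ltnS ltnW.
have -> : nthw (split_at (stop m) a b m.2) i = b by rewrite iE nth_split1 ?size_k.
have -> : nthw (split_at (stop m) a b m.2) i.+1 = nthw m.2 i.
  by rewrite nth_split2 ?size_k // iE.
by rewrite bE.
Qed.

(** The new left leaf is merged with the vertex before it. The stopping vertex is again the old one,
    whose word has lost its first letter, and nothing changes to its right. *)
Lemma rank_face_left i : i.+1 = stop m -> ends0 (nthw m.2 (stop m)) ->
  right_length m = right_length (face i (split_cell m)) /\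
  size (nthw (face i (split_cell m)).2 (stop (face i (split_cell m)))) < size (nthw m.2 (stop m)).
Proof.
move=> iS eT; have ts j := @tail_split j; have vs := valid_split.
have [nk _ tn] := stop_k.
have ik : i < k by rewrite ltnW // iS.
have vf : valid N k (face i (split_cell m)) by apply: (valid_face vs).
have /and5P[_ /andP[/eqP fn k0] /eqP fw _ _] := vf.
have [q [c [a [b [E [c0 pa pb dE wE sab H]]]]]] := split_cellP vm sm.
have iy : inner_pos (ins q c m.1).
  by have /and5P[/andP[_ ?] _ _ _ _] := vm; apply: inner_ins.
case: H => [[qE bE nu]|[qE aE nu eb hn]].
  move: eT; rewrite -wE ends0_word_mul bE // => /andP[e _].
  by case/negP: nu.
have hn' : ~~ up i m.1 by case: hn; rewrite -iS.
have fE : stop (face i (split_cell m)) = stop m.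
  apply: stop_eq; rewrite ?fn //.
    have hs : i.+2 < nodes (ins q c m.1) by rewrite nodes_ins nodes_k ltnS iS.
    have [] := up_adjacent iy hs; rewrite iS dE (negPf hn') /= => X _ _.
    by rewrite E /tail -iS /= X !andbF.
  move=> j /andP[nj jk]; have tSj : tail j.+1 (split_cell m) by apply: ts; rewrite ltnS nj.
  move: vs tSj; case: (split_cell m) => y' w' vs tSj.
  by rewrite -[j]/(j.+1.-1) (tail_face_gt vs) // iS.
have sk : i.+1 < size (split_at (stop m) a b m.2) by rewrite size_split ?size_k // ltnS iS ltnW.
rewrite /right_length fE E /= drop_merge //; last by rewrite -iS ltnW.
have h1 : (stop m < i) = false by rewrite -iS ltnNge leqnSn.
have h2 : (stop m == i) = false by rewrite -iS gtn_eqF.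
rewrite drop_split ?size_k // nth_merge // h1 h2.
by rewrite nth_split1 ?size_k // -sab aE.
Qed.

Lemma rank_face i : i < k -> i != stop m -> splittable (face i (split_cell m)) ->
  rank (face i (split_cell m)) < rank m.
Proof.
move=> ik ne sf; have [sE _] := stop_split; have vs := valid_split.
have := special_face ik sf; rewrite {}sE => sp.
apply: (rank_lt (valid_face vs (ik : i.+1 < k.+1))); move: sp.
case: ifP => e [iE|iE].
- by rewrite iE eqxx in ne.
- by right; apply: rank_face_left.
- by left; apply: rank_face_right; rewrite ?e.
by case: iE ne => ->; rewrite eqxx.
Qed.
End Split.
End Matching.

(** * Cells obtained by splitting *)

Section Unsplit.
Variables (gamma N : nat).
Notation letter := 'I_gamma.+1.
Notation vtree := (stree letter).
Notation word := (seq letter).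
Notation cell := (stree letter * seq (seq letter))%type.
Notation unit_word := [:: (@ord0 gamma)].
Notation nthw := (nth [:: (@ord0 gamma)]).
Implicit Types (y : vtree) (w : seq word) (m v : cell) (x : word).

Lemma split_merge p n w : n.+1 < size w ->
  split_at n (nthw w n) (nthw w n.+1) (merge_at p n w) = w.
Proof.
move=> h; rewrite /split_at drop_merge // /merge_at take_size_cat; last first.
  by rewrite size_takel // ltnW // ltnW.
by rewrite -take_nth2.
Qed.

Lemma belast_head_rcons x (c : letter) :
  belast (head ord0 (rcons x c)) (behead (rcons x c)) = x.
Proof. by case: x => //= a x; rewrite belast_rcons. Qed.

Section Cell.
Variables (k : nat) (y : vtree) (w : seq word).
Hypothesis yw_valid : valid N k (y, w).
Let p := stop (y, w).
Hypothesis p_unit : nthw w p = unit_word.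

Lemma unsplit_facts : [/\ p < k, p = 0 \/ ~~ up p.-1 y & forall i, p < i < k -> tail i (y, w)].
Proof.
have [vy iy yk wk wp] := cell_facts yw_valid.
have [] := @stopP gamma (y, w); first by rewrite /= yk; case/and5P: yw_valid => _ /andP[].
rewrite /= yk -/p => pk; rewrite /tail /= p_unit => np tp; split=> //.
by case: (posnP p) np => [-> _|_ np]; [left|right].
Qed.

(** By the second hypothesis the next vertex, if any, lies above n too, so [p] is a leaf with parent
    n. Merging them appends a nonzero letter to the word of n, which is then no tail and becomes the
    stopping vertex. *)
Lemma unsplit_right n : p = n.+1 -> p.+1 = k \/ up n (del n y) ->
  [/\ valid N k.-1 (face n (y, w)), splittable (face n (y, w))
    & split_cell (face n (y, w)) = (y, w)].
Proof.
have [vy iy yk wk wp] := cell_facts yw_valid => pE hb.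
have [pk np tp] := unsplit_facts.
have nk : n.+1 < k by rewrite -pE.
have nu : ~~ up n y by case: np; rewrite pE.
have vf : valid N k.-1 (face n (y, w)) by apply: (valid_face yw_valid).
have fn : nodes (face n (y, w)).1 = k.-1 by case/and5P: vf => _ /andP[/eqP].
have hy : n.+1 < nodes y by rewrite yk.
have up' : n.+2 < k -> up n (del n y).
  by move=> h; case: hb => // hk; move: h; rewrite -hk pE ltnn.
have lE : lbl n y = (ord0, (lbl n y).2).
  by have := lbl_down iy hy; rewrite nu => /eqP E; rewrite -{1}E -surjective_pairing.
set c := (lbl n y).2 in lE; have c0 : c != ord0 by exact: nu.
have wE : nthw (face n (y, w)).2 n = rcons (nthw w n) c.
  by rewrite nth_merge /= ?wk // ltnn eqxx lE -pE p_unit word_mul0r.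
have yE : y = ins n.+1 c (del n y).
  apply: del_ins_left => //; case: (eqVneq n.+2 (nodes y)) => h; [by left|right].
  have h2 : n.+2 < k by rewrite -yk ltn_neqAle h yk.
  rewrite up' // andbT; have /and3P[_ _] // : tail n.+2 (y, w).
  by apply: tp; rewrite pE ltnSn.
have eF : ends0 (rcons (nthw w n) c) = false by rewrite /ends0 last_rcons (negPf c0).
have sE : stop (face n (y, w)) = n.
  apply: stop_eq; rewrite ?fn; first by rewrite -ltnS prednK // (leq_trans _ nk).
    by rewrite /tail wE eF.
  move=> j /andP[nj jk]; have {}jk : j.+1 < k by move: jk; clear; lia.
  have tj : tail j.+1 (y, w) by apply: tp; rewrite pE ltnS nj.
  case: (ltnP n.+1 j) => h; first by rewrite -[j]/(j.+1.-1) (tail_face_gt yw_valid).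
  have {nj h} jE : j = n.+1 by apply/eqP; rewrite eqn_leq h.
  rewrite jE in jk tj *; rewrite /tail /= up' // nth_merge ?wk // ltnNge leqnSn /= gtn_eqF //=.
  by have /and3P[-> _ _] := tj.
split=> //.
  rewrite /splittable sE wE; apply/eqP => /(congr1 (last ord0)).
  by rewrite last_rcons /=; apply/eqP.
rewrite /split_cell sE wE eF last_rcons belast_head_rcons -yE.
by congr pair; rewrite -[RHS](@split_merge (lbl n y) n) ?wk // -pE p_unit.
Qed.

(** Here the next vertex lies below the preceding one, if any, so [p] is a leaf with parent [p.+1].
    Merging them prepends a nonzero letter to a word ending with 0, at a vertex left without left
    child. *)
Lemma unsplit_left : p.+1 < k -> p = 0 \/ ~~ up p.-1 (del p.-1 y) ->
  [/\ valid N k.-1 (face p (y, w)), splittable (face p (y, w))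
    & split_cell (face p (y, w)) = (y, w)].
Proof.
have [vy iy yk wk wp] := cell_facts yw_valid => pk1 hb.
have [pk np tp] := unsplit_facts.
have vf : valid N k.-1 (face p (y, w)) by apply: (valid_face yw_valid).
have fn : nodes (face p (y, w)).1 = k.-1 by case/and5P: vf => _ /andP[/eqP].
have hy : p.+1 < nodes y by rewrite yk.
have /and3P[/= e _ u] : tail p.+1 (y, w) by apply: tp; rewrite ltnSn.
have lE : lbl p y = ((lbl p y).1, ord0).
  by have /eqP E : up p y := u; rewrite -E -surjective_pairing.
set c := (lbl p y).1 in lE; have c0 : c != ord0 by rewrite /c lbl_down // negbK.
have wE : nthw (face p (y, w)).2 p = c :: nthw w p.+1.
  by rewrite nth_merge /= ?wk // ltnn eqxx lE p_unit word_mul0l.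
have nu : p = 0 \/ ~~ up p.-1 (del p y).
  case: (posnP p) => p0; [by left|right].
  have hy' : p.-1.+2 < nodes y by rewrite prednK.
  have {}np : ~~ up p.-1 y by case: np => // E; rewrite E in p0.
  have {}hb : ~~ up p.-1 (del p.-1 y) by case: hb => // E; rewrite E in p0.
  by have [] := up_adjacent iy hy'; rewrite prednK // np hb /= => _ _ <-.
have yE : y = ins p c (del p y).
  apply: del_ins_right => //; case: np => [|np]; first by left.
  by case: nu => [|->]; [left|right; rewrite andbT].
have eT : ends0 (c :: nthw w p.+1).
  have := pointed_nil (wp _ pk1); move: e; rewrite /ends0 /=.
  by case: (nthw w p.+1).
have sE : stop (face p (y, w)) = p.
  apply: stop_eq; rewrite ?fn; first by rewrite -ltnS prednK // (leq_trans _ pk1).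
    rewrite /tail /=; case: nu => [->|/negPf ->]; by rewrite !andbF.
  move=> j /andP[nj jk]; have {}jk : j.+1 < k by move: jk; clear; lia.
  have tj : tail j.+1 (y, w) by apply: tp; rewrite ltnS ltnW.
  case: (ltnP p.+1 j) => h; first by rewrite -[j]/(j.+1.-1) (tail_face_gt yw_valid).
  have {nj h} jE : j = p.+1 by apply/eqP; rewrite eqn_leq h.
  by rewrite jE in jk tj *; apply: (tail_face_next yw_valid).
split=> //.
  rewrite /splittable sE wE; apply/eqP => /(congr1 (head ord0)) /=.
  by apply/eqP.
rewrite /split_cell sE wE eT /= -yE.
by congr pair; rewrite -[RHS](@split_merge (lbl p y) p) ?wk // p_unit.
Qed.
End Cell.

(** A stopping vertex with the unit word is a leaf; its parent is the lower of its two neighbours,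
    and this decides which merge recovers the original cell. *)
Lemma unsplit k v : 1 < N -> valid N k v -> ~~ splittable v ->
  exists m, [/\ valid N k.-1 m, splittable m & split_cell m = v].
Proof.
case: v => y w N1 vv; rewrite /splittable negbK => /eqP /= pu.
have [vy iy yk wk wp] := cell_facts vv; have [pk np tp] := unsplit_facts vv pu.
(* A single vertex with the unit word has total length 1. This is the one unmatched cell, which
   accounts for the unit operad. *)
have k1 : 1 < k.
  case: k pk wk {yk vv wp tp} (vv) => // -[|//] pk wk vv.
  have p0 : stop (y, w) = 0 by move: pk; case: (stop _).
  move: wk pu vv N1; rewrite p0; case: w {pk p0 np} => [|x [|]] //= _ ->.
  by case/and5P => _ _ _ _ /eqP <-.
case: (posnP (stop (y, w))) => p0.
  by exists (face (stop (y, w)) (y, w)); apply: unsplit_left => //; [rewrite p0|left].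
have pE : stop (y, w) = (stop (y, w)).-1.+1 by rewrite prednK.
case: (boolP (((stop (y, w)).+1 == k) || up (stop (y, w)).-1 (del (stop (y, w)).-1 y))) => hb.
  exists (face (stop (y, w)).-1 (y, w)); apply: unsplit_right => //.
  by case/orP: hb => [/eqP|]; [left|right].
move: hb; rewrite negb_or => /andP[h1 h2].
exists (face (stop (y, w)) (y, w)); apply: unsplit_left => //; last by right.
by rewrite ltn_neqAle h1.
Qed.
End Unsplit.

(** * Exactness in arities greater than 1 *)

Section Acyclic.
Variables (gamma : nat) (K : fieldType).
Local Open Scope ring_scope.
Notation cell := (stree 'I_gamma.+1 * seq (seq 'I_gamma.+1))%type.

Lemma rank_bound N k (m : cell) : valid N k m -> (rank N m <= N * N.+1 + N)%N.
Proof.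
move=> vm; have /and5P[_ /andP[/eqP mk k0] /eqP wk _ /eqP mN] := vm.
have := @stop_word_le gamma N m; rewrite wk mN.
have [] := @stopP gamma m; rewrite mk // => sk _ _ /(_ sk erefl).
rewrite /rank => h; apply: leq_add; last by move: h; clear; lia.
by rewrite leq_mul2r leq_subr orbT.
Qed.

Lemma sgn_face_neq0 k i : sgn_face K k i != 0.
Proof. by rewrite /sgn_face signr_eq0. Qed.

Lemma supported_split N k (m : cell) : valid N k m -> splittable m ->
  supported (fun m' => valid N k m' && (splittable m' ==> (rank N m' < rank N m)%N))
   (\sum_(i < (nodes (split_cell m).1).-1)
      << sgn_face K (nodes (split_cell m).1) i *g face i (split_cell m) >>
    - sgn_face K (nodes m.1).+1 (stop m) *: << m >>).
Proof.
move=> vm sm; have vs := valid_split vm sm; have mk := nodes_k vm.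
have [sk _ _] := stop_k vm.
have sn : nodes (split_cell m).1 = k.+1 by case/and5P: vs => _ /andP[/eqP].
rewrite sn mk /= (bigD1 (Ordinal sk)) //= (face_split vm sm) malgUZ addrAC subrr add0r.
apply: supported_sum => i ne; apply: supportedU; apply/andP; split.
  by apply: (valid_face vs); rewrite ltnS ltn_ord.
by apply/implyP => sf; apply: (rank_face vm sm).
Qed.

Lemma boundary_exact N k (a : {malg K[cell]}) : (1 < N)%N ->
  supported (valid N k) a -> boundary a = 0 ->
  exists2 b, supported (valid N k.+1) b & boundary b = a.
Proof.
move=> N1; apply: (morse_exact (U := @splittable gamma) (h := @split_cell gamma)
  (rank := rank N) (c := fun m => sgn_face K (nodes m.1).+1 (stop m))
  (bound := (N * N.+1 + N)%N) (P := valid N)).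
- by move=> j m; apply: rank_bound.
- by move=> j b; apply: boundary_boundary.
- by move=> j m; apply: valid_split.
- by move=> j m; apply: unsplit.
- by move=> m; apply: sgn_face_neq0.
- by move=> j m; apply: supported_split.
Qed.

Lemma dias_acyclic : koszul_acyclic K (@dias_gen gamma).
Proof.
move=> N k z N1 /chain_dual_span[a va <-]; rewrite (koszul_diff_span va) => da0.
have {}da0 : boundary a = 0.
  exact: (dual_span_inj (supported_boundary va)).
have [b vb <-] := boundary_exact N1 va da0.
exists (dual_span b); first exact: dual_span_chain.
exact: koszul_diff_span vb.
Qed.
End Acyclic.

Theorem theorem2p3p1 (K : fieldType) (charK : [pchar K]%R =i pred0)
    (gamma : nat) :
  koszul_operad K (Dias gamma) /\
  pbw_basis (@dias_gen gamma) (@hook_tree gamma).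
Proof.
split; last exact: hook_pbw_basis.
exists (dias_label gamma), (@dias_gen gamma).
by split; [apply: dias_binary_quadratic | apply: dias_acyclic].
Qed.
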